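(* Let $P$ be a finite poset and $Q$ a closed subposet of $P$. Then $Q$ is collared in $P$ if and only if there exists a PL homeomorphism $h\colon|P|\to|P^+_Q|$ that keeps $|P\setminus\lfloor Q\rfloor|$ fixed and extends the obvious homeomorphism $|Q|\to|Q\times\{1\}|$.
   Context: All posets are finite; all maps and homeomorphisms of polyhedra are PL. For a poset $P$, $|P|$ denotes the polyhedron given by the geometric realization of the simplicial complex of nonempty chains of $P$; for a subposet $Q\subset P$, $|Q|$ is regarded as a subpolyhedron of $|P|$. A subposet $Q$ of $P$ is closed if $p\le q\in Q$ implies $p\in Q$. $\lfloor Q\rfloor=\{p\in P: p\ge q\text{ for some }q\in Q\}$. For $q\in P$, $\mathrm{lk}(q,P)=\{x\in P: x>q\}$. A closed subposet $Q$ of $P$ is collared in $P$ if for every $q\in Q$, $|\mathrm{lk}(q,P)|$ is homeomorphic to the cone over $|\mathrm{lk}(q,Q)|$ by a homeomorphism keeping $|\mathrm{lk}(q,Q)|$ fixed (the cone over $\emptyset$ being a point). $I$ denotes the $1$-simplex viewed as the poset of nonempty subsets of $\{0,1\}$ ordered by inclusion, with minimal elements $\{0\}$ and $\{1\}$; $Q\times I$ has the product order, and $Q\times\{0\}$, $Q\times\{1\}$ denote the copies of $Q$ in $Q\times I$ over these two minimal elements. $P^+_Q$ is the poset $P\cup_{Q=Q\times\{0\}}Q\times I$ obtained from $P\sqcup(Q\times I)$ by identifying $Q\subset P$ with $Q\times\{0\}$ (two classes satisfy $x\le y$ iff they have representatives $x'\le y'$ in $P$ or in $Q\times I$). *)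

(* Defs.v *)
From HB Require Import structures.
From mathcomp Require Import all_boot all_order all_algebra.
From mathcomp Require Import generic_quotient.
From mathcomp Require Import boolp classical_sets reals.

Set Implicit Arguments.
Unset Strict Implicit.
Unset Printing Implicit Defensive.

Import Order.TTheory GRing.Theory Num.Theory.

Local Open Scope ring_scope.
Local Open Scope order_scope.
Local Open Scope quotient_scope.

Section PL.
Variable R : realType.

(* The solution set of a finite system of non-strict affine inequalities. *)
Definition convex_cell (V : vectType R) (C : set V) : Prop :=
  exists (n : nat) (phi : 'I_n -> {scalar V}) (b : 'I_n -> R),
    C = [set x | forall i, phi i x <= b i]%classic.

Definition affine_on (V W : vectType R) (C : set V) (f : V -> W) : Prop :=
  exists (L : {linear V -> W}) (c : W), forall x, C x -> f x = (L x + c)%R.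

(* Only the restriction of [f] to [X] matters.  [X] is written as a finite
   union of closed convex cells on each of which [f] is affine; as the cells
   are closed, [f] is continuous on [X]. *)
Definition pl_on (V W : vectType R) (X : set V) (f : V -> W) : Prop :=
  exists (n : nat) (C : 'I_n -> set V),
    (forall i, convex_cell (C i) /\ affine_on (C i) f) /\
    X = [set x | exists i, C i x]%classic.

Definition pl_homeo (V W : vectType R) (X : set V) (Y : set W)
    (f : V -> W) : Prop :=
  [/\ pl_on X f, (forall x, X x -> Y (f x)) &
      exists g : W -> V,
        [/\ pl_on Y g, (forall y, Y y -> X (g y)),
            (forall x, X x -> g (f x) = x) &
            (forall y, Y y -> f (g y) = y)]].

(* The cone over [X] with apex [(0, 1)] and base [X x {0}]; the cone over the
   empty set is the apex. *)
Definition cone (V : vectType R) (X : set V) : set (V * R^o)%type :=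
  [set y | y = (0%R, 1%R) \/
     exists (x : V) (t : R), [/\ X x, (0 <= t)%R, (t <= 1)%R &
                                 y = ((1 - t) *: x, t)%R]]%classic.

Definition cone_base (V : vectType R) (x : V) : (V * R^o)%type := (x, 0%R).

(* [|S|] for a subposet [S] of [P], in barycentric coordinates, as a subset of
   [R^P]; thus [|P|] is [realization [set: P]] and [|S|] is a subset of it. *)
Definition realization d (P : finPOrderType d) (S : {set P}) :
    set {ffun P -> R^o} :=
  [set x | [/\ forall p, (0 <= x p)%R,
               (\sum_p x p = 1)%R,
               forall p, x p != 0%R -> p \in S &
               forall p q, x p != 0%R -> x q != 0%R -> p >=< q]]%classic.

(* In barycentric coordinates, the simplicial map induced by [g] on vertices. *)
Definition pushforward (S T : finType) (g : S -> T) (x : {ffun S -> R^o}) :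
    {ffun T -> R^o} :=
  [ffun t => (\sum_(s | g s == t) x s)%R].

Definition restriction (T : finType) (S : {set T}) (x : {ffun T -> R^o}) :
    {ffun {t | t \in S} -> R^o} :=
  [ffun s => x (val s)].

End PL.

Definition closed_subposet d (P : finPOrderType d) (Q : {set P}) : Prop :=
  forall p q : P, p <= q -> q \in Q -> p \in Q.

Definition upper_set d (P : finPOrderType d) (Q : {set P}) : {set P} :=
  [set p : P | [exists q in Q, q <= p]].

(* [link q S] is lk(q, S). *)
Definition link d (P : finPOrderType d) (q : P) (S : {set P}) : {set P} :=
  [set x in S | q < x].

Definition collared (R : realType) d (P : finPOrderType d) (Q : {set P}) :
    Prop :=
  forall q : P, q \in Q ->
    exists h : {ffun P -> R^o} -> ({ffun P -> R^o} * R^o)%type,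
      pl_homeo (realization (R := R) (link q [set: P]))
               (cone (realization (R := R) (link q Q))) h /\
      forall x, realization (link q Q) x -> h x = cone_base x.

(* The poset I, ordered by inclusion. *)
Definition interval_poset : finType := {A : {set 'I_2} | A != finset.set0}.

Lemma set1_neq0 (T : finType) (a : T) : [set a]%SET != finset.set0.
Proof. by apply/set0Pn; exists a; rewrite finset.in_set1. Qed.

Definition vertex (a : 'I_2) : interval_poset := exist _ [set a]%SET (set1_neq0 a).
Definition I0 : interval_poset := vertex ord0.
Definition I1 : interval_poset := vertex ord_max.

Section Pplus.
Variables (d : Order.disp_t) (P : finPOrderType d) (Q : {set P}).

Definition disjoint_sum : finType := (P + {q | q \in Q} * interval_poset)%type.

Definition sum_le (x y : disjoint_sum) : bool :=
  match x, y with
  | inl p, inl p' => p <= p'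
  | inr (q, i), inr (q', i') => (val q <= val q') && (val i \subset val i')
  | _, _ => false
  end.

(* Sends [(q, {0})] to [q] and fixes everything else: its fibres are the
   classes of the identification of [Q x {0}] with [Q]. *)
Definition to_P (x : disjoint_sum) : disjoint_sum :=
  match x with
  | inr (q, i) => if i == I0 then inl (val q) else x
  | inl _ => x
  end.

Definition glue (x y : disjoint_sum) : bool := to_P x == to_P y.

Lemma glue_refl : reflexive glue.
Proof. by move=> x; rewrite /glue. Qed.
Lemma glue_sym : symmetric glue.
Proof. by move=> x y; rewrite /glue eq_sym. Qed.
Lemma glue_trans : transitive glue.
Proof. by move=> y x z; rewrite /glue => /eqP -> /eqP ->. Qed.

Canonical glue_equiv := EquivRel glue glue_refl glue_sym glue_trans.

(* The proof that [Q] is closed is only used to get a partial order. *)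
Definition pplus (clQ : closed_subposet Q) := {eq_quot glue_equiv}.

Variable clQ : closed_subposet Q.

HB.instance Definition _ := EqQuotient.on (pplus clQ).
HB.instance Definition _ := Choice.on (pplus clQ).
HB.instance Definition _ := Countable.on (pplus clQ).
HB.instance Definition _ : isFinite (pplus clQ) :=
  CanIsFinite (@reprK _ (pplus clQ)).

Definition pplus_le (x y : pplus clQ) : bool :=
  [exists x' : disjoint_sum, exists y' : disjoint_sum,
     [&& \pi_(pplus clQ) x' == x, \pi_(pplus clQ) y' == y & sum_le x' y']].

Definition coords (x : disjoint_sum) : P * {set 'I_2} :=
  match x with
  | inl p => (p, val I0)
  | inr (q, i) => (val q, val i)
  end.

Lemma glue_coords x y : glue x y = (coords x == coords y).
Proof.
have toK z : coords (to_P z) = coords z.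
  by case: z => [p|[q i]] //=; case: eqP => [->|].
apply/eqP/eqP => [E|]; first by rewrite -toK E toK.
have I0E (i : interval_poset) : (i == I0) = (val i == val I0) by [].
case: x => [p|[q i]]; case: y => [p'|[q' i']] /= => - [].
- by move=> ->.
- by move=> -> /eqP; rewrite eq_sym -I0E => ->.
- by move=> -> /eqP; rewrite -I0E => ->.
- by move=> /val_inj -> /val_inj ->.
Qed.

Lemma eq_pi_coords x y :
  (\pi_(pplus clQ) x == \pi_(pplus clQ) y) = (coords x == coords y).
Proof. by rewrite -glue_coords; apply/eqP/idP => /eqmodP. Qed.

Lemma pplus_leE x y :
  pplus_le (\pi_(pplus clQ) x) (\pi_(pplus clQ) y) =
  ((coords x).1 <= (coords y).1) && ((coords x).2 \subset (coords y).2).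
Proof.
apply/existsP/andP => [[x' /existsP[y' /and3P[]]]|[le1 le2]].
  rewrite !eq_pi_coords => /eqP <- /eqP <-.
  by case: x' => [p|[q i]]; case: y' => [p'|[q' i']] //=; case/andP.
have in0 (i : interval_poset) : val i \subset val I0 -> val i = val I0.
  by rewrite subset1 (negPf (valP i)) orbF => /eqP.
case: x y le1 le2 => [p|[q i]] [p'|[q' i']] /= le1 le2.
- by exists (inl p); apply/existsP; exists (inl p'); rewrite !eqxx.
- have Qp : p \in Q := clQ le1 (valP q').
  exists (inr (Sub p Qp, I0)); apply/existsP; exists (inr (q', i')).
  by rewrite !eq_pi_coords /= !eqxx le1.
- exists (inl (val q)); apply/existsP; exists (inl p').
  by rewrite !eq_pi_coords /= (in0 _ le2) !eqxx.
- exists (inr (q, i)); apply/existsP; exists (inr (q', i')).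
  by rewrite !eqxx /= le1.
Qed.

Lemma pplus_le_refl : reflexive pplus_le.
Proof. by move=> x; rewrite -[x]reprK pplus_leE lexx subxx. Qed.

Lemma pplus_le_anti : antisymmetric pplus_le.
Proof.
move=> x y; rewrite -[x]reprK -[y]reprK !pplus_leE.
case/andP=> /andP[l1 s1] /andP[l2 s2].
apply/eqP; rewrite eq_pi_coords.
case: (coords _) (coords _) l1 s1 l2 s2 => [a b] [a' b'] /= l1 s1 l2 s2.
by rewrite xpair_eqE eq_le l1 l2 finset.eqEsubset s1 s2.
Qed.

Lemma pplus_le_trans : transitive pplus_le.
Proof.
move=> y x z; rewrite -[x]reprK -[y]reprK -[z]reprK !pplus_leE.
case/andP=> l1 s1 /andP[l2 s2].
by rewrite (le_trans l1 l2) (fintype.subset_trans s1 s2).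
Qed.

HB.instance Definition _ := Order.Le_isPOrder.Build d (pplus clQ)
  pplus_le_refl pplus_le_anti pplus_le_trans.

Definition pplus_incl (p : P) : pplus clQ := \pi_(pplus clQ) (inl p).
Definition pplus_cyl (q : {q | q \in Q}) (i : interval_poset) : pplus clQ :=
  \pi_(pplus clQ) (inr (q, i)).

End Pplus.

(* Main.v *)
Require Import Defs.
From HB Require Import structures.
From mathcomp Require Import all_boot all_order all_algebra.
From mathcomp Require Import generic_quotient.
From mathcomp Require Import boolp classical_sets reals.
From mathcomp Require Import lra.

Set Implicit Arguments.
Unset Strict Implicit.
Unset Printing Implicit Defensive.

Import Order.TTheory GRing.Theory Num.Theory.

(** Points of a realization are treated without the normalisation of their
    total mass: [chain_cone S] is the cone over [|S|].  There the join of two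
    posets is a product, and a map defined on a link extends homogeneously to
    the star.  The realization of the poset with the collar attached is
    replaced by [cylinder Q], the set of pairs [(x, t)] with [x] in [|P|],
    [0 <= t <= 1], and [x] in [|Q|] unless [t = 0] ([pl_inverse_cylinder]).  So
    both directions concern homeomorphisms from [|P|] to the cylinder that lift
    [|Q|] to height one.

    From collars to a homeomorphism.  The collar is raised over one element [q]
    of [Q] after the other.  When it has been raised over [U], the space reached
    is the part of the cylinder below the graph of the mass carried by [U]
    ([partial_cylinder]).  Passing to [q |: U] only moves the star of [q].  In
    this star a point is a part not above [q] together with a part above [q];
    by the collar of the link of [q], extended homogeneously, the latter lies in
    the cone over [lk(q,Q)] times a half-line with coordinate [tau].  As [tau]
    and the height [t] never are both positive, they merge into the real number
    [s = t - tau], and the space becomes the region below the same graph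
    ([flat_star]).  Now an explicit map, linear on three sectors of the plane of
    [(x q, s)], adds [x q] to [s] and keeps the total mass ([raise]).  It is the
    identity where [x q = 0], so it extends by the identity off the star; these
    homeomorphisms compose to the one wanted ([collared_cylinder]).

    From a homeomorphism to collars.  Let [k] be a homeomorphism from [|P|] to
    the cylinder with [k x = (x, 1)] on [|Q|], and let [q] be in [Q].  Near an
    interior point [x0] of the simplex of a maximal chain [sigma] of elements
    [<= q], the space [|P|] is a product of that simplex with the cone over
    [lk(q,P)], and near [(x0, 1)] the cylinder is a product of it with the cone
    over [lk(q,Q)] and a half-line.  A cancellation of the common factor is
    available because [k] fixes it: a piecewise linear map has a differential at
    each point ([pl_differential]), and if [x0] lies on no wall of a cell that
    is transverse to the simplex ([generic_point]), then the differential
    commutes with translations along the simplex.  It therefore induces a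
    conewise linear homeomorphism from the cone over [lk(q,P)] to the cone over
    [lk(q,Q)] times a half-line, which is the identity over [lk(q,Q)]
    ([link_map_pl]).  It need not preserve the mass, and projecting it radially
    to the links would not be piecewise linear; instead, it is composed with a
    homeomorphism that rescales the vertices of a derived subdivision
    ([pseudo_radial]).  The composite preserves the mass, and its restriction to
    mass one is the collar of the link ([link_collared]). *)

(** * Piecewise linear maps on polyhedra *)

Section PLCalculus.
Variable R : realType.
Local Open Scope ring_scope.
Local Open Scope classical_set_scope.
Implicit Types U V W : vectType R.

Definition packed_linear V W (f : V -> W) (lf : linear f) : {linear V -> W} :=
  HB.pack f (GRing.isLinear.Build R V W _ f lf).

Lemma convex_cell_fin V (I : finType) (phi : I -> {scalar V}) (b : I -> R)
    (C : set V) :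
  (forall x, C x <-> forall i, phi i x <= b i) -> convex_cell C.
Proof.
move=> CE; exists #|I|, (phi \o enum_val), (b \o enum_val).
apply/predeqP => x; split=> [/CE h i|h]; first exact: h.
by apply/CE => i; rewrite -(enum_rankK i); apply: h.
Qed.

Lemma convex_cellT V : convex_cell [set: V].
Proof.
exists 0%N, (fun=> \0 : {linear V -> R^o}), (fun=> 0).
by apply/predeqP => x; split=> // _ [].
Qed.

Lemma convex_cellI V (C D : set V) :
  convex_cell C -> convex_cell D -> convex_cell (C `&` D).
Proof.
move=> [n [phi [b ->]]] [m [psi [c ->]]].
apply: (@convex_cell_fin V ('I_n + 'I_m)%type
  (fun i => match i with inl i => phi i | inr j => psi j end)
  (fun i => match i with inl i => b i | inr j => c j end)).
move=> x; split=> [[h1 h2] [i|j]|h]; [exact: h1|exact: h2|].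
by split=> [i|j]; [apply: (h (inl i))|apply: (h (inr j))].
Qed.

Lemma convex_cell_preim V W (D : set W) (L : {linear V -> W}) c :
  convex_cell D -> convex_cell [set x | D (L x + c)].
Proof.
move=> [n [phi [b ->]]].
have lin i : linear (fun x => phi i (L x) : R^o).
  by move=> a x y; rewrite !linearP.
exists n, (fun i => packed_linear (lin i) : {scalar V}),
  (fun i => b i - phi i c).
by apply/predeqP => x; split=> h i /=; have := h i; rewrite /= raddfD lerBrDr.
Qed.

Lemma pl_on_bigU V W (I : finType) (D : I -> set V) X (f : V -> W) :
    (forall i, pl_on (D i) f) -> (forall x, X x <-> exists i, D i x) ->
  pl_on X f.
Proof.
move=> hD XE; have [n hn] := choice hD; pose C i := projT1 (cid (hn i)).
have [hc hU] : (forall i j, convex_cell (C i j) /\ affine_on (C i j) f) /\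
    (forall i, D i = [set x | exists j, C i j x]).
  by split=> i; have [] := projT2 (cid (hn i)).
pose C' (t : {i : I & 'I_(n i)}) := C (tag t) (tagged t).
exists #|{: {i : I & 'I_(n i)}}|, (C' \o enum_val); split=> [i|]; first exact: hc.
apply/predeqP => x; split=> [/XE[i]|[i Ci]]; last first.
  by apply/XE; exists (tag (enum_val i)); rewrite hU; exists (tagged (enum_val i)).
rewrite hU => -[j Cj]; exists (enum_rank (Tagged (fun i => 'I_(n i)) j)).
by rewrite /= enum_rankK.
Qed.

Lemma pl_on_cell V W (C : set V) (f : V -> W) :
  convex_cell C -> affine_on C f -> pl_on C f.
Proof.
move=> cC aC; exists 1%N, (fun=> C); split=> //.
by apply/predeqP => x; split=> [|[]//]; exists ord0.
Qed.

Lemma pl_on_cells V W (I : finType) (C : I -> set V) X (f : V -> W) :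
    (forall i, convex_cell (C i)) -> (forall i, affine_on (C i) f) ->
    (forall x, X x <-> exists i, C i x) ->
  pl_on X f.
Proof. by move=> h1 h2; apply: pl_on_bigU => i; apply: pl_on_cell. Qed.

Lemma pl_onU V W X Y (f : V -> W) :
  pl_on X f -> pl_on Y f -> pl_on (X `|` Y) f.
Proof.
move=> pX pY; apply: (@pl_on_bigU _ _ bool (fun b => if b then X else Y)).
  by case.
move=> x; split=> [[]|[[]]]; by [exists true|exists false|left|right].
Qed.

Lemma affine_on_sub V W (C D : set V) (f : V -> W) :
  D `<=` C -> affine_on C f -> affine_on D f.
Proof. by move=> sub [L [c h]]; exists L, c => x /sub; apply: h. Qed.

Lemma affine_on_eq V W (C : set V) (f g : V -> W) :
  (forall x, C x -> f x = g x) -> affine_on C f -> affine_on C g.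
Proof. by move=> fg [L [c h]]; exists L, c => x Cx; rewrite -fg ?h. Qed.

Lemma pl_on_eq V W X (f g : V -> W) :
  (forall x, X x -> f x = g x) -> pl_on X f -> pl_on X g.
Proof.
move=> fg [n [C [hC XE]]]; exists n, C; split=> // i.
split; [by case: (hC i)|apply: (affine_on_eq _ (proj2 (hC i)))].
by move=> x Cx; apply: fg; rewrite XE; exists i.
Qed.

Lemma pl_on_seteq V W X Y (f : V -> W) :
  (forall x, X x <-> Y x) -> pl_on X f -> pl_on Y f.
Proof. by move=> /predeqP ->. Qed.

Lemma affine_on_comp U V W (C : set U) (D : set V) (f : U -> V) (g : V -> W) :
    affine_on C f -> affine_on D g ->
  affine_on (C `&` [set x | D (f x)]) (g \o f).
Proof.
move=> [L [c hL]] [M [e hM]].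
have lin : linear (fun x => M (L x)) by move=> a x y; rewrite !linearP.
exists (packed_linear lin), (M c + e) => x [Cx Dx] /=.
by rewrite hM // hL // raddfD addrA.
Qed.

(** Each cell of [f] meets the preimages of the cells of [g] in convex cells, as
    [f] is affine there.  Points of [X] mapped outside [Y] are left out, so this
    also shows that preimages of polyhedra are polyhedra. *)
Lemma pl_on_comp_preim U V W X (Y : set V) (f : U -> V) (g : V -> W) :
  pl_on X f -> pl_on Y g -> pl_on (X `&` [set x | Y (f x)]) (g \o f).
Proof.
move=> [n [C [hC XE]]] [m [D [hD YE]]].
apply: (@pl_on_cells _ _ ('I_n * 'I_m)%type
         (fun ij => C ij.1 `&` [set x | D ij.2 (f x)])).
- move=> [i j] /=; have [cC [L [c hL]]] := hC i; have [cD _] := hD j.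
  have -> : C i `&` [set x | D j (f x)] = C i `&` [set x | D j (L x + c)].
    by apply/predeqP => x; split=> -[Cx Dx]; split; rewrite //= ?hL // -hL.
  exact/convex_cellI/convex_cell_preim.
- by move=> [i j] /=; apply: affine_on_comp; [case: (hC i)|case: (hD j)].
- move=> x; rewrite XE YE; split=> [[[i Ci] [j Dj]]|[[i j] [Ci Dj]]].
    by exists (i, j).
  by split; [exists i|exists j].
Qed.

Lemma pl_on_comp U V W X (Y : set V) (f : U -> V) (g : V -> W) :
    pl_on X f -> pl_on Y g -> (forall x, X x -> Y (f x)) ->
  pl_on X (fun x => g (f x)).
Proof.
move=> pf pg XY; apply: pl_on_seteq (pl_on_comp_preim pf pg) => x.
by split=> [[]|Xx]//; split=> //; apply: XY.
Qed.

(** A constant map is affine on every cell, so only the existence of the cells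
    remains. *)
Definition polyhedron V (X : set V) := pl_on X (fun=> 0 : R^o).

Lemma pl_on_affine V W X (f : V -> W) :
  polyhedron X -> affine_on [set: V] f -> pl_on X f.
Proof.
move=> [n [C [hC XE]]] af; exists n, C; split=> // i; split.
  by case: (hC i).
exact: affine_on_sub af.
Qed.

Lemma pl_on_linear V W X (f : V -> W) :
  polyhedron X -> linear f -> pl_on X f.
Proof.
move=> pX lf; apply: pl_on_affine => //; exists (packed_linear lf), 0 => x _.
by rewrite addr0.
Qed.

Lemma pl_on_id V X : polyhedron X -> pl_on X (fun x : V => x).
Proof. by move=> pX; apply: pl_on_linear. Qed.

Lemma pl_on_cst V W X (c : W) : polyhedron X -> pl_on X (fun _ : V => c).
Proof.
move=> pX; apply: pl_on_affine => //; exists \0, c => x _.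
by rewrite /= add0r.
Qed.

Lemma pl_on_poly V W X (f : V -> W) : pl_on X f -> polyhedron X.
Proof.
move=> [n [C [hC XE]]]; exists n, C; split=> // i; split.
  by case: (hC i).
by exists \0, 0 => x _; rewrite /= addr0.
Qed.

Lemma polyhedronT V : polyhedron [set: V].
Proof.
by apply: pl_on_cell; [apply: convex_cellT|exists \0, 0 => x; rewrite /= addr0].
Qed.
Hint Resolve polyhedronT : core.

Lemma pl_on_preim V W X (Y : set W) (f : V -> W) :
  pl_on X f -> polyhedron Y -> polyhedron (X `&` [set x | Y (f x)]).
Proof. by move=> pf pY; apply: pl_on_poly (pl_on_comp_preim pf pY). Qed.

Lemma polyhedronI V (X Y : set V) :
  polyhedron X -> polyhedron Y -> polyhedron (X `&` Y).
Proof. by move=> /pl_on_id pX pY; apply: pl_on_preim pX pY. Qed.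

Lemma polyhedronU V (X Y : set V) :
  polyhedron X -> polyhedron Y -> polyhedron (X `|` Y).
Proof. exact: pl_onU. Qed.

Lemma pl_on_sub V W X Y (f : V -> W) :
  pl_on X f -> polyhedron Y -> Y `<=` X -> pl_on Y f.
Proof.
by move=> pf /pl_on_id pY sub; apply: pl_on_comp pY pf sub.
Qed.

Lemma polyhedron0 V : polyhedron (set0 : set V).
Proof.
by apply: (@pl_on_cells _ _ void (fun=> set0)); [case|case|split=> // -[]].
Qed.

Lemma polyhedron_const V (b : Prop) : polyhedron [set _ : V | b].
Proof.
case: (pselect b) => hb; [apply: pl_on_seteq (polyhedronT V)|
  apply: pl_on_seteq (polyhedron0 V)]; by move=> x; split.
Qed.

Lemma polyhedron_bigI V (I : finType) (X : I -> set V) :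
  (forall i, polyhedron (X i)) -> polyhedron [set x | forall i, X i x].
Proof.
move=> pX; suff H (s : seq I) : polyhedron [set x | forall i, i \in s -> X i x].
  by apply: pl_on_seteq (H (enum I)) => x; split=> h i *; apply: h;
    rewrite ?mem_enum.
elim: s => [|i s IH]; first by apply: pl_on_seteq (polyhedronT V) => x; split.
apply: pl_on_seteq (polyhedronI (pX i) IH) => x; split=> [[h1 h2] j|h].
  by rewrite inE => /orP[/eqP->//|]; apply: h2.
by split=> [|j js]; apply: h; rewrite inE ?eqxx ?js ?orbT.
Qed.

Lemma pl_on_add V W X (f g : V -> W) :
  pl_on X f -> pl_on X g -> pl_on X (fun x => f x + g x).
Proof.
move=> [n [C [hC XE]]] [m [D [hD YE]]].
apply: (@pl_on_cells _ _ ('I_n * 'I_m)%type (fun ij => C ij.1 `&` D ij.2)).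
- by move=> [i j]; apply: convex_cellI; [case: (hC i)|case: (hD j)].
- move=> [i j] /=; have [_ [L [c hL]]] := hC i; have [_ [M [e hM]]] := hD j.
  have lin : linear (fun x => L x + M x).
    by move=> a x y; rewrite !linearP scalerDr addrACA.
  exists (packed_linear lin), (c + e) => x [Cx Dx].
  by rewrite hL // hM //= addrACA.
- move=> x; split=> [Xx|[[i j] [Ci _]]]; last by rewrite XE; exists i.
  have [i Ci] : exists i, C i x by rewrite XE in Xx.
  have [j Dj] : exists j, D j x by rewrite YE in Xx.
  by exists (i, j).
Qed.

Lemma pl_on_comp_linear U V W X (f : U -> V) (g : V -> W) :
  pl_on X f -> linear g -> pl_on X (fun x => g (f x)).
Proof.
by move=> pf lg; apply: (pl_on_comp pf (pl_on_linear (@polyhedronT V) lg)).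
Qed.

Lemma pl_on_scale V W X (a : R) (f : V -> W) :
  pl_on X f -> pl_on X (fun x => a *: f x).
Proof.
move=> pf; apply: (pl_on_comp_linear (g := fun y => a *: y) pf).
by move=> b x y; rewrite scalerDr !scalerA mulrC.
Qed.

Lemma pl_on_scalel V W X (f : V -> R^o) (w : W) :
  pl_on X f -> pl_on X (fun x => f x *: w).
Proof.
move=> pf; apply: (pl_on_comp_linear (g := fun y : R^o => y *: w) pf).
by move=> b x y; rewrite scalerDl scalerA.
Qed.

Lemma pl_on_opp V W X (f : V -> W) :
  pl_on X f -> pl_on X (fun x => - f x).
Proof.
move=> /(pl_on_scale (- 1)); apply: pl_on_eq => x _; exact: scaleN1r.
Qed.

Lemma pl_on_subr V W X (f g : V -> W) :
  pl_on X f -> pl_on X g -> pl_on X (fun x => f x - g x).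
Proof. by move=> pf /pl_on_opp; apply: pl_on_add. Qed.

Lemma pl_on_fst U V W X (f : U -> V * W) :
  pl_on X f -> pl_on X (fun x => (f x).1).
Proof. by move=> pf; apply: (pl_on_comp_linear (g := fst) pf). Qed.

Lemma pl_on_snd U V W X (f : U -> V * W) :
  pl_on X f -> pl_on X (fun x => (f x).2).
Proof. by move=> pf; apply: (pl_on_comp_linear (g := snd) pf). Qed.

Lemma pl_on_pair U V W X (f : U -> V) (g : U -> W) :
  pl_on X f -> pl_on X g -> pl_on X (fun x => (f x, g x)).
Proof.
move=> pf pg.
have := pl_on_add (pl_on_comp_linear (g := fun y => (y, 0) : V * W) pf _)
                  (pl_on_comp_linear (g := fun y => (0, y) : V * W) pg _).
move=> h; apply: pl_on_eq (h _ _) => [x _|a x y|a x y].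
- by congr (_, _); rewrite /= ?addr0 ?add0r.
- by congr (_, _); rewrite /= scaler0 addr0.
- by congr (_, _); rewrite /= scaler0 addr0.
Qed.

Lemma pl_on_sum V W X (I : finType) (A : pred I) (f : I -> V -> W) :
    polyhedron X -> (forall i, A i -> pl_on X (f i)) ->
  pl_on X (fun x => \sum_(i | A i) f i x).
Proof.
move=> pX pf; suff H (s : seq I) : pl_on X (fun x => \sum_(i <- s | A i) f i x).
  exact: H.
elim: s => [|i s IH].
  by apply: pl_on_eq (pl_on_cst 0 pX) => x _; rewrite big_nil.
case: (boolP (A i)) => Ai.
  by apply: pl_on_eq (pl_on_add (pf i Ai) IH) => x _; rewrite big_cons Ai.
by apply: pl_on_eq IH => x _; rewrite big_cons (negPf Ai).
Qed.

Lemma pl_on_coord V (T : finType) X (f : V -> {ffun T -> R^o}) t :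
  pl_on X f -> pl_on X (fun x => f x t).
Proof.
move=> pf.
apply: (pl_on_comp_linear (g := fun y : {ffun T -> R^o} => y t : R^o) pf).
by move=> a x y; rewrite !ffunE.
Qed.

(** The map is the sum of its coordinates times the vectors of the standard
    basis. *)
Lemma pl_on_ffun V (T : finType) X (f : T -> V -> R^o) :
    polyhedron X -> (forall t, pl_on X (f t)) ->
  pl_on X (fun x => [ffun t => f t x] : {ffun T -> R^o}).
Proof.
move=> pX pf.
pose e t : {ffun T -> R^o} := [ffun u => (u == t)%:R].
have p : pl_on X (fun x => \sum_t f t x *: e t).
  by apply: pl_on_sum => // t _; apply: pl_on_scalel.
apply: pl_on_eq p => x _; apply/ffunP => u.
rewrite sum_ffunE ffunE (bigD1 u) //= !ffunE eqxx [_ *: _]mulr1 big1 ?addr0 //.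
by move=> t tu; rewrite !ffunE eq_sym (negPf tu) [_ *: _]mulr0.
Qed.

Lemma pl_on_le V W X (f : V -> W) (a b : V -> R^o) :
    pl_on X f -> pl_on X a -> pl_on X b ->
  pl_on (X `&` [set x | (a x : R) <= b x]) f.
Proof.
move=> pf pa pb.
have pH : polyhedron [set y : R^o | (y : R) <= 0].
  have lin : linear (fun y : R^o => y) by [].
  apply: pl_on_cell; last by exists \0, 0 => x; rewrite /= addr0.
  apply: (@convex_cell_fin _ unit (fun=> packed_linear lin : {scalar R^o}) (fun=> 0)).
  by move=> x; split=> [? []|/(_ tt)].
have pZ := pl_on_preim (pl_on_subr pa pb) pH.
apply: pl_on_sub pf _ _; last by move=> x [].
by apply: pl_on_seteq pZ => x /=; rewrite subr_le0.
Qed.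

(** Where [a] and [b] agree, both formulas for [h] hold; so the two closed parts
    of [X] may be glued. *)
Lemma pl_on_if V W X (f g h : V -> W) (a b : V -> R^o) :
    pl_on X f -> pl_on X g -> pl_on X a -> pl_on X b ->
    (forall x, X x -> (a x : R) <= b x -> h x = f x) ->
    (forall x, X x -> (b x : R) <= a x -> h x = g x) ->
  pl_on X h.
Proof.
move=> pf pg pa pb hf hg.
have p1 : pl_on (X `&` [set x | (a x : R) <= b x]) h.
  by apply: pl_on_eq (pl_on_le pf pa pb) => x [Xx l]; rewrite hf.
have p2 : pl_on (X `&` [set x | (b x : R) <= a x]) h.
  by apply: pl_on_eq (pl_on_le pg pb pa) => x [Xx l]; rewrite hg.
apply: pl_on_seteq (pl_onU p1 p2) => x; split=> [[]|Xx]; try by case.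
by case: (leP (a x : R) (b x)) => [|/ltW]; [left|right].
Qed.

Lemma pl_on_max V X (a b : V -> R^o) :
    pl_on X a -> pl_on X b ->
  pl_on X (fun x => Num.max (a x : R) (b x) : R^o).
Proof.
move=> pa pb; apply: (pl_on_if pb pa pa pb) => x _ h.
  exact: max_r.
exact: max_l.
Qed.

Lemma pl_on_min V X (a b : V -> R^o) :
    pl_on X a -> pl_on X b ->
  pl_on X (fun x => Num.min (a x : R) (b x) : R^o).
Proof.
move=> pa pb; apply: (pl_on_if pa pb pa pb) => x _ h.
  exact: min_l.
exact: min_r.
Qed.

Lemma polyhedron_le V (a b : V -> R^o) :
    pl_on [set: V] a -> pl_on [set: V] b ->
  polyhedron [set x | (a x : R) <= b x].
Proof.
move=> pa pb; apply: pl_on_seteq (pl_on_le (polyhedronT V) pa pb) => x.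
by split=> [[]|].
Qed.

Lemma polyhedron_eq V (a b : V -> R^o) :
    pl_on [set: V] a -> pl_on [set: V] b ->
  polyhedron [set x | (a x : R) = b x].
Proof.
move=> pa pb.
apply: pl_on_seteq (polyhedronI (polyhedron_le pa pb) (polyhedron_le pb pa)).
by move=> x; split=> [[h1 h2]|/= ->]; [apply/le_anti/andP|split=> /=].
Qed.

End PLCalculus.

(** * Homogeneous extension to cones *)

Section Homogenization.
Variable R : realType.
Local Open Scope ring_scope.
Local Open Scope classical_set_scope.
Implicit Types V W : vectType R.

Definition cone_over V (m : V -> R) (X : set V) : set V :=
  [set x | x = 0 \/ 0 < m x /\ X ((m x)^-1 *: x)].

Lemma scalar_scale V (phi : {scalar V}) (a : R) x : phi (a *: x) = a * phi x.
Proof. exact: linearZ. Qed.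

(** On the cone over a cell where [f x = L x + c], the extension is
    [L x + m x *: c], which is linear.  The functionals [psi] cut out a cone on
    which [m] vanishes only at the origin: without them the inequalities of an
    unbounded description of a cell would add its recession directions. *)
Lemma pl_on_homogenize V W (I : finType) (psi : I -> {scalar V})
    (m : {scalar V}) (X : set V) (f : V -> W) :
    (forall x, (forall i, 0 <= psi i x) -> 0 <= m x) ->
    (forall x, (forall i, 0 <= psi i x) -> m x = 0 -> x = 0) ->
    (forall x, X x -> m x = 1 /\ forall i, 0 <= psi i x) ->
    pl_on X f ->
  pl_on (cone_over m X) (fun x => m x *: f ((m x)^-1 *: x)).
Proof.
move=> m_ge0 m_eq0 Xm [n [C [hC XE]]].
have cone0 : pl_on [set (0 : V)] (fun x => m x *: f ((m x)^-1 *: x)).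
  apply: (@pl_on_eq _ _ _ _ (fun=> 0)) => [x ->|]; first by rewrite linear0 scale0r.
  apply: pl_on_cst; apply: pl_on_cell; last by exists \0, 0 => x; rewrite /= addr0.
  apply: (@convex_cell_fin _ _ (option I) (fun o => if o is Some i then \- psi i else m) (fun=> 0)).
  move=> x; split=> [-> [i|]|h] /=; rewrite ?linear0 ?oppr0 //.
  have psix i : 0 <= psi i x by have := h (Some i); rewrite /= oppr_le0.
  by apply: m_eq0 => //; apply/le_anti; rewrite m_ge0 // andbT (h None).
pose D i := [set x | x = 0 \/ 0 < m x /\ C i ((m x)^-1 *: x)].
have pD i : pl_on (D i) (fun x => m x *: f ((m x)^-1 *: x)).
  have [[k [phi [b CE]]] [L [c hL]]] := hC i.
  have Cm x : C i x -> m x = 1 /\ forall i, 0 <= psi i x.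
    by move=> Cx; apply: Xm; rewrite XE; exists i.
  have lin j : linear (fun x => phi j x - b j * m x : R^o).
    move=> a x y; rewrite !linearP /= mulrDr opprD addrACA scalerBr.
    by congr (_ - _ + _); rewrite /GRing.scale /= mulrCA.
  apply: pl_on_cell.
    apply: (@convex_cell_fin _ _ ('I_k + I)%type
      (fun j => match j with inl j => packed_linear (lin j) : {scalar V}
                           | inr j => \- psi j end) (fun=> 0)).
    move=> x; split=> [[->|[mx]]|h].
    - by case=> j /=; rewrite ?linear0 ?mulr0 ?subr0 ?oppr0.
    - move=> /[dup] /Cm[_ psix]; rewrite CE => phix [j|j] /=.
        have := phix j; rewrite scalar_scale mulrC ler_pdivrMr //.
        by rewrite subr_le0.
      have := psix j; rewrite scalar_scale oppr_le0 => h.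
      by rewrite -(@pmulr_rge0 _ (m x)^-1) // invr_gt0.
    - have psix j : 0 <= psi j x by have := h (inr j); rewrite /= oppr_le0.
      have [mx|mx|mx] := ltgtP 0 (m x); [right|by have := m_ge0 _ psix; rewrite leNgt mx|left; exact: m_eq0].
      split=> //; rewrite CE => j; have := h (inl j).
      by rewrite scalar_scale mulrC ler_pdivrMr //= subr_le0.
  have lin' : linear (fun x => L x + m x *: c).
    by move=> a x y; rewrite !linearP /= scalerDl -scalerA scalerDr addrACA.
  exists (packed_linear lin'), 0 => x; rewrite addr0 /= => -[->|[mx Cx]].
    by rewrite !linear0 !scale0r addr0.
  by rewrite hL // scalerDr linearZ scalerA mulfV ?scale1r // gt_eqF.
apply: (@pl_on_bigU _ _ _ (option 'I_n) (fun o => if o is Some i then D i else [set 0])).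
  by case.
move=> x; split=> [[->|[mx]]|].
- by exists None.
- by rewrite XE => -[i Ci]; exists (Some i); right.
- move=> [[i|] /=]; last by left.
  move=> [|[mx Cx]]; [by left|right; split=> //].
  by rewrite XE; exists i.
Qed.

Lemma pl_homeo_homogenize V W (I J : finType) (psi : I -> {scalar V})
    (chi : J -> {scalar W}) (m : {scalar V}) (n : {scalar W}) X Y (f : V -> W) :
    (forall x, (forall i, 0 <= psi i x) -> 0 <= m x) ->
    (forall x, (forall i, 0 <= psi i x) -> m x = 0 -> x = 0) ->
    (forall x, X x -> m x = 1 /\ forall i, 0 <= psi i x) ->
    (forall y, (forall j, 0 <= chi j y) -> 0 <= n y) ->
    (forall y, (forall j, 0 <= chi j y) -> n y = 0 -> y = 0) ->
    (forall y, Y y -> n y = 1 /\ forall j, 0 <= chi j y) ->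
    pl_homeo X Y f ->
  pl_homeo (cone_over m X) (cone_over n Y) (fun x => m x *: f ((m x)^-1 *: x)) /\
  forall x, cone_over m X x -> n (m x *: f ((m x)^-1 *: x)) = m x.
Proof.
move=> m1 m2 m3 n1 n2 n3 [pf XY [g [pg YX gf fg]]].
have nm x : cone_over m X x -> n (m x *: f ((m x)^-1 *: x)) = m x.
  move=> [->|[mx Xx]]; first by rewrite linear0 scale0r linear0.
  by rewrite scalar_scale (n3 _ (XY _ Xx)).1 mulr1.
have mn y : cone_over n Y y -> m (n y *: g ((n y)^-1 *: y)) = n y.
  move=> [->|[ny Yy]]; first by rewrite linear0 scale0r linear0.
  by rewrite scalar_scale (m3 _ (YX _ Yy)).1 mulr1.
split=> //; split; first exact: pl_on_homogenize m1 m2 m3 pf.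
  move=> x cx; case: (cx) => [->|[mx Xx]]; [left|right].
    by rewrite linear0 scale0r.
  by rewrite nm // scalerA mulVf ?gt_eqF // scale1r; split=> //; apply: XY.
exists (fun y => n y *: g ((n y)^-1 *: y)); split.
- exact: pl_on_homogenize n1 n2 n3 pg.
- move=> y cy; case: (cy) => [->|[ny Yy]]; [left|right].
    by rewrite linear0 scale0r.
  by rewrite mn // scalerA mulVf ?gt_eqF // scale1r; split=> //; apply: YX.
- move=> x cx; case: (cx) => [->|[mx Xx]].
    by rewrite linear0 scale0r linear0 scale0r.
  rewrite nm // scalerA mulVf ?gt_eqF // scale1r gf // scalerA mulfV ?gt_eqF //.
  by rewrite scale1r.
- move=> y cy; case: (cy) => [->|[ny Yy]].
    by rewrite linear0 scale0r linear0 scale0r.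
  rewrite mn // scalerA mulVf ?gt_eqF // scale1r fg // scalerA mulfV ?gt_eqF //.
  by rewrite scale1r.
Qed.
End Homogenization.

(** * Cones over realizations *)

Section ChainCones.
Variables (R : realType) (d : Order.disp_t) (P : finPOrderType d).
Local Open Scope ring_scope.
Local Open Scope classical_set_scope.
Local Open Scope order_scope.
Notation V := {ffun P -> R^o}.
Implicit Types (S T : {set P}) (x y : V) (p q : P).

(** The realization without the normalisation of the total mass. *)
Definition chain_cone S : set V :=
  [set x | [/\ forall p, (0 <= x p)%R, forall p, x p != 0%R -> p \in S &
               forall p q, x p != 0%R -> x q != 0%R -> p >=< q]].

Definition mass S x : R := (\sum_(p in S) x p)%R.
Notation total := (mass [set: P]%SET).

Lemma totalE x : total x = (\sum_p x p)%R.
Proof. by apply: eq_bigl => p; rewrite finset.in_setT. Qed.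

Lemma realizationE S x : realization S x <-> chain_cone S x /\ total x = 1%R.
Proof. by rewrite totalE; split=> [[]|[[]]]. Qed.

Lemma mass_linear S : linear (mass S : V -> R^o).
Proof.
move=> a x y; rewrite /mass scaler_sumr -big_split.
by apply: eq_bigr => p _; rewrite !ffunE.
Qed.

Definition mass_scalar S : {scalar V} := packed_linear (@mass_linear S).

Lemma totalZ (a : R) x : total (a *: x)%R = (a * total x)%R.
Proof. exact: (scalar_scale (mass_scalar [set: P]%SET)). Qed.

Lemma coord_linear p : linear (fun x => x p : R^o).
Proof. by move=> a x y; rewrite !ffunE. Qed.

Definition coord_scalar p : {scalar V} := packed_linear (coord_linear p).

Lemma polyhedron_chain_cone S : polyhedron (chain_cone S).
Proof.
have pc p : pl_on [set: V] (fun x => x p : R^o).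
  exact: pl_on_linear (@polyhedronT _ _) (coord_linear p).
have p0 : pl_on [set: V] (fun x => 0%R : R^o) by exact: pl_on_cst (@polyhedronT _ _).
have pz p (b : Prop) : polyhedron [set x : V | x p = 0%R \/ b].
  by apply: polyhedronU; [exact: polyhedron_eq (pc p) p0|exact: polyhedron_const].
have h1 := polyhedron_bigI (fun p => polyhedron_le p0 (pc p)).
have h2 := polyhedron_bigI (fun p => pz p (p \in S)).
have h3 := polyhedron_bigI (fun p => polyhedron_bigI (fun q =>
  polyhedronU (polyhedron_eq (pc p) p0) (pz q (p >=< q)))).
apply: pl_on_seteq (polyhedronI h1 (polyhedronI h2 h3)) => x; split.
  move=> [g1 [g2 g3]]; split=> // [p|p q] /eqP xp.
    by case: (g2 p).
  by move=> /eqP xq; case: (g3 p q) => // -[].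
move=> [g1 g2 g3]; split=> //; split=> [p|p q].
  by have [|/g2] := eqVneq (x p) 0%R; [left|right].
have [|xp] := eqVneq (x p) 0%R; [by left|right].
by have [|xq] := eqVneq (x q) 0%R; [left|right; apply: g3].
Qed.

Lemma pl_on_mass (U : vectType R) (X : set U) S (f : U -> V) :
  pl_on X f -> pl_on X (fun u => mass S (f u) : R^o).
Proof. by move=> pf; apply: pl_on_comp_linear pf (@mass_linear S). Qed.

Lemma polyhedron_realization S : polyhedron (realization (R := R) S).
Proof.
have h : polyhedron [set x : V | total x = 1%R].
  apply: polyhedron_eq; last exact: pl_on_cst (@polyhedronT _ _).
  exact: pl_on_linear (@polyhedronT _ _) (@mass_linear _).
apply: pl_on_seteq (polyhedronI (polyhedron_chain_cone S) h) => x.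
by rewrite realizationE.
Qed.

Lemma mass_ge0 S x : (forall p, (0 <= x p)%R) -> (0 <= mass S x)%R.
Proof. by move=> x0; apply: sumr_ge0. Qed.

Lemma total_eq0 x : (forall p, (0 <= x p)%R) -> total x = 0%R -> x = 0%R.
Proof.
move=> x0 /psumr_eq0P h; apply/ffunP => p; rewrite ffunE h //.
Qed.

Lemma chain_cone0 S : chain_cone S 0%R.
Proof. by split=> [p|p|p q]; rewrite !ffunE ?eqxx. Qed.

Lemma chain_coneZ S (a : R) x : (0 <= a)%R -> chain_cone S x -> chain_cone S (a *: x)%R.
Proof.
move=> a0 [x0 xS xc].
have h p : (a *: x)%R p != 0%R -> x p != 0%R.
  by rewrite ffunE; apply: contra_neq => ->; rewrite scaler0.
split=> [p|p /h/xS//|p q /h xp /h xq]; last exact: xc.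
by rewrite ffunE; apply: mulr_ge0.
Qed.

Lemma chain_coneS S T x : S \subset T -> chain_cone S x -> chain_cone T x.
Proof. by move=> sub [x0 xS xc]; split=> // p /xS; apply: (fintype.subsetP sub). Qed.

Lemma cone_over_realization S x :
  cone_over total (realization S) x <-> chain_cone S x.
Proof.
split=> [[->|[mx /realizationE[cx _]]]|cx]; first exact: chain_cone0.
  have := chain_coneZ (ltW mx) cx; rewrite scalerA mulfV ?scale1r //.
  by rewrite gt_eqF.
have x0 : forall p, (0 <= x p)%R by case: cx.
have [mx|mx|mx] := ltgtP 0%R (total x).
- right; split=> //; apply/realizationE; split.
    by apply: chain_coneZ cx; rewrite invr_ge0 ltW.
  by rewrite totalZ mulVf // gt_eqF.
- by have := mass_ge0 [set: P]%SET x0; rewrite leNgt mx.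
- by left; apply: total_eq0.
Qed.

Definition half_cylinder S : set (V * R^o) :=
  [set y | chain_cone S y.1 /\ (0 <= y.2)%R].

(** The cone of the realization is the slice of mass one of the product of
    [chain_cone S] and a half-line; the apex is its only point with first
    component zero. *)
Lemma cone_realizationE S (y : V * R^o) :
  cone (realization S) y <-> half_cylinder S y /\ (total y.1 + y.2 = 1)%R.
Proof.
split.
  move=> [->|[x [t [/realizationE[cx mx] t0 t1 ->]]]] /=.
    split; first by split=> /=; [exact: chain_cone0|exact: ler01].
    by rewrite /mass big1 ?add0r // => p _; rewrite ffunE.
  split; first by split=> //=; apply: chain_coneZ cx; rewrite subr_ge0.
  by rewrite totalZ mx mulr1 subrK.
case: y => z t [[/= cz t0] mz].
have z0 : forall p, (0 <= z p)%R by case: cz.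
have mge := mass_ge0 [set: P]%SET z0.
have [t1|t1|t1] := ltgtP t (1%R : R).
- right; exists ((1 - t)^-1 *: z)%R, t; split=> //.
  + apply/realizationE; split; first by apply: chain_coneZ cz; rewrite invr_ge0 subr_ge0 ltW.
    by rewrite totalZ -mz addrK mulVf // -(addrK t (total z)) mz subr_eq0 eq_sym lt_eqF.
  + exact: ltW.
  + by rewrite scalerA mulfV ?scale1r // subr_eq0 eq_sym lt_eqF.
- by exfalso; move: mz mge t1; lra.
- left; congr (_, _) => //; apply: total_eq0 => //.
  by move: mz; rewrite t1 -[X in _ = X]add0r => /addIr.
Qed.

(** A point of the star of [q] carries any mass between [0] and [1] above [q];
    the homogeneous extension makes the collar of the link act on this part. *)
Lemma collar_homogenize (B L : {set P}) h :
    pl_homeo (realization (R := R) B) (cone (realization (R := R) L)) h ->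
    (forall x, realization L x -> h x = cone_base x) ->
  exists G, [/\ pl_homeo (chain_cone B) (half_cylinder L) G,
    forall x, chain_cone B x -> (total (G x).1 + (G x).2 = total x)%R &
    forall x, chain_cone L x -> G x = (x, 0%R)].
Proof.
move=> hh hL.
have nlin : linear (fun y : V * R^o => total y.1 + y.2 : R^o)%R.
  move=> a x y /=; have -> := @mass_linear [set: P]%SET a x.1 y.1.
  by rewrite scalerDr addrACA.
have sndlin : linear (fun y : V * R^o => y.2) by [].
have clin p : linear (fun y : V * R^o => y.1 p : R^o).
  by move=> a x y; rewrite !ffunE.
pose chi (o : option P) : {scalar (V * R^o)%type} :=
  if o is Some p then packed_linear (clin p) else packed_linear sndlin.
have [] := @pl_homeo_homogenize R V (V * R^o)%type P (option P) coord_scalar chi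
  (mass_scalar [set: P]%SET) (packed_linear nlin) _ _ h _ _ _ _ _ _ hh.
- by move=> x x0; apply: mass_ge0.
- by move=> x x0; apply: total_eq0.
- by move=> x /realizationE[[x0 _ _]]; split.
- move=> y y0; apply: addr_ge0; last exact: (y0 None).
  by apply: mass_ge0 => p; apply: (y0 (Some p)).
- move=> [z t] y0 /= /eqP; rewrite paddr_eq0.
  + move=> /andP[/eqP z0 /eqP ->]; congr (_, _); apply: total_eq0 => // p.
    exact: (y0 (Some p)).
  + by apply: mass_ge0 => p; apply: (y0 (Some p)).
  + exact: (y0 None).
- by move=> y /cone_realizationE[[[y0 _ _] yt] my]; split=> // -[p|]; [exact: y0|exact: yt].
set G := fun x => _; move=> Gh Gm; exists G.
have coneE (y : V * R^o) : cone_over (packed_linear nlin) (cone (realization L)) y <-> half_cylinder L y.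
  split=> [[->|[my /cone_realizationE[[c1 c2] _]]]|[cy yt]].
  - by split; [exact: chain_cone0|exact: lexx].
  - have i0 := ltW my.
    have yE : y = (packed_linear nlin y *: ((packed_linear nlin y)^-1 *: y))%R.
      by rewrite scalerA mulfV ?scale1r // gt_eqF.
    rewrite yE; split=> /=; first exact: chain_coneZ c1.
    exact: mulr_ge0.
  - have y0 : forall p, (0 <= y.1 p)%R by case: cy.
    have mge := mass_ge0 [set: P]%SET y0.
    have [my|my|my] := ltgtP 0%R (total y.1 + y.2)%R.
    + right; split=> //; apply/cone_realizationE; split; last first.
        rewrite [LHS](scalar_scale (packed_linear nlin : {scalar _}) ((total y.1 + y.2)^-1)%R y).
        by rewrite /= mulVf // gt_eqF.
      have i0 : (0 <= (total y.1 + y.2)^-1)%R by rewrite invr_ge0 ltW.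
      split; first exact: chain_coneZ cy.
      exact: mulr_ge0.
    + by exfalso; move: mge my yt; lra.
    + left; move/eqP: my; rewrite eq_sym paddr_eq0 // => /andP[/eqP /total_eq0 y10 /eqP y20].
      by rewrite (surjective_pairing y) y20 y10.
split.
- have E1 : cone_over (mass_scalar [set: P]%SET) (realization B) = chain_cone B.
    by apply/predeqP => x; exact: cone_over_realization.
  have E2 : cone_over (packed_linear nlin) (cone (realization L)) = half_cylinder L.
    by apply/predeqP.
  by rewrite E1 E2 in Gh.
- by move=> x /cone_over_realization; apply: Gm.
- move=> x /cone_over_realization[->|[mx Lx]].
    by rewrite /G linear0 scale0r.
  rewrite /G /= hL //; congr (_, _) => /=; last by rewrite scaler0.
  by rewrite scalerA mulfV ?scale1r // gt_eqF.
Qed.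
End ChainCones.

(** * Gluing piecewise linear homeomorphisms *)

Section Gluing.
Variable R : realType.
Local Open Scope ring_scope.
Local Open Scope classical_set_scope.
Implicit Types V W : vectType R.

(** The inverse is a parameter because gluing and composing homeomorphisms acts
    on both directions at once. *)
Definition pl_inverse V W (X : set V) (Y : set W) f g :=
  [/\ pl_on X f, forall x, X x -> Y (f x), pl_on Y g, forall y, Y y -> X (g y) &
      (forall x, X x -> g (f x) = x) /\ (forall y, Y y -> f (g y) = y)].

Lemma pl_homeoP V W (X : set V) (Y : set W) f :
  pl_homeo X Y f <-> exists g, pl_inverse X Y f g.
Proof.
split=> [[pf XY [g [pg YX gf fg]]]|[g [pf XY pg YX [gf fg]]]]; first by exists g.
by split=> //; exists g.
Qed.

Lemma pl_inverse_comp (U V W : vectType R) (X : set U) (Y : set V) (Z : set W) f f' g g' :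
  pl_inverse X Y f f' -> pl_inverse Y Z g g' ->
  pl_inverse X Z (g \o f) (f' \o g').
Proof.
move=> [pf XY pf' YX [f'f ff']] [pg YZ pg' ZY [g'g gg']]; split.
- exact: pl_on_comp pf pg XY.
- by move=> x /XY /YZ.
- exact: pl_on_comp pg' pf' ZY.
- by move=> z /ZY /YX.
- split=> [x Xx|z Zz] /=; first by rewrite g'g ?f'f //; apply: XY.
  by rewrite ff' ?gg' //; apply: ZY.
Qed.

Lemma pl_inverse_sym V W (X : set V) (Y : set W) f g :
  pl_inverse X Y f g -> pl_inverse Y X g f.
Proof. by move=> [? ? ? ? [? ?]]; split. Qed.

Definition piecewise V W (X : set V) (f g : V -> W) x :=
  if `[< X x >] then f x else g x.

Lemma piecewiseL V W (X : set V) (f g : V -> W) x : X x -> piecewise X f g x = f x.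
Proof. by rewrite /piecewise; case: asboolP. Qed.

Lemma piecewiseR V W (X Y : set V) (f g : V -> W) x :
  (forall x, X x -> Y x -> f x = g x) -> Y x -> piecewise X f g x = g x.
Proof. by move=> fg Yx; rewrite /piecewise; case: asboolP => // Xx; apply: fg. Qed.

Lemma pl_inverse_glue V W (X1 X2 : set V) (Y1 Y2 : set W) f1 f2 g1 g2 :
    pl_inverse X1 Y1 f1 g1 -> pl_inverse X2 Y2 f2 g2 ->
    (forall x, X1 x -> X2 x -> f1 x = f2 x) ->
    (forall y, Y1 y -> Y2 y -> g1 y = g2 y) ->
  pl_inverse (X1 `|` X2) (Y1 `|` Y2) (piecewise X1 f1 f2) (piecewise Y1 g1 g2).
Proof.
move=> [pf1 m1 pg1 n1 [g1f1 f1g1]] [pf2 m2 pg2 n2 [g2f2 f2g2]] f12 g12; split.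
- apply: pl_onU; [apply: pl_on_eq pf1|apply: pl_on_eq pf2] => x Xx.
    by rewrite piecewiseL.
  by rewrite (piecewiseR f12).
- move=> x [Xx|Xx]; [left; rewrite piecewiseL //|right; rewrite (piecewiseR f12) //].
    exact: m1.
  exact: m2.
- apply: pl_onU; [apply: pl_on_eq pg1|apply: pl_on_eq pg2] => x Xx.
    by rewrite piecewiseL.
  by rewrite (piecewiseR g12).
- move=> x [Xx|Xx]; [left; rewrite piecewiseL //|right; rewrite (piecewiseR g12) //].
    exact: n1.
  exact: n2.
- split=> x [Xx|Xx].
  + by rewrite (piecewiseL f1) // (piecewiseL g1) ?g1f1 //; apply: m1.
  + by rewrite (piecewiseR f12 Xx) (piecewiseR g12) ?g2f2 //; apply: m2.
  + by rewrite (piecewiseL g1) // (piecewiseL f1) ?f1g1 //; apply: n1.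
  + by rewrite (piecewiseR g12 Xx) (piecewiseR f12) ?f2g2 //; apply: n2.
Qed.
End Gluing.

(** * Raising the star of one element *)

Section MinMax.
Variable R : realType.
Local Open Scope ring_scope.

Lemma max_cases (a b : R) :
  (Num.max a b = a /\ b <= a) \/ (Num.max a b = b /\ a <= b).
Proof. by case: (leP a b) => h; [right|left; split=> //; apply: ltW]. Qed.

Lemma min_cases (a b : R) :
  (Num.min a b = a /\ a <= b) \/ (Num.min a b = b /\ b <= a).
Proof. by case: (leP a b) => h; [left|right; split=> //; apply: ltW]. Qed.
End MinMax.

(* The inequalities stay in the goal so that nested occurrences of Num.min and
   Num.max in them are resolved as well. *)
Ltac minmax := repeat match goal with
  | |- context [Num.max ?a ?b] => have [[->]|[->]] := max_cases a b
  | |- context [Num.min ?a ?b] => have [[->]|[->]] := min_cases a b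
  end; intros; lra.

Section RaiseArithmetic.
Variable R : realType.
Local Open Scope ring_scope.

(** If [w] is the weight of [q] before raising and [(y, s)] are the weight and the
    height after it, then the height before was [s - w].  Preservation of mass,
    [w + max 0 (w - s) = y + max 0 (- s)], says that the maximum of [w] and
    [2 * w - s] is [y + max 0 (- s)], whose solution is this minimum. *)
Definition unraised (y s : R) :=
  Num.min (y + Num.max 0 (- s)) ((y + Num.max 0 (- s) + s) / 2).

Lemma raise_total (y s : R) : 0 <= y ->
  Num.min y (Num.max 0 (- s)) + Num.max 0 (- (s + y)) = Num.max 0 (- s).
Proof. by move=> y0; minmax. Qed.

Lemma unraised_raise (y s : R) : 0 <= y ->
  unraised (y + Num.min y (Num.max 0 (- s))) (s + y) = y.
Proof. by move=> y0; rewrite /unraised; minmax. Qed.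

Lemma unraised_ge0 (y s : R) : 0 <= y -> 0 <= unraised y s.
Proof. by move=> y0; rewrite /unraised; minmax. Qed.

Lemma unraised_total (y s : R) : 0 <= y ->
  unraised y s - y + Num.max 0 (- (s - unraised y s)) = Num.max 0 (- s).
Proof. by move=> y0; rewrite /unraised; minmax. Qed.

Lemma unraised_height (y s m : R) : 0 <= y -> 0 <= m -> s <= y + m -> s - unraised y s <= m.
Proof. by move=> y0 m0 sm; rewrite /unraised; minmax. Qed.

Lemma unraised0 (s : R) : unraised 0 s = 0.
Proof. by rewrite /unraised; minmax. Qed.

Lemma raise_unraised (y s : R) : 0 <= y ->
  unraised y s + Num.min (unraised y s) (Num.max 0 (- (s - unraised y s))) = y.
Proof. by move=> y0; rewrite /unraised; minmax. Qed.
End RaiseArithmetic.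

Section Push.
Variables (R : realType) (d : Order.disp_t) (P : finPOrderType d).
Variables (Q : {set P}) (clQ : closed_subposet Q).
Local Open Scope ring_scope.
Local Open Scope classical_set_scope.
Local Open Scope order_scope.
Notation V := {ffun P -> R^o}.
Notation VR := (V * R^o)%type.
Implicit Types (S T U : {set P}) (x y z : V) (p q : P).
Notation total := (mass [set: P]%SET).

Definition above q x : V := [ffun p => if q < p then x p else 0%R].
Definition not_above q x : V := [ffun p => if q < p then 0%R else x p].
Definition bump q (a : R) x : V := [ffun p => if p == q then (x p + a)%R else x p].

Definition star q : set V := [set x | forall p, x p != 0%R -> p >=< q].

Definition partial_cylinder U : set VR :=
  [set u | [/\ realization [set: P]%SET u.1, (0 <= u.2)%R, (u.2 <= mass U u.1)%R &
               u.2 = 0%R \/ chain_cone Q u.1]].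

(** The star of [q] in the partial cylinder, once the collar parameter [tau] of the
    part above [q] and the height [t] are merged into [s = t - tau].  The
    parameter is recovered as [Num.max 0 (- s)], which explains the formula for
    the total mass. *)
Definition flat_star q U : set VR :=
  [set u | [/\ chain_cone Q u.1, star q u.1,
     (total u.1 + Num.max 0 (- u.2) = 1)%R & (u.2 <= mass U u.1)%R]].

Lemma above_split q x : (not_above q x + above q x)%R = x.
Proof. by apply/ffunP => p; rewrite !ffunE; case: ifP; rewrite ?add0r ?addr0. Qed.

Lemma massD U x y : mass U (x + y)%R = (mass U x + mass U y)%R.
Proof. by have := @mass_linear R _ _ U 1%R x y; rewrite !scale1r. Qed.

Lemma link_above q S z : chain_cone (link q S) z ->
  (forall x, above q (not_above q x + z)%R = z) /\
  (forall x, not_above q (not_above q x + z)%R = not_above q x).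
Proof.
move=> [_ zl _].
have z0 p : ~~ (q < p) -> z p = 0%R.
  by move=> nqp; have [//|/zl] := eqVneq (z p) 0%R; rewrite inE (negPf nqp) andbF.
split=> x; apply/ffunP => p; rewrite !ffunE; case: ifP => qp; rewrite ?add0r //.
- by rewrite qp add0r.
- by rewrite z0 // qp.
- by rewrite qp z0 ?addr0 // qp.
Qed.

Lemma chain_cone_above q S x : chain_cone S x -> chain_cone (link q S) (above q x).
Proof.
move=> [x0 xS xc]; split=> [p|p|p r]; rewrite !ffunE.
- by case: ifP.
- by case: ifP => [qp /xS|]; rewrite ?eqxx // !inE qp => ->.
- by case: ifP; case: ifP; rewrite ?eqxx // => _ _; apply: xc.
Qed.

(** All elements below [q] are in [Q], so only the part above [q] decides whether
    the chain lies in [Q]. *)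
Lemma link_join q x z S : chain_cone [set: P]%SET x -> star q x ->
  chain_cone (link q S) z -> S = Q \/ S = [set: P]%SET -> q \in Q ->
  chain_cone S (not_above q x + z)%R /\ star q (not_above q x + z)%R.
Proof.
move=> [x0 _ xc] xs [z0 zl zc] SE qQ.
have supp p : (not_above q x + z)%R p != 0%R ->
    [/\ x p != 0%R & p <= q] \/ [/\ z p != 0%R, p \in S & q < p].
  rewrite !ffunE; case: ifP => qp; rewrite ?add0r => h.
    by right; have := zl p h; rewrite inE => /andP[].
  have zp : z p = 0%R.
    by have [//|/zl] := eqVneq (z p) 0%R; rewrite inE qp andbF.
  move: h; rewrite zp addr0 => h; left; split=> //.
  by rewrite comparable_leNgt ?qp ?xs.
split; last first.
  by move=> p /supp[[_]|[_ _ /ltW]]; rewrite /Order.comparable => ->; rewrite ?orbT.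
split=> [p|p|p r].
- by rewrite !ffunE; case: ifP => _; rewrite ?add0r ?addr_ge0.
- move=> /supp[[_ pq]|[]//]; case: SE => ->; last by rewrite inE.
  exact: clQ pq qQ.
- move=> /supp[[xp pq]|[zp _ qp]] /supp[[xr rq]|[zr _ qr]].
  + exact: xc.
  + by rewrite /Order.comparable (le_trans pq (ltW qr)).
  + by rewrite /Order.comparable (le_trans rq (ltW qp)) orbT.
  + exact: zc.
Qed.

Lemma pl_on_above (W : vectType R) (X : set W) q (f : W -> V) :
  pl_on X f -> pl_on X (fun w => above q (f w)).
Proof.
move=> pf; apply: pl_on_comp_linear pf _ => a x y; apply/ffunP => p.
by rewrite !ffunE; case: ifP; rewrite ?scaler0 ?addr0.
Qed.

Lemma pl_on_not_above (W : vectType R) (X : set W) q (f : W -> V) :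
  pl_on X f -> pl_on X (fun w => not_above q (f w)).
Proof.
move=> pf; apply: pl_on_comp_linear pf _ => a x y; apply/ffunP => p.
by rewrite !ffunE; case: ifP; rewrite ?scaler0 ?addr0.
Qed.

Lemma pl_on_bump (W : vectType R) (X : set W) q (a : W -> R^o) (f : W -> V) :
  pl_on X a -> pl_on X f -> pl_on X (fun w => bump q (a w) (f w)).
Proof.
move=> pa pf; apply: pl_on_ffun => [|p]; first exact: pl_on_poly pf.
have pfp := pl_on_coord p pf.
by case: (p == q); first exact: pl_on_add.
Qed.

Lemma polyhedron_star q : polyhedron (star q).
Proof.
have h p : polyhedron [set x : V | x p = 0%R \/ p >=< q].
  apply: polyhedronU; last exact: polyhedron_const.
  apply: polyhedron_eq; last exact: pl_on_cst (@polyhedronT _ _).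
  by apply: pl_on_coord; apply: pl_on_id (@polyhedronT _ _).
apply: pl_on_seteq (polyhedron_bigI h) => x; split=> h' p.
  by move=> /eqP xp; case: (h' p).
by have [|/h'] := eqVneq (x p) 0%R; [left|right].
Qed.

Lemma polyhedron_fst (W1 W2 : vectType R) (X : set W1) :
  polyhedron X -> polyhedron [set u : W1 * W2 | X u.1].
Proof.
move=> pX; have pf := pl_on_fst (pl_on_id (@polyhedronT _ (W1 * W2)%type)).
by apply: pl_on_seteq (pl_on_preim pf pX) => u; split=> [[]|].
Qed.

Lemma pl_on_fst_id (W1 W2 : vectType R) (X : set (W1 * W2)) :
  polyhedron X -> pl_on X (fun u => u.1).
Proof. by move=> pX; apply: pl_on_fst; apply: pl_on_id. Qed.

Lemma pl_on_snd_id (W1 W2 : vectType R) (X : set (W1 * W2)) :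
  polyhedron X -> pl_on X (fun u => u.2).
Proof. by move=> pX; apply: pl_on_snd; apply: pl_on_id. Qed.

Lemma polyhedron_partial_cylinder U : polyhedron (partial_cylinder U).
Proof.
have pT := @polyhedronT R VR.
have p0 := pl_on_cst (0%R : R^o) pT.
have ps := pl_on_snd_id pT.
have pf := pl_on_fst_id pT.
have h1 := polyhedron_fst R^o (polyhedron_realization R [set: P]%SET).
have h2 := polyhedron_le p0 ps.
have h3 := polyhedron_le ps (pl_on_mass U pf).
have h4 := polyhedronU (polyhedron_eq ps p0)
  (polyhedron_fst R^o (polyhedron_chain_cone R Q)).
apply: pl_on_seteq (polyhedronI h1 (polyhedronI h2 (polyhedronI h3 h4))) => u.
by split=> [[? [? []]]|[]].
Qed.

Lemma polyhedron_flat_star q U : polyhedron (flat_star q U).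
Proof.
have pT := @polyhedronT R VR.
have p0 := pl_on_cst (0%R : R^o) pT.
have p1 := pl_on_cst (1%R : R^o) pT.
have ps := pl_on_snd_id pT.
have pf := pl_on_fst_id pT.
have h1 := polyhedron_fst R^o (polyhedron_chain_cone R Q).
have h2 := polyhedron_fst R^o (polyhedron_star q).
have h3 := polyhedron_eq (pl_on_add (pl_on_mass [set: P]%SET pf)
  (pl_on_max p0 (pl_on_opp ps))) p1.
have h4 := polyhedron_le ps (pl_on_mass U pf).
apply: pl_on_seteq (polyhedronI h1 (polyhedronI h2 (polyhedronI h3 h4))) => u.
by split=> [[? [? []]]|[]].
Qed.

Section Step.
Variables (q : P) (qQ : q \in Q) (G : V -> VR) (G' : VR -> V).
Notation B := (link q [set: P]%SET).
Notation L := (link q Q).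
Hypothesis GG' : pl_inverse (chain_cone B) (half_cylinder L) G G'.
Hypothesis Gtotal : forall x, chain_cone B x -> (total (G x).1 + (G x).2 = total x)%R.
Hypothesis Gbase : forall x, chain_cone L x -> G x = (x, 0%R).

(** The collar acts on the part above [q]; its parameter becomes a negative
    height. *)
Definition flatten (u : VR) : VR :=
  (not_above q u.1 + (G (above q u.1)).1, u.2 - (G (above q u.1)).2)%R.

Definition unflatten (v : VR) : VR :=
  (not_above q v.1 + G' (above q v.1, Num.max 0 (- v.2)), Num.max 0 v.2)%R.

Let star_cylinder U : set VR := partial_cylinder U `&` [set u | star q u.1].

(** At positive height the point lies over [|Q|], where the collar is the base
    inclusion; hence the collar parameter is zero there. *)
Lemma star_cylinder_cases U u : star_cylinder U u ->
  [/\ chain_cone B (above q u.1), half_cylinder L (G (above q u.1)) &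
      u.2 = 0%R \/ [/\ (0 <= u.2)%R, chain_cone Q u.1 & G (above q u.1) = (above q u.1, 0%R)]].
Proof.
move=> [[/realizationE[ux _] u0 uU uQ] us].
have cB := chain_cone_above q ux.
have [_ GL _ _ _] := GG'.
split=> //; first exact: GL.
case: uQ => [|uQ]; [by left|right; split=> //].
by apply: Gbase; apply: chain_cone_above.
Qed.

Lemma flatten_star U u : star_cylinder U u -> flat_star q U (flatten u).
Proof.
move=> hu; have [cB [cL t0] cases] := star_cylinder_cases hu.
case: (hu) => -[/realizationE[ux um] u0 uU _] us.
have [h1 h2] := link_join ux us cL (or_introl erefl) qQ.
have tE : Num.max 0%R (- (flatten u).2)%R = (G (above q u.1)).2.
  rewrite /= opprB; case: cases => [->|[u20 _ ->]] /=; first by rewrite subr0; exact: max_r.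
  by rewrite sub0r; apply: max_l; rewrite oppr_le0.
split=> //.
  rewrite tE /= massD -addrA Gtotal // -um -[in RHS](above_split q u.1) massD //.
case: cases => [u20|[_ _ GE]] /=; last by rewrite GE above_split subr0.
rewrite u20 sub0r; apply: (@le_trans _ _ 0%R); first by rewrite oppr_le0.
by apply: mass_ge0; case: h1.
Qed.

Lemma flat_star_cases U v : flat_star q U v ->
  [/\ chain_cone L (above q v.1), half_cylinder L (above q v.1, Num.max 0%R (- v.2)%R) &
     (v.2 <= 0)%R \/ [/\ (0 <= v.2)%R, Num.max 0%R (- v.2)%R = 0%R &
        G' (above q v.1, Num.max 0%R (- v.2)%R) = above q v.1]].
Proof.
move=> [vQ vs vm vU].
have cL := chain_cone_above q vQ.
have [_ _ _ _ [G'G _]] := GG'.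
split=> //; first by split=> //=; rewrite le_max lexx.
have [v0|v0] := leP v.2 (0%R : R); [by left|right].
have m0 : Num.max 0%R (- v.2)%R = 0%R by apply: max_l; rewrite oppr_le0 ltW.
split=> //; first exact: ltW.
rewrite m0 -Gbase // G'G //; apply: chain_coneS cL.
by apply/fintype.subsetP => p; rewrite !inE => /andP[].
Qed.

Lemma unflatten_star U v : flat_star q U v -> star_cylinder U (unflatten v).
Proof.
move=> hv; have [cL hL cases] := flat_star_cases hv; case: (hv) => vQ vs vm vU.
have [_ _ _ G'B [G'G GG'K]] := GG'.
have cB := G'B _ hL.
have vP : chain_cone [set: P]%SET v.1 by apply: chain_coneS vQ; apply/fintype.subsetP => p; rewrite inE.
have [h1 h2] := link_join vP vs cB (or_intror erefl) qQ.
split=> //=; split.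
- apply/realizationE; split=> //=.
  have := Gtotal cB; rewrite GG'K //= => tE.
  by rewrite massD -tE addrA -massD above_split.
- by rewrite /= le_max lexx.
- case: cases => [v0|[v0 _ E]] /=.
    have -> : Num.max 0%R (v.2 : R) = 0%R by apply: max_l.
    by apply: mass_ge0; case: h1.
  have -> : Num.max 0%R (v.2 : R) = v.2 by apply: max_r.
  by rewrite E above_split.
- case: cases => [v0|[v0 _ E]] /=; first by left; apply: max_l.
  by right; rewrite E above_split.
Qed.

Lemma flattenK U u : star_cylinder U u -> unflatten (flatten u) = u.
Proof.
move=> hu; have [cB [cL t0] cases] := star_cylinder_cases hu.
have [_ _ _ _ [G'G _]] := GG'.
have [aE nE] := link_above cL.
rewrite /unflatten /= aE nE.
have -> : Num.max 0%R (- (u.2 - (G (above q u.1)).2))%R = (G (above q u.1)).2.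
  rewrite opprB; case: cases => [->|[u20 _ ->]] /=; first by rewrite subr0; exact: max_r.
  by rewrite sub0r; apply: max_l; rewrite oppr_le0.
have -> : Num.max 0%R (u.2 - (G (above q u.1)).2)%R = u.2.
  case: cases => [->|[u20 _ ->]] /=; first by rewrite sub0r; apply: max_l; rewrite oppr_le0.
  by rewrite subr0; apply: max_r.
by rewrite -surjective_pairing G'G // above_split -surjective_pairing.
Qed.

Lemma unflattenK U v : flat_star q U v -> flatten (unflatten v) = v.
Proof.
move=> hv; have [cL hL cases] := flat_star_cases hv.
have [_ _ _ G'B [_ GG'K]] := GG'.
have [aE nE] := link_above (G'B _ hL).
rewrite /flatten /= aE nE GG'K //= above_split.
rewrite [RHS]surjective_pairing; congr (_, _).
by case: (leP 0%R (v.2 : R)) => v0; case: leP; lra.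
Qed.

Lemma pl_inverse_flatten U :
  pl_inverse (star_cylinder U) (flat_star q U) flatten unflatten.
Proof.
have [pG GL pG' G'B _] := GG'.
split; [|exact: flatten_star| |exact: unflatten_star|by split; [apply: flattenK|apply: unflattenK]].
- have pX : polyhedron (star_cylinder U).
    apply: polyhedronI; first exact: polyhedron_partial_cylinder.
    exact: polyhedron_fst (polyhedron_star q).
  have pG1 : pl_on (star_cylinder U) (fun u => G (above q u.1)).
    apply: pl_on_comp (pl_on_above q (pl_on_fst_id pX)) pG _ => u hu.
    by have [] := star_cylinder_cases hu.
  apply: pl_on_pair.
    exact: pl_on_add (pl_on_not_above q (pl_on_fst_id pX)) (pl_on_fst pG1).
  exact: pl_on_subr (pl_on_snd_id pX) (pl_on_snd pG1).
- have pX := polyhedron_flat_star q U.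
  have p0 := pl_on_cst (0%R : R^o) pX.
  have p2 := pl_on_snd_id pX.
  have pG1 : pl_on (flat_star q U) (fun v => G' (above q v.1, Num.max 0%R (- v.2)%R)).
    apply: (pl_on_comp _ pG').
      apply: pl_on_pair (pl_on_above q (pl_on_fst_id pX)) _.
      exact: pl_on_max p0 (pl_on_opp p2).
    by move=> v hv; have [] := flat_star_cases hv.
  apply: pl_on_pair; last exact: pl_on_max p0 p2.
  exact: pl_on_add (pl_on_not_above q (pl_on_fst_id pX)) pG1.
Qed.

(** Over a point of mass one of [lk(q,Q)], let [a] be the apex of the collar
    ([v.1 q = 0] and [v.2 = - 1]) and let [m] be the midpoint of [a] and [q].
    The map is linear on the sectors spanned by [a, m], by [m, q], and by [q]
    and the upward direction.  It fixes [a], moves [m] down to the bottom point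
    [q] and [q] up to height one: the segment [m q] becomes the new piece of
    the cylinder over [q]. *)
Definition raise (v : VR) : VR :=
  (bump q (Num.min (v.1 q : R) (Num.max 0 (- v.2))) v.1, v.2 + v.1 q)%R.

Definition unraised_weight (v : VR) : R := unraised (v.1 q) v.2.

Definition lower (v : VR) : VR :=
  (bump q (unraised_weight v - v.1 q) v.1, v.2 - unraised_weight v)%R.

Lemma mass_bump U a x : mass U (bump q a x) = (mass U x + (if q \in U then a else 0))%R.
Proof.
have -> : bump q a x = (x + [ffun p => if p == q then a else 0%R])%R.
  by apply/ffunP => p; rewrite !ffunE; case: ifP; rewrite ?addr0.
rewrite massD; congr (_ + _)%R; rewrite /mass; case: ifP => qU.
  rewrite (bigD1 q) //= ffunE eqxx big1 ?addr0 // => p /andP[_ /negPf pq].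
  by rewrite ffunE pq.
by rewrite big1 // => p pU; rewrite ffunE; case: eqP => // pq; rewrite -pq pU in qU.
Qed.

Lemma bump_flat a x : (0 <= x q + a)%R -> chain_cone Q x -> star q x ->
  chain_cone Q (bump q a x) /\ star q (bump q a x).
Proof.
move=> a0 [x0 xQ xc] xs.
have supp p : bump q a x p != 0%R -> p = q \/ x p != 0%R.
  by rewrite ffunE; have [|_] := eqVneq p q; [left|right].
split; last by move=> p /supp[->|/xs //]; rewrite comparablexx.
split=> [p|p|p r].
- by rewrite ffunE; case: eqP => [->//|_]; apply: x0.
- by move=> /supp[->|/xQ].
- move=> /supp[->|xp] /supp[->|xr].
  + by rewrite comparablexx.
  + by rewrite comparable_sym xs.
  + by rewrite xs.
  + exact: xc.
Qed.

Lemma pl_inverse_raise U : q \notin U ->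
  pl_inverse (flat_star q U) (flat_star q (q |: U)) raise lower.
Proof.
move=> qU.
have massU x : mass (q |: U) x = (x q + mass U x)%R by rewrite /mass big_setU1.
have pX W := polyhedron_flat_star q W.
have p0 W := pl_on_cst (0%R : R^o) (pX W).
have p1 W := pl_on_fst_id (pX W).
have p2 W := pl_on_snd_id (pX W).
have pq W := pl_on_coord q (p1 W).
have pm W := pl_on_max (p0 W) (pl_on_opp (p2 W)).
have pw W : pl_on (flat_star q W) (unraised_weight : VR -> R^o).
  apply: pl_on_min; first exact: pl_on_add.
  apply: (@pl_on_eq _ _ _ _ (fun v : VR => 2^-1 *: (v.1 q + Num.max 0 (- v.2) + v.2) : R^o)%R).
    by move=> v _; rewrite mulrC.
  by apply: pl_on_scale; do 2?apply: pl_on_add.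
split.
- apply: pl_on_pair; last exact: pl_on_add.
  by apply: pl_on_bump (p1 _); apply: pl_on_min.
- move=> [y s] [/= yQ ys ym yU].
  have y0 : (0 <= y q :> R)%R by case: yQ.
  have c0 : (0 <= Num.min (y q : R) (Num.max 0 (- s)))%R by rewrite le_min y0 le_max lexx.
  have [h1 h2] := bump_flat (addr_ge0 y0 c0) yQ ys.
  split=> //=.
    rewrite mass_bump inE -ym.
    by rewrite -addrA raise_total.
  rewrite massU mass_bump (negPf qU) addr0 ffunE eqxx.
  by move: c0 yU; lra.
- apply: pl_on_pair; last exact: pl_on_subr.
  by apply: pl_on_bump (p1 _); apply: pl_on_subr.
- move=> [y s] [/= yQ ys ym yU].
  have y0 : (0 <= y q :> R)%R by case: yQ.
  have m0 : (0 <= mass U y)%R by apply: mass_ge0; case: yQ.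
  have w0 : (0 <= y q + (unraised_weight (y, s) - y q))%R.
    by rewrite addrC subrK; apply: unraised_ge0.
  have [h1 h2] := bump_flat w0 yQ ys.
  rewrite massU in yU.
  split=> //=.
    by rewrite mass_bump inE -ym -addrA unraised_total.
  by rewrite mass_bump (negPf qU) addr0; apply: unraised_height.
- split=> -[y s] [/= yQ ys ym yU].
  + have y0 : (0 <= y q :> R)%R by case: yQ.
    have wE : unraised_weight (raise (y, s)) = y q.
      by rewrite /unraised_weight /= ffunE eqxx; apply: unraised_raise.
    rewrite /lower wE /=; congr (_, _); last by rewrite addrK.
    apply/ffunP => p; rewrite !ffunE eqxx; case: eqP => // ->.
    by rewrite addrC subrK.
  + have y0 : (0 <= y q :> R)%R by case: yQ.
    rewrite /raise /= ffunE eqxx.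
    have -> : (y q + (unraised_weight (y, s) - y q) = unraised_weight (y, s))%R by rewrite addrC subrK.
    congr (_, _); last by rewrite subrK.
    apply/ffunP => p; rewrite !ffunE; case: eqP => // ->.
    by rewrite (addrC (y q)) subrK; apply: raise_unraised.
Qed.

Let off_star U : set VR := partial_cylinder U `&` [set u : VR | u.1 q = 0%R].

Lemma flatten_at_q U u : star_cylinder U u -> (flatten u).1 q = u.1 q.
Proof.
move=> hu; have [_ [[_ cL _] _] _] := star_cylinder_cases hu.
rewrite /= !ffunE ltxx; have [->|/cL] := eqVneq ((G (above q u.1)).1 q) 0%R.
  by rewrite addr0.
by rewrite inE ltxx andbF.
Qed.

Lemma bump0 (x : V) : bump q 0%R x = x.
Proof. by apply/ffunP => p; rewrite ffunE addr0 if_same. Qed.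

Lemma raise_id (v : VR) : v.1 q = 0%R -> raise v = v.
Proof.
move=> v0; rewrite /raise v0 addr0 [RHS]surjective_pairing; congr (_, _).
have -> : Num.min (0 : R)%R (Num.max 0 (- v.2))%R = 0%R by rewrite min_l // le_max lexx.
exact: bump0.
Qed.

Lemma lower_id (v : VR) : v.1 q = 0%R -> lower v = v.
Proof.
move=> v0; rewrite /lower /unraised_weight v0 unraised0 subr0 subr0 [RHS]surjective_pairing.
by rewrite bump0.
Qed.

Lemma partial_cylinder_split U u :
  partial_cylinder U u <-> (star_cylinder U `|` off_star U) u.
Proof.
split=> [hu|[[]|[]]]//; have [/realizationE[[_ _ xc] _] _ _ _] := hu.
have [|uq] := eqVneq (u.1 q) 0%R; [by right|left; split=> // p up].
exact: xc.
Qed.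

Lemma off_star_setU1 U : q \notin U -> off_star U = off_star (q |: U).
Proof.
move=> qU; apply/predeqP => u.
have massU x : mass (q |: U) x = (x q + mass U x)%R by rewrite /mass big_setU1.
by split=> -[[ux u0 uU uQ] uq]; split=> //; split=> //; move: uU;
  rewrite massU uq add0r.
Qed.

(** In the star of [q] the map is [raise] in the flattened coordinates; it is the
    identity where the weight of [q] vanishes, hence can be extended by the
    identity off the star. *)
Lemma pl_inverse_step U : q \notin U -> exists f g,
  [/\ pl_inverse (partial_cylinder U) (partial_cylinder (q |: U)) f g,
      forall x, realization Q x -> f (x, mass U x) = (x, mass (q |: U) x) &
      forall u : VR, partial_cylinder U u -> u.1 q = 0%R -> f u = u].
Proof.
move=> qU.
have inv1 := pl_inverse_comp (pl_inverse_comp (pl_inverse_flatten U)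
  (pl_inverse_raise qU)) (pl_inverse_sym (pl_inverse_flatten (q |: U))).
have pO : polyhedron (off_star U).
  apply: polyhedronI; first exact: polyhedron_partial_cylinder.
  apply: polyhedron_eq; last exact: pl_on_cst (@polyhedronT _ _).
  exact: pl_on_coord (pl_on_fst_id (@polyhedronT _ _)).
have inv2 : pl_inverse (off_star U) (off_star (q |: U)) id id.
  by rewrite -off_star_setU1 //; split=> //; apply: pl_on_id.
have agree1 u : star_cylinder U u -> off_star U u ->
    (unflatten \o (raise \o flatten)) u = id u.
  move=> su [_ /= uq]; rewrite raise_id; first exact: flattenK su.
  by rewrite (flatten_at_q su).
have agree2 u : star_cylinder (q |: U) u -> off_star (q |: U) u ->
    ((unflatten \o lower) \o flatten) u = id u.
  move=> su [_ /= uq]; rewrite lower_id; first exact: flattenK su.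
  by rewrite (flatten_at_q su).
have inv := pl_inverse_glue inv1 inv2 agree1 agree2.
have E W : star_cylinder W `|` off_star W = partial_cylinder W.
  by apply/predeqP => u; rewrite partial_cylinder_split.
eexists; eexists; split; first by rewrite -(E U) -(E (q |: U)); exact: inv.
- move=> x /realizationE[xQ xm].
  have massU : mass (q |: U) x = (x q + mass U x)%R by rewrite /mass big_setU1.
  have x0 : forall p, (0 <= x p)%R by case: xQ.
  have m0 := mass_ge0 U x0.
  have hx : partial_cylinder U (x, mass U x).
    split=> //=; [|by right]; apply/realizationE; split=> //.
    by apply: chain_coneS xQ; apply/fintype.subsetP => p; rewrite inE.
  move/partial_cylinder_split: (hx) => [sx|ox]; last first.
    by rewrite (piecewiseR agree1) // massU; case: ox => _ /= ->; rewrite add0r.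
  rewrite piecewiseL //= /flatten /= Gbase /=; last exact: chain_cone_above.
  rewrite above_split subr0 /raise /=.
  have -> : Num.max (0 : R)%R (- mass U x)%R = 0%R by rewrite max_l // oppr_le0.
  have -> : Num.min (x q : R) 0%R = 0%R by apply: min_r.
  rewrite bump0 /unflatten /= (addrC (mass U x)) -massU.
  have h0 : (0 <= mass (q |: U) x)%R by apply: mass_ge0.
  have -> : Num.max (0 : R)%R (- mass (q |: U) x)%R = 0%R by rewrite max_l // oppr_le0.
  have -> : Num.max (0 : R)%R (mass (q |: U) x) = mass (q |: U) x by rewrite max_r.
  have cL := chain_cone_above q xQ.
  rewrite -Gbase //; have [_ _ _ _ [G'G _]] := GG'; rewrite G'G ?above_split //.
  apply: chain_coneS cL.
  by apply/fintype.subsetP => p; rewrite !inE => /andP[].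
- move=> u hu uq; rewrite (piecewiseR agree1) //.
Qed.
End Step.

Definition cylinder : set VR :=
  [set u | [/\ realization [set: P]%SET u.1, (0 <= u.2)%R, (u.2 <= 1)%R &
               u.2 = 0%R \/ chain_cone Q u.1]].

Lemma partial_cylinder_full u : partial_cylinder Q u <-> cylinder u.
Proof.
have massQ x : realization [set: P]%SET x -> chain_cone Q x -> mass Q x = 1%R.
  move=> /realizationE[_ <-] [_ xQ _]; rewrite /mass [RHS](bigID (mem Q)) /=.
  rewrite [X in (_ + X)%R]big1 ?addr0; last first.
    by move=> p /andP[_]; apply: contraNeq => /xQ.
  by apply: eq_bigl => p; rewrite inE.
split=> -[ux u0 uU uQ]; split=> //; case: (uQ) => [->|h].
- exact: ler01.
- by rewrite -(massQ _ ux h).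
- by apply: mass_ge0; have /realizationE[[]] := ux.
- by rewrite massQ.
Qed.

(** Enumerating [Q] in any order, one composes the steps that start from
    [|P|], the partial cylinder over the empty set, and end at the partial
    cylinder over [Q], which is the whole cylinder since all the mass of a point
    of [|Q|] is carried by [Q]. *)
Lemma collared_cylinder : collared R Q -> exists h : V -> VR,
  [/\ pl_homeo (realization [set: P]%SET) cylinder h,
      forall x, realization Q x -> h x = (x, 1%R) &
      forall x, realization [set: P]%SET x -> (forall q, q \in Q -> x q = 0%R) ->
        h x = (x, 0%R)].
Proof.
move=> coll.
suff H (s : seq P) : uniq s -> {subset s <= Q} -> exists h g,
  [/\ pl_inverse (realization [set: P]%SET) (partial_cylinder [set p in s]%SET) h g,
      forall x, realization Q x -> h x = (x, mass [set p in s]%SET x) &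
      forall x, realization [set: P]%SET x -> (forall q, q \in Q -> x q = 0%R) ->
        h x = (x, 0%R)].
  have [|h [g [hg hQ h0]]] := H (enum Q) (enum_uniq _).
    by move=> p; rewrite mem_enum.
  have QE : [set p in enum Q]%SET = Q by apply/setP => p; rewrite inE mem_enum.
  rewrite QE in hg hQ; exists h; split=> //.
    apply/pl_homeoP; exists g.
    by have <- : partial_cylinder Q = cylinder by apply/predeqP; exact: partial_cylinder_full.
  move=> x hx; rewrite hQ //; congr (_, _); have /realizationE[[x0 xQ _] <-] := hx.
  rewrite /mass [RHS](bigID (mem Q)) /=.
  rewrite [X in _ = (_ + X)%R]big1 ?addr0; last first.
    by move=> p /andP[_]; apply: contraNeq => /xQ.
  by apply: eq_bigl => p; rewrite inE.
elim: s => [_ _|q s IH /= /andP[qs us] sQ].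
  have s0 : [set p in [::]]%SET = finset.set0 :> {set P} by apply/setP => p; rewrite !inE.
  have m0 x : mass [set p in [::]]%SET x = 0%R by rewrite s0 /mass big_set0.
  have pR := polyhedron_realization R [set: P]%SET.
  exists (fun x => (x, 0%R)), fst; split=> [|x hx|//]; last by rewrite m0.
  split=> //.
  - by apply: pl_on_pair; [exact: pl_on_id|exact: pl_on_cst].
  - by move=> x hx; split=> //=; [rewrite m0|left].
  - exact: pl_on_fst_id (polyhedron_partial_cylinder _).
  - by move=> u [].
  - split=> // -[x t] [/= _ t0]; rewrite m0 => t1 _; congr (_, _).
    by apply/le_anti; rewrite t0 t1.
have [|h [g [hg hQ h0]]] := IH us.
  by move=> p ps; apply: sQ; rewrite inE ps orbT.
have qQ : q \in Q by apply: sQ; rewrite mem_head.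
have [h1 [hom base]] := coll q qQ.
have [G [/pl_homeoP[G' GG'] Gt Gb]] := collar_homogenize hom base.
have qs' : q \notin [set p in s]%SET by rewrite inE.
have [f [f' [ff' fQ f0]]] := pl_inverse_step qQ GG' Gt Gb qs'.
have sE : [set p in q :: s]%SET = q |: [set p in s]%SET.
  by apply/setP => p; rewrite !inE.
rewrite sE; exists (f \o h), (g \o f'); split.
- exact: pl_inverse_comp hg ff'.
- by move=> x hx; rewrite /= hQ // fQ.
- move=> x hx xQ; rewrite /= h0 // f0 //; last exact: xQ.
  by rewrite -h0 //; case: hg => _ hm _ _ _; apply: hm.
Qed.
End Push.

(** * The staircase subdivision of a prism *)

Section Staircase.
Variables (R : realType) (d : Order.disp_t) (P : finPOrderType d).
Local Open Scope ring_scope.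
Local Open Scope order_scope.
Notation V := {ffun P -> R^o}.

(** If an amount [s] is poured into the elements of a chain from the bottom,
    up to the capacity [x r] at [r], then [p] receives this amount. *)
Definition lower_part (s : R) (x : P -> R) (p : P) : R :=
  Num.max 0%R (Num.min (x p) (s - \sum_(r | (r < p)%O) x r))%R.

Lemma lower_part_ge0 s x p : (0 <= lower_part s x p)%R.
Proof. by rewrite /lower_part le_max lexx. Qed.

Lemma lower_part_le s x p : (0 <= x p)%R -> (lower_part s x p <= x p)%R.
Proof. by move=> x0; rewrite /lower_part; minmax. Qed.

Lemma lower_part0 x p : (forall r, (0 <= x r)%R) -> lower_part 0 x p = 0%R.
Proof.
move=> x0; have : (0 <= \sum_(r | (r < p)%O) x r)%R by apply: sumr_ge0.
by rewrite /lower_part; have := x0 p; minmax.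
Qed.

Lemma lower_part_support s x p : x p = 0%R -> lower_part s x p = 0%R.
Proof. by rewrite /lower_part => ->; minmax. Qed.

(** By removing the top element of the support: the capacities below it are all
    the others. *)
Lemma sum_lower_part s (x : V) : (0 <= s)%R ->
    (forall p, (0 <= x p)%R) ->
    (forall p q, x p != 0%R -> x q != 0%R -> p >=< q) ->
  (\sum_p lower_part s x p = Num.min s (\sum_p x p))%R.
Proof.
move=> s0; have [n] := ubnP #|[set p | x p != 0%R]%SET|.
elim: n x => // n IH x /ltnSE ub x0 xc.
have [p0 xp0|xz] := pickP (fun p => x p != 0%R); last first.
  have x00 p : x p = 0%R by have /negbFE/eqP := xz p.
  rewrite !big1 ?min_r // => p _; exact: lower_part_support.
pose p := [arg max_(p > p0 | x p != 0%R) #|[set r | (r <= p)%O]%SET|]%N.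
(* The number of elements below an element is largest at the top of the chain. *)
have [xp pmax] : x p != 0%R /\ forall r, x r != 0%R -> r <= p.
  rewrite /p; case: arg_maxnP => //= m xm max; split=> // r xr.
  have := xc r m xr xm; rewrite /Order.comparable => /orP[//|mr].
  have sub : [set s | s <= m]%SET \subset [set s | s <= r]%SET.
    by apply/fintype.subsetP => t; rewrite !inE => /le_trans; apply.
  have /eqP AE : [set s | s <= m]%SET == [set s | s <= r]%SET.
    by rewrite eqEcard sub; apply: max.
  have : r \in [set s | s <= r]%SET by rewrite inE.
  rewrite -AE.
  by rewrite inE.
pose x' : V := [ffun r => if r == p then 0%R else x r].
have x'p : x' p = 0%R by rewrite ffunE eqxx.
have x'E r : r != p -> x' r = x r by rewrite ffunE => /negPf ->.
have x'0 r : (0 <= x' r)%R.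
  by have [->|/x'E->] := eqVneq r p; [rewrite x'p|].
have x'x r : x' r != 0%R -> x r != 0%R.
  by have [->|/x'E->//] := eqVneq r p; rewrite x'p eqxx.
have IHx : (\sum_r lower_part s x' r = Num.min s (\sum_r x' r))%R.
  apply: IH => // [|r t /x'x xr /x'x xt]; last exact: xc.
  apply: leq_trans ub; apply: proper_card; apply/properP; split.
    by apply/fintype.subsetP => r; rewrite !inE => /x'x.
  by exists p; rewrite !inE ?x'p ?eqxx.
have -> : (\sum_r x r = x p + \sum_r x' r)%R.
  rewrite (bigD1 p) //= [in RHS](bigD1 p) //= x'p add0r.
  by congr (_ + _)%R; apply: eq_bigr => r /x'E.
have below : (\sum_(r | (r < p)%O) x r = \sum_r x' r)%R.
  rewrite [RHS](bigID (fun r => r < p)) /= [X in (_ + X)%R]big1 ?addr0.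
    by apply: eq_bigr => r rp; rewrite x'E // lt_eqF.
  move=> r nrp; have [->//|rp] := eqVneq r p; rewrite x'E //; apply/eqP.
  by apply: contraNT nrp => xr; rewrite lt_neqAle rp pmax.
have rest r : r != p -> lower_part s x r = lower_part s x' r.
  move=> rp; have [xr|xr] := eqVneq (x r) 0%R.
    by rewrite !lower_part_support ?x'E.
  rewrite /lower_part x'E //; congr (Num.max _ (Num.min _ (_ - _)))%R.
  apply: eq_bigr => t tr; rewrite x'E //; apply: contraTneq tr => ->.
  by rewrite le_gtF // pmax.
rewrite (bigD1 p) //= (eq_bigr (lower_part s x')) //.
have -> : (\sum_(r | r != p) lower_part s x' r = \sum_r lower_part s x' r)%R.
  by rewrite [RHS](bigD1 p) //= lower_part_support ?add0r.
rewrite IHx.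
rewrite /lower_part below; have := x0 p.
have : (0 <= \sum_r x' r)%R by apply: sumr_ge0.
move: s0; minmax.
Qed.

(** The supports of [a] and [b] share at most one element, where pouring stops:
    all that lies strictly below an element carrying [a] carries no [b], and all
    [a] lies below an element carrying [b]. *)
Lemma lower_partE (a b : P -> R) p :
    (forall r, (0 <= a r)%R) -> (forall r, (0 <= b r)%R) ->
    (forall r t, a r != 0%R -> b t != 0%R -> r <= t) ->
  lower_part (\sum_r a r) (fun r => a r + b r)%R p = a p.
Proof.
move=> a0 b0 ab; rewrite /lower_part.
have [ap|ap] := eqVneq (a p) 0%R.
  have [bp|bp] := eqVneq (b p) 0%R; first by rewrite ap bp addr0; minmax.
  have h : (\sum_r a r <= \sum_(r | (r < p)%O) (a r + b r))%R.
    rewrite (bigID (fun r => r < p)) /= [X in (_ + X)%R]big1 ?addr0.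
      by apply: ler_sum => r _; rewrite lerDl.
    move=> r nrp; apply/eqP; apply: contraNT nrp => ar.
    rewrite lt_neqAle ab // andbT; apply: contraNneq ar => ->; exact/eqP.
  by rewrite ap; have := b0 p; move: h; minmax.
(* An element with [b] strictly below [p] would lie above [p], which carries [a]. *)
have below : (\sum_(r | (r < p)%O) (a r + b r) = \sum_(r | (r < p)%O) a r)%R.
  apply: eq_bigr => r rp; have [->|br] := eqVneq (b r) 0%R; first by rewrite addr0.
  by have := le_lt_trans (ab _ _ ap br) rp; rewrite ltxx.
have -> : (\sum_r a r = a p + \sum_(r | (r < p)%O) a r +
    \sum_(r | (r != p) && ~~ (r < p)%O) a r)%R.
  rewrite (bigD1 p) //= -addrA; congr (_ + _)%R.
  rewrite (bigID (fun r => r < p)) /=; congr (_ + _)%R; apply: eq_bigl => r.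
  by rewrite andb_idl // => /lt_eqF ->.
rewrite below.
have [bp|bp] := eqVneq (b p) 0%R; last first.
  rewrite [X in (_ + X - _)%R]big1; first by have := a0 p; have := b0 p; minmax.
  move=> r /andP[rp nrp]; apply/eqP; apply: contraNT nrp => ar.
  by rewrite lt_neqAle rp ab.
have : (0 <= \sum_(r | (r != p) && ~~ (r < p)%O) a r)%R by apply: sumr_ge0.
by rewrite bp; have := a0 p; minmax.
Qed.
End Staircase.

(** * The poset with a collar attached as a geometric cylinder *)

Section Cylinder.
Variables (R : realType) (d : Order.disp_t) (P : finPOrderType d).
Variables (Q : {set P}) (clQ : closed_subposet Q).
Local Open Scope ring_scope.
Local Open Scope order_scope.
Local Open Scope quotient_scope.
Notation V := {ffun P -> R^o}.
Notation VR := (V * R^o)%type.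
Notation PP := (pplus clQ).
Notation VP := {ffun PP -> R^o}.
Implicit Types (e : PP) (p : P) (y : VP) (x : V).

Definition base e : P := (coords (repr e)).1.
Definition level e : {set 'I_2} := (coords (repr e)).2.

Notation bottom := (val I0).
Notation top := (val I1).
Notation middle := [set: 'I_2]%SET.

Lemma middle_neq0 : middle != finset.set0.
Proof. by apply/set0Pn; exists ord0; rewrite finset.in_setT. Qed.

Definition I01 : interval_poset := exist _ middle middle_neq0.

Lemma coords_repr (z : disjoint_sum Q) : coords (repr (\pi_PP z)) = coords z.
Proof. by apply/eqP; rewrite -eq_pi_coords reprK. Qed.

Lemma base_level_inj e e' : base e = base e' -> level e = level e' -> e = e'.
Proof.
move=> h1 h2; apply/eqP; rewrite -[e]reprK -[e']reprK eq_pi_coords.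
by rewrite (surjective_pairing (coords _)) -/(base e) -/(level e) h1 h2
  [X in _ == X](surjective_pairing (coords _)).
Qed.

Lemma leE e e' : (e <= e') = (base e <= base e') && (level e \subset level e').
Proof. by rewrite -{1}[e]reprK -{1}[e']reprK; apply: pplus_leE. Qed.

Lemma base_incl p : base (pplus_incl clQ p) = p.
Proof. by rewrite /base coords_repr. Qed.
Lemma level_incl p : level (pplus_incl clQ p) = bottom.
Proof. by rewrite /level coords_repr. Qed.
Lemma base_cyl q i : base (pplus_cyl clQ q i) = val q.
Proof. by rewrite /base coords_repr. Qed.
Lemma level_cyl q i : level (pplus_cyl clQ q i) = val i.
Proof. by rewrite /level coords_repr. Qed.

Lemma base_Q e : level e != bottom -> base e \in Q.
Proof.
rewrite /base /level; case: (repr e) => [p|[q i]] /=; first by rewrite eqxx.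
by move=> _; apply: valP.
Qed.

Lemma level_cases e : [\/ level e = bottom, level e = middle | level e = top].
Proof.
have : level e != finset.set0.
  by rewrite /level; case: (repr e) => [p|[q i]] /=; [exact: (valP I0)|exact: (valP i)].
move: (level e) => S S0.
have I2 (i : 'I_2) : i = ord0 \/ i = ord_max.
  by case: i => [[|[|//]] ?]; [left|right]; apply: val_inj.
have [h0|h0] := boolP (ord0 \in S); have [h1|h1] := boolP (ord_max \in S).
- by constructor 2; apply/setP => i; rewrite finset.in_setT; case: (I2 i) => ->.
- constructor 1; apply/setP => i; rewrite finset.in_set1.
  by case: (I2 i) => ->; rewrite ?h0 ?(negPf h1).
- constructor 3; apply/setP => i; rewrite finset.in_set1.
  by case: (I2 i) => ->; rewrite ?h1 ?(negPf h0).
- case/set0Pn: S0 => i; case: (I2 i) => ->; rewrite ?(negPf h0) ?(negPf h1) //.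
Qed.

Lemma middle_bottom : (middle == bottom) = false.
Proof. by apply/eqP => /setP /(_ ord_max); rewrite !inE. Qed.
Lemma middle_top : (middle == top) = false.
Proof. by apply/eqP => /setP /(_ ord0); rewrite !inE. Qed.
Lemma top_bottom : (top == bottom) = false.
Proof. by apply/eqP => /setP /(_ ord0); rewrite !inE. Qed.
Lemma bottom_top : (bottom == top) = false.
Proof. by rewrite eq_sym top_bottom. Qed.
Lemma middle_subF i : (middle \subset [set i]) = false.
Proof.
apply/negbTE/negP => /subset_leq_card.
by rewrite cards1 cardsT card_ord.
Qed.
Lemma top_bottomF : (top \subset bottom) = false.
Proof. by rewrite /= finset.sub1set inE. Qed.
Lemma bottom_topF : (bottom \subset top) = false.
Proof. by rewrite /= finset.sub1set inE. Qed.

(** At most one element has a given base and level, so the sum is a coordinate of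
    [y], or zero when [p] is outside [Q] and the level is not the bottom. *)
Definition at_level y p (S : {set 'I_2}) : R :=
  (\sum_(e | (base e == p) && (level e == S)) y e)%R.

Lemma at_levelE y e : at_level y (base e) (level e) = y e.
Proof.
rewrite /at_level (big_pred1 e) // => e'; apply/andP/eqP => [[/eqP h1 /eqP h2]|->//].
exact: base_level_inj.
Qed.

Lemma at_level_neq0 y p S : at_level y p S != 0%R ->
  exists e, [/\ base e = p, level e = S & y e != 0%R].
Proof.
move=> h; have [e /andP[/andP[/eqP h1 /eqP h2] ye]|h0] :=
  pickP (fun e => (base e == p) && (level e == S) && (y e != 0%R)).
  by exists e.
case/eqP: h; apply: big1 => e /andP[h1 h2].
by have := h0 e; rewrite h1 h2 /= => /negbFE/eqP.
Qed.

Lemma at_level_ge0 y p S : (forall e, (0 <= y e)%R) -> (0 <= at_level y p S)%R.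
Proof. by move=> y0; apply: sumr_ge0. Qed.

Lemma sum_levels (w : PP -> R) (a b c : R) y :
    (forall e, w e = if level e == bottom then a else if level e == top then c else b) ->
  (\sum_e y e * w e = \sum_p (at_level y p bottom * a +
     at_level y p middle * b + at_level y p top * c))%R.
Proof.
move=> wE; rewrite (partition_big base xpredT) //=; apply: eq_bigr => p _.
rewrite (bigID (fun e => level e == bottom)) /= -addrA; congr (_ + _)%R.
  by rewrite /at_level mulr_suml; apply: eq_bigr => e /andP[_ h]; rewrite wE h.
rewrite (bigID (fun e => level e == middle)) /=; congr (_ + _)%R.
  rewrite /at_level mulr_suml; apply: eq_big => e.
    rewrite -andbA; congr (_ && _); apply: andb_idl => /eqP ->.
    by rewrite middle_bottom.
  by move=> /andP[_ /eqP h]; rewrite wE h middle_bottom middle_top.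
rewrite /at_level mulr_suml; apply: eq_big => e.
  rewrite -!andbA; congr (_ && _).
  by case: (level_cases e) => ->; rewrite ?eqxx ?middle_bottom ?middle_top
    ?top_bottom ?bottom_top ?(eq_sym top) ?middle_top ?andbF.
by move=> /andP[/andP[_ /negPf h1] h2]; rewrite wE h1; case: (level_cases e) h1 h2
  => ->; rewrite ?eqxx // !top_bottom.
Qed.

Lemma base_sum y p : (pushforward base y p =
  at_level y p bottom + at_level y p middle + at_level y p top)%R.
Proof.
pose y' : VP := [ffun e => if base e == p then y e else 0%R].
have h S r : at_level y' r S = if r == p then at_level y r S else 0%R.
  rewrite /at_level; case: eqP => [->|/eqP rp].
    by apply: eq_bigr => e /andP[/eqP h _]; rewrite ffunE h eqxx.
  by apply: big1 => e /andP[/eqP h _]; rewrite ffunE h (negPf rp).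
have sumE := @sum_levels (fun=> 1)%R 1 1 1 y'; rewrite ffunE big_mkcond.
rewrite (eq_bigr (fun e => y' e * 1)%R) => [|e _]; last by rewrite mulr1 ffunE.
rewrite sumE => [|e]; last by do 2?case: ifP.
rewrite (bigD1 p) //= !h eqxx !mulr1 big1 ?addr0 // => r rp.
by rewrite !h (negPf rp) !mulr1 !addr0.
Qed.

Definition height e : R :=
  if level e == bottom then 0%R else if level e == top then 1%R else (2^-1)%R.

Definition to_cylinder y : VR :=
  (pushforward base y, \sum_e y e * height e)%R.

(** The levels bottom, middle and top are at the heights [0], [1/2] and [1].  A
    simplex of [Q * I] meets at most one of the bottom and top levels, so the
    height of a point determines its mass at each level. *)
Definition mass_bottom (t : R) : R := Num.max 0%R (1 - 2 * t)%R.
Definition mass_top (t : R) : R := Num.max 0%R (2 * t - 1)%R.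

(** In the order of [Q * I] the middle level lies above the two others, so on a
    chain the mass at the bottom or at the top level is carried by the lower
    elements. *)
Definition of_cylinder (u : VR) : VP :=
  [ffun e => let p := base e in
     let c0 := lower_part (mass_bottom u.2) u.1 p in
     let c1 := lower_part (mass_top u.2) u.1 p in
     if level e == bottom then c0 else if level e == top then c1
     else (u.1 p - c0 - c1)%R].

Lemma heightE y :
  (\sum_e y e * height e = \sum_p (at_level y p middle / 2 + at_level y p top))%R.
Proof.
rewrite (@sum_levels height 0 2^-1 1)%R //; apply: eq_bigr => p _.
by rewrite mulr0 add0r mulr1.
Qed.

Lemma base_neq0 y p : pushforward base y p != 0%R ->
  exists e, base e = p /\ y e != 0%R.
Proof.
rewrite base_sum => h.
have [h0|/at_level_neq0[e [? _ ?]]] := eqVneq (at_level y p bottom) 0%R; last by exists e.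
have [h1|/at_level_neq0[e [? _ ?]]] := eqVneq (at_level y p middle) 0%R; last by exists e.
have [h2|/at_level_neq0[e [? _ ?]]] := eqVneq (at_level y p top) 0%R; last by exists e.
by move: h; rewrite h0 h1 h2 !addr0 eqxx.
Qed.

Lemma sum_base y : (\sum_p pushforward base y p = \sum_e y e)%R.
Proof.
rewrite [RHS](partition_big base xpredT) //=.
by apply: eq_bigr => p _; rewrite ffunE.
Qed.

Lemma height_ge0 e : (0 <= height e)%R.
Proof. by rewrite /height; do 2?case: ifP => _; rewrite ?lexx ?ler01 // invr_ge0 ler0n. Qed.

Lemma height_le1 e : (height e <= 1)%R.
Proof. by rewrite /height; do 2?case: ifP => _; lra. Qed.

Lemma sub_bottom e : level e \subset bottom -> level e = bottom.
Proof. by case: (level_cases e) => -> //; rewrite ?middle_subF ?top_bottomF. Qed.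

Lemma to_cylinder_cylinder y :
  realization [set: PP]%SET y -> cylinder Q (to_cylinder y).
Proof.
move=> [y0 y1 _ yc].
have x0 p : (0 <= pushforward base y p)%R by rewrite ffunE; apply: sumr_ge0.
have xc p q : pushforward base y p != 0%R -> pushforward base y q != 0%R -> p >=< q.
  move=> /base_neq0[e [<- ye]] /base_neq0[e' [<- ye']].
  by have /orP[] := yc _ _ ye ye'; rewrite leE => /andP[h _];
    rewrite /Order.comparable h ?orbT.
split => /=.
- by split=> //; rewrite sum_base.
- by apply: sumr_ge0 => e _; apply: mulr_ge0 => //; apply: height_ge0.
- rewrite -y1; apply: ler_sum => e _; rewrite -[leRHS]mulr1.
  by apply: ler_wpM2l => //; apply: height_le1.
- have [e /andP[ye le]|none] := pickP (fun e => (y e != 0%R) && (level e != bottom)).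
    right; split=> // p /base_neq0[e' [<- ye']].
    have [le'|/base_Q//] := eqVneq (level e') bottom.
    have /orP[] := yc _ _ ye' ye; rewrite leE => /andP[h hl].
      exact: clQ h (base_Q le).
    by move: le; rewrite sub_bottom ?eqxx // -le'.
  left; apply: big1 => e _; have := none e.
  have [->|ye] := eqVneq (y e) 0%R; first by rewrite mul0r.
  by rewrite /height => /= /negbFE ->; rewrite mulr0.
Qed.

Section OfCylinder.
Variables (x : V) (t : R).
Hypothesis xt : cylinder Q (x, t).
Notation c0 := (lower_part (mass_bottom t) x).
Notation c1 := (lower_part (mass_top t) x).

Lemma cylinder_coord_ge0 p : (0 <= x p)%R.
Proof. by case: xt => -[]. Qed.

Lemma mass_bottom_or_top : mass_bottom t = 0%R \/ mass_top t = 0%R.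
Proof.
rewrite /mass_bottom /mass_top.
have [[->]|[->]] := max_cases 0%R (1 - 2 * t)%R; first by left.
by move=> h; right; rewrite max_l //; lra.
Qed.

Lemma lower_part_disjoint p : c0 p = 0%R \/ c1 p = 0%R.
Proof.
by case: mass_bottom_or_top => ->; [left|right]; apply: lower_part0 cylinder_coord_ge0.
Qed.

Lemma middle_ge0 p : (0 <= x p - c0 p - c1 p)%R.
Proof.
have h0 := lower_part_le (mass_bottom t) (cylinder_coord_ge0 p).
have h1 := lower_part_le (mass_top t) (cylinder_coord_ge0 p).
by case: (lower_part_disjoint p) => h; rewrite h; move: h0 h1; lra.
Qed.

Lemma below_le r p : r < p ->
  (x r + \sum_(s | (s < r)%O) x s <= \sum_(s | (s < p)%O) x s)%R.
Proof.
move=> rp; rewrite [leRHS](bigD1 r) //= lerD2l.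
rewrite [leRHS](bigID (fun s => s < r)) /=.
rewrite [X in (X + _)%R](eq_bigl (fun s => s < r)) ?lerDl.
  by apply: sumr_ge0 => *; apply: cylinder_coord_ge0.
move=> s; case sr: (s < r); rewrite ?andbF // (lt_trans sr rp) andbT.
by rewrite lt_eqF.
Qed.

Lemma lower_part_full s r p : lower_part s x p != 0%R -> r < p ->
  lower_part s x r = x r.
Proof.
move=> cp rp; have := below_le rp; have := cylinder_coord_ge0 r.
move: cp; rewrite /lower_part.
have [[->]|[->]] := max_cases 0%R (Num.min (x p : R) (s - \sum_(r | (r < p)%O) x r))%R.
  by rewrite eqxx.
have [[->]|[->]] := min_cases (x p : R) (s - \sum_(r | (r < p)%O) x r)%R => h1 h2 h3 h4 h5;
  rewrite min_l ?max_r //; lra.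
Qed.

(** Outside [Q] either the height is zero, and then all the mass is at the bottom
    level, or the coordinate vanishes. *)
Lemma outside_Q p : p \notin Q -> c0 p = x p /\ c1 p = 0%R.
Proof.
case: (xt) => /= -[x0 x1 _ _] t0 t1 tQ pQ.
case: tQ => [->|[_ xQ _]]; last first.
  have xp : x p = 0%R by apply: contraNeq pQ => /xQ.
  by rewrite !lower_part_support.
have -> : mass_top 0%R = 0%R by rewrite /mass_top max_l // mulr0 sub0r oppr_le0 ler01.
have -> : mass_bottom 0%R = 1%R by rewrite /mass_bottom mulr0 subr0 max_r // ler01.
split; last exact: lower_part0 cylinder_coord_ge0.
have : (x p + \sum_(s | (s < p)%O) x s <= 1)%R.
  rewrite -x1 [leRHS](bigD1 p) //= lerD2l [leRHS](bigID (fun s => s < p)) /=.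
  rewrite [X in (X + _)%R](eq_bigl (fun s => s < p)) ?lerDl; first by apply: sumr_ge0.
  by move=> s; case sp: (s < p); rewrite ?andbF // lt_eqF.
rewrite /lower_part; have := x0 p; move=> h1 h2.
by rewrite min_l ?max_r //; lra.
Qed.

Notation y := (of_cylinder (x, t)).

Lemma of_cylinder_level p : [/\ at_level y p bottom = c0 p,
  at_level y p middle = (x p - c0 p - c1 p)%R & at_level y p top = c1 p].
Proof.
have none S : p \notin Q -> S != bottom -> at_level y p S = 0%R.
  move=> pQ Sb; apply/eqP; apply: contraNT pQ => /at_level_neq0[e [<- le _]].
  by apply: base_Q; rewrite le.
split.
- by have := at_levelE y (pplus_incl clQ p); rewrite ffunE base_incl level_incl eqxx.
- have [pQ|pQ] := boolP (p \in Q); last first.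
    by rewrite none ?middle_bottom //; have [-> ->] := outside_Q pQ; rewrite subrr subr0.
  have := at_levelE y (pplus_cyl clQ (exist _ p pQ) I01).
  by rewrite ffunE base_cyl level_cyl /= middle_bottom middle_top.
- have [pQ|pQ] := boolP (p \in Q); last first.
    by rewrite none ?top_bottom //; have [_ ->] := outside_Q pQ.
  have := at_levelE y (pplus_cyl clQ (exist _ p pQ) I1).
  by rewrite ffunE base_cyl level_cyl top_bottom eqxx.
Qed.

Lemma of_cylinder_base : pushforward base y = x.
Proof.
apply/ffunP => p; rewrite base_sum; have [-> -> ->] := of_cylinder_level p.
by rewrite addrA subrK addrC subrK.
Qed.

Lemma of_cylinderK : to_cylinder y = (x, t).
Proof.
rewrite /to_cylinder of_cylinder_base heightE; congr (_, _).
case: (xt) => /= -[x0 x1 _ xc] t0 t1 _.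
have sE s : (0 <= s <= 1)%R -> (\sum_p lower_part s x p = s)%R.
  by move=> /andP[s0 s1]; rewrite sum_lower_part // x1 min_l.
have b1 : (0 <= mass_bottom t <= 1)%R.
  by rewrite /mass_bottom le_max lexx /= ge_max ler01 /=; lra.
have b2 : (0 <= mass_top t <= 1)%R.
  by rewrite /mass_top le_max lexx /= ge_max ler01 /=; lra.
rewrite (eq_bigr (fun p => 2^-1 * x p - 2^-1 * c0 p + 2^-1 * c1 p)%R); last first.
  by move=> p _; have [_ -> ->] := of_cylinder_level p; lra.
rewrite !big_split /= sumrN -!mulr_sumr x1 !sE //.
rewrite /mass_bottom /mass_top.
have [[->]|[->]] := max_cases 0%R (1 - 2 * t)%R;
have [[->]|[->]] := max_cases 0%R (2 * t - 1)%R; lra.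
Qed.

Lemma of_cylinder_realization : realization [set: PP]%SET y.
Proof.
case: (xt) => /= -[x0 x1 _ xc] t0 t1 _.
have support e : y e != 0%R -> x (base e) != 0%R.
  apply: contra_neq => xe; rewrite ffunE /= !lower_part_support // xe !subr0.
  by rewrite !if_same.
(* With [s] the mass of an outer level: if [p] receives some of it, everything
   strictly below [p] is full, so no mass of the middle level is below [p]. *)
have gap s s' p r : (s = mass_bottom t /\ s' = mass_top t) \/
      (s = mass_top t /\ s' = mass_bottom t) ->
    lower_part s x p != 0%R -> (x r - lower_part s x r - lower_part s' x r != 0)%R ->
    x p != 0%R -> x r != 0%R -> p <= r.
  move=> ss cp cr xp xr; have := xc p r xp xr; rewrite /Order.comparable => /orP[//|].
  rewrite le_eqVlt => /orP[/eqP->//|rp]; case/eqP: cr.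
  rewrite (lower_part_full cp rp) subrr sub0r.
  have -> : s' = 0%R.
    case: ss => -[sE ->]; case: mass_bottom_or_top => // s0;
    by move: cp; rewrite sE s0 lower_part0 ?eqxx // => *; apply: cylinder_coord_ge0.
  by rewrite lower_part0 ?oppr0 // => *; apply: cylinder_coord_ge0.
split=> // [e||e e'].
- rewrite ffunE /=; case: ifP => _; first exact: lower_part_ge0.
  by case: ifP => _; [exact: lower_part_ge0|exact: middle_ge0].
- by rewrite -sum_base of_cylinder_base.
- wlog: e e' / [|| level e == level e', (level e' == middle)
                 | (level e == bottom) && (level e' == top)].
    move=> H ye ye'.
    case c : [|| level e == level e', (level e' == middle)
               | (level e == bottom) && (level e' == top)]; first exact: H.
    rewrite comparable_sym; apply: H => //; move: c.
    by case: (level_cases e) => ->; case: (level_cases e') => ->;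
      rewrite ?eqxx ?middle_bottom ?middle_top ?top_bottom ?bottom_top ?orbT
        ?(eq_sym top) ?(eq_sym bottom) ?middle_top ?middle_bottom.
  move=> c ye ye'; have xe := support _ ye; have xe' := support _ ye'.
  have [lE|lE] := eqVneq (level e) (level e').
    by have := xc _ _ xe xe'; rewrite /Order.comparable !leE lE subxx !andbT.
  rewrite (negPf lE) /= in c; move: ye ye' lE; rewrite !ffunE /=.
  case/orP: c => [/eqP le'|/andP[/eqP le /eqP le']]; last first.
    rewrite le le' top_bottom !eqxx.
    by case: (lower_part_disjoint (base e)); case: mass_bottom_or_top => ->;
      rewrite ?lower_part0 ?eqxx // => *; apply: cylinder_coord_ge0.
  rewrite le' middle_bottom middle_top => h h' lE.
  suff lee : base e <= base e' by rewrite /Order.comparable leE lee le' finset.subsetT.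
  case: (level_cases e) h lE => ->; rewrite ?eqxx ?top_bottom ?middle_bottom // => h _.
    by apply: (gap (mass_bottom t) (mass_top t)) => //; left.
  apply: (gap (mass_top t) (mass_bottom t)) => //; first by right.
  by rewrite addrAC.
Qed.
End OfCylinder.

(** A chain cannot contain elements of the bottom and of the top level, so only
    one of these levels and the middle one carry mass, and [lower_partE]
    recovers how the mass is shared. *)
Lemma to_cylinderK y : realization [set: PP]%SET y -> of_cylinder (to_cylinder y) = y.
Proof.
move=> yr; have [y0 y1 _ yc] := yr.
pose A p := at_level y p bottom; pose M p := at_level y p middle; pose B p := at_level y p top.
have A0 p : (0 <= A p)%R by apply: at_level_ge0.
have M0 p : (0 <= M p)%R by apply: at_level_ge0.
have B0 p : (0 <= B p)%R by apply: at_level_ge0.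
have xE p : (pushforward base y p = A p + M p + B p)%R by apply: base_sum.
have sE : (\sum_p A p + \sum_p M p + \sum_p B p = 1)%R.
  by rewrite -y1 -sum_base (eq_bigr _ (fun p _ => xE p)) !big_split.
have tE : ((to_cylinder y).2 = (\sum_p M p) / 2 + \sum_p B p)%R.
  by rewrite /= heightE big_split /= mulr_suml.
have AM r p : A r != 0%R -> M p != 0%R -> r <= p.
  move=> /at_level_neq0[e [<- le ye]] /at_level_neq0[e' [<- le' ye']].
  have /orP[] := yc _ _ ye ye'; rewrite leE le le' => /andP[//].
  by rewrite middle_subF.
have BM r p : B r != 0%R -> M p != 0%R -> r <= p.
  move=> /at_level_neq0[e [<- le ye]] /at_level_neq0[e' [<- le' ye']].
  have /orP[] := yc _ _ ye ye'; rewrite leE le le' => /andP[//].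
  by rewrite middle_subF.
have AB r p : A r = 0%R \/ B p = 0%R.
  have [|] := eqVneq (A r) 0%R; [by left|have [|] := eqVneq (B p) 0%R; first by right].
  move=> /at_level_neq0[e [_ le ye]] /at_level_neq0[e' [_ le' ye']].
  have /orP[] := yc _ _ ye ye'; rewrite leE le le' => /andP[_].
    by rewrite top_bottomF.
  by rewrite bottom_topF.
have allAB : (forall p, A p = 0%R) \/ (forall p, B p = 0%R).
  have [r /eqP Ar|none] := pickP (fun r => A r != 0%R).
    by right=> p; case: (AB r p).
  by left=> p; apply/eqP; have := none p => /negbFE.
have x0 p : (0 <= pushforward base y p)%R by rewrite xE !addr_ge0.
have SM : (0 <= \sum_p M p)%R by apply: sumr_ge0.
have SA : (0 <= \sum_p A p)%R by apply: sumr_ge0.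
have SB : (0 <= \sum_p B p)%R by apply: sumr_ge0.
have cE : forall p, lower_part (mass_bottom (to_cylinder y).2) (to_cylinder y).1 p = A p /\
    lower_part (mass_top (to_cylinder y).2) (to_cylinder y).1 p = B p.
  move=> p; rewrite /mass_bottom /mass_top tE /=.
  case: allAB => h0.
    have SA0 : (\sum_p A p = 0)%R by apply: big1.
    rewrite SA0 add0r in sE.
    rewrite max_l; last by lra.
    rewrite max_r; last by lra.
    have -> : (2 * ((\sum_p M p) / 2 + \sum_p B p) - 1 = \sum_p B p)%R by lra.
    split; first by rewrite h0 lower_part0.
    rewrite -[RHS](lower_partE p B0 M0 BM); congr (lower_part _ _ _).
    by apply/funext => r; rewrite xE h0 add0r addrC.
  have SB0 : (\sum_p B p = 0)%R by apply: big1.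
  rewrite max_r; last by lra.
  rewrite max_l; last by lra.
  have -> : (1 - 2 * ((\sum_p M p) / 2 + \sum_p B p) = \sum_p A p)%R by lra.
  split; last by rewrite h0 lower_part0.
  rewrite -[RHS](lower_partE p A0 M0 AM); congr (lower_part _ _ _).
  by apply/funext => r; rewrite xE h0 addr0.
apply/ffunP => e; rewrite ffunE /=; have [-> ->] := cE (base e).
rewrite -[RHS]at_levelE xE; case: (level_cases e) => ->; rewrite ?eqxx ?middle_bottom ?middle_top ?top_bottom //.
by rewrite -/(M _); lra.
Qed.

Lemma pl_inverse_cylinder :
  pl_inverse (realization [set: PP]%SET) (cylinder Q) to_cylinder of_cylinder.
Proof.
have pR := polyhedron_realization R [set: PP]%SET.
have pC : polyhedron (cylinder (R := R) Q).
  have h := @partial_cylinder_full R _ _ Q.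
  exact: (pl_on_seteq h (polyhedron_partial_cylinder R Q Q)).
split.
- apply: pl_on_pair.
    apply: pl_on_ffun => // p; apply: pl_on_sum => // e _.
    by apply: pl_on_coord; apply: pl_on_id.
  apply: pl_on_sum => // e _; apply: (@pl_on_eq _ _ _ _ (fun y => height e *: (y e : R^o)))%R.
    by move=> y _; rewrite mulrC.
  by apply: pl_on_scale; apply: pl_on_coord; apply: pl_on_id.
- exact: to_cylinder_cylinder.
- have p1 := pl_on_fst_id pC; have p2 := pl_on_snd_id pC.
  have plow (f : VR -> R^o) p : pl_on (cylinder Q) f ->
      pl_on (cylinder Q) (fun u => lower_part (f u) u.1 p : R^o).
    move=> pf; apply: pl_on_max; first exact: pl_on_cst.
    apply: pl_on_min; first exact: pl_on_coord.
    apply: pl_on_subr => //; apply: pl_on_sum => // r _; exact: pl_on_coord.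
  have p2t : pl_on (cylinder Q) (fun u : VR => 2 * u.2 : R^o)%R := pl_on_scale 2%R p2.
  have pb p : pl_on (cylinder Q) (fun u => lower_part (mass_bottom u.2) u.1 p : R^o).
    apply: plow; apply: pl_on_max; first exact: pl_on_cst.
    by apply: pl_on_subr p2t; apply: pl_on_cst.
  have pt p : pl_on (cylinder Q) (fun u => lower_part (mass_top u.2) u.1 p : R^o).
    apply: plow; apply: pl_on_max; first exact: pl_on_cst.
    by apply: pl_on_subr p2t _; apply: pl_on_cst.
  apply: pl_on_ffun => // e; case: (level e == bottom) => //.
  case: (level e == top) => //.
  by apply: pl_on_subr => //; apply: pl_on_subr => //; apply: pl_on_coord.
- by move=> [x t]; apply: of_cylinder_realization.
- by split=> [|[x t]]; [exact: to_cylinderK|exact: of_cylinderK].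
Qed.

End Cylinder.

Section Ends.
Variables (R : realType) (d : Order.disp_t) (P : finPOrderType d).
Variables (Q : {set P}) (clQ : closed_subposet Q).
Local Open Scope ring_scope.
Local Open Scope order_scope.
Notation V := {ffun P -> R^o}.
Notation PP := (pplus clQ).

Lemma sum_pushforward (S T : finType) (f : S -> T) (z : {ffun S -> R^o}) (w : T -> R) :
  (\sum_t pushforward f z t * w t = \sum_s z s * w (f s))%R.
Proof.
rewrite [RHS](partition_big f xpredT) //=; apply: eq_bigr => t _.
by rewrite ffunE mulr_suml; apply: eq_bigr => s /eqP ->.
Qed.

Lemma pushforward_comp (S T U : finType) (f : S -> T) (g : T -> U) (z : {ffun S -> R^o}) :
  pushforward g (pushforward f z) = pushforward (g \o f) z.
Proof.
apply/ffunP => u; rewrite !ffunE.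
have h := sum_pushforward f z (fun t => (g t == u)%:R).
have E (I : finType) (A : pred I) (F : I -> R) : (\sum_(i | A i) F i = \sum_i F i * (A i)%:R)%R.
  by rewrite big_mkcond; apply: eq_bigr => i _; case: (A i); rewrite ?mulr1 ?mulr0.
by rewrite [LHS]E [RHS]E h.
Qed.

Lemma realization_pushforward (T : finType) (f : T -> PP) (z : {ffun T -> R^o}) :
    (forall s, (0 <= z s)%R) -> (\sum_s z s = 1)%R ->
    (forall s t, z s != 0%R -> z t != 0%R -> f s >=< f t) ->
  realization [set: PP]%SET (pushforward f z).
Proof.
move=> z0 z1 zc.
have supp e : pushforward f z e != 0%R -> exists s, f s = e /\ z s != 0%R.
  rewrite ffunE => h; have [s /andP[/eqP fs zs]|none] := pickP (fun s => (f s == e) && (z s != 0%R)).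
    by exists s.
  case/eqP: h; apply: big1 => s /eqP fs; have := none s.
  by rewrite fs eqxx /= => /negbFE/eqP.
split=> // [e||e e' /supp[s [<- zs]] /supp[t [<- zt]]]; last exact: zc.
- by rewrite ffunE; apply: sumr_ge0.
- rewrite -z1 (eq_bigr (fun e => pushforward f z e * 1)%R) => [|e _]; last by rewrite mulr1.
  by rewrite sum_pushforward; apply: eq_bigr => s _; rewrite mulr1.
Qed.

Lemma bottom_end S (x : V) : realization S x ->
  realization [set: PP]%SET (pushforward (pplus_incl clQ) x) /\
  to_cylinder (pushforward (pplus_incl clQ) x) = (x, 0%R).
Proof.
move=> [x0 x1 _ xc]; split.
  apply: realization_pushforward => // p q xp xq.
  have := xc p q xp xq; rewrite /Order.comparable !leE.
  by rewrite !base_incl !level_incl subxx !andbT.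
rewrite /to_cylinder sum_pushforward pushforward_comp; congr (_, _).
  apply/ffunP => p; rewrite ffunE (big_pred1 p) // => q /=.
  by rewrite base_incl.
by apply: big1 => p _; rewrite /height level_incl eqxx mulr0.
Qed.

Lemma top_end (x : V) : realization Q x ->
  realization [set: PP]%SET
    (pushforward (fun q => pplus_cyl clQ q I1) (restriction Q x)) /\
  to_cylinder (pushforward (fun q => pplus_cyl clQ q I1) (restriction Q x)) = (x, 1%R).
Proof.
move=> [x0 x1 xQ xc].
have sumQ (F : P -> R) : (\sum_(q : {q | q \in Q}) F (val q) = \sum_(p in Q) F p)%R.
  by rewrite -big_sub.
have sum1 : (\sum_q restriction Q x q = 1)%R.
  rewrite -x1 (bigID (mem Q)) /= [X in (_ + X)%R]big1 ?addr0.
    by rewrite -sumQ; apply: eq_bigr => q _; rewrite ffunE.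
  by move=> p; apply: contraNeq => /xQ.
split.
  apply: realization_pushforward => // [q|q q']; rewrite ?ffunE // => xq xq'.
  have := xc _ _ xq xq'; rewrite /Order.comparable !leE.
  by rewrite !base_cyl !level_cyl subxx !andbT.
rewrite /to_cylinder sum_pushforward pushforward_comp; congr (_, _).
  apply/ffunP => p; rewrite ffunE.
  have [pQ|pQ] := boolP (p \in Q).
    rewrite (big_pred1 (exist _ p pQ)) ?ffunE // => q /=.
    by rewrite base_cyl.
  rewrite big1 ?[RHS](_ : _ = 0%R) //; first by apply: contraNeq pQ => /xQ.
  by move=> q /eqP; rewrite /= base_cyl => h; case/negP: pQ; rewrite -h; apply: valP.
rewrite -sum1; apply: eq_bigr => q _.
by rewrite /height level_cyl top_bottom eqxx mulr1.
Qed.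

Lemma collared_homeo : collared R Q ->
  exists h : V -> {ffun PP -> R^o},
    [/\ pl_homeo (realization [set: P]%SET) (realization [set: PP]%SET) h,
        (forall x, realization (~: upper_set Q)%SET x ->
                   h x = pushforward (pplus_incl clQ) x) &
        (forall x, realization Q x ->
                   h x = pushforward (fun q => pplus_cyl clQ q I1)
                                     (restriction Q x))].
Proof.
move=> /(collared_cylinder clQ)[k [/pl_homeoP[k' kk'] kQ k0]].
have inv := pl_inverse_comp kk' (pl_inverse_sym (pl_inverse_cylinder R clQ)).
exists (of_cylinder clQ \o k); split.
- by apply/pl_homeoP; exists (k' \o to_cylinder (clQ := clQ)).
- move=> x xr; have [yr yE] := bottom_end xr.
  case: (xr) => x0 x1 xS xc.
  have xT : realization [set: P]%SET x by split=> // p _; rewrite finset.in_setT.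
  rewrite /= k0 // => [|q qQ]; first by rewrite -yE to_cylinderK.
  apply/eqP; apply: contraTT qQ => /xS; rewrite !inE.
  by apply: contra => qQ; apply/exists_inP; exists q.
- move=> x xr; have [yr yE] := top_end xr.
  by rewrite /= kQ // -yE to_cylinderK.
Qed.
End Ends.

(** * Differentials of piecewise linear maps *)

Section Differential.
Variable R : realType.
Local Open Scope ring_scope.
Local Open Scope classical_set_scope.
Implicit Types V W : vectType R.

Definition near0 (A : R -> Prop) :=
  exists2 e : R, 0 < e & forall t, 0 < t -> t < e -> A t.

Lemma near0W (A B : R -> Prop) : (forall t, 0 < t -> A t -> B t) -> near0 A -> near0 B.
Proof. by move=> AB [e e0 h]; exists e => // t t0 /(h t t0); apply: AB. Qed.

Lemma near0I (A B : R -> Prop) : near0 A -> near0 B -> near0 (fun t => A t /\ B t).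
Proof.
move=> [e e0 hA] [f f0 hB]; exists (Num.min e f); first by rewrite lt_min e0.
by move=> t t0; rewrite lt_min => /andP[te tf]; split; [exact: hA|exact: hB].
Qed.

Lemma near0_forall (I : finType) (A : I -> R -> Prop) :
  (forall i, near0 (A i)) -> near0 (fun t => forall i, A i t).
Proof.
move=> h; suff H (s : seq I) : near0 (fun t => forall i, i \in s -> A i t).
  by apply: near0W (H (enum I)) => t _ hA i; apply: hA; rewrite mem_enum.
elim: s => [|i s IH]; first by exists 1; rewrite ?ltr01.
apply: near0W (near0I (h i) IH) => t _ [h1 h2] j.
by rewrite inE => /orP[/eqP->|]; [|exact: h2].
Qed.

Lemma near0_ex (A : R -> Prop) : near0 A -> exists2 t, 0 < t & A t.
Proof.
move=> [e e0 h]; exists (e / 2); first by rewrite divr_gt0.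
by apply: h; [rewrite divr_gt0|rewrite ltr_pdivrMr // ltr_pMr // ltr1n].
Qed.

Lemma near0_true (A : R -> Prop) : (forall t, 0 < t -> A t) -> near0 A.
Proof. by move=> h; exists 1 => // t t0 _; apply: h. Qed.

Lemma near0_lt (a b c : R) : a < b -> near0 (fun t => a + t * c < b).
Proof.
move=> ab; have [c0|c0] := leP c 0.
  by apply: near0_true => t t0; rewrite (le_lt_trans _ ab) // gerDl pmulr_rle0.
exists ((b - a) / c); first by rewrite divr_gt0 // subr_gt0.
by move=> t t0; rewrite ltr_pdivlMr // ltrBrDl.
Qed.

Definition conewise_linear V W (T : set V) (f : V -> W) :=
  exists (I : finType) (J : I -> finType) (phi : forall i, J i -> {scalar V})
    (L : I -> {linear V -> W}),
    (forall v, T v <-> exists i, forall j, phi i j v <= 0) /\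
    forall i v, (forall j, phi i j v <= 0) -> f v = L i v.

(** Near [x] a cell containing [x] is the translate of the cone given by its
    inequalities that are equalities at [x].  If [w] annihilates all of these,
    each such cone is invariant under translation by [w], and the differential is
    linear on it.  The functionals [phi] and constants [b] are chosen before
    [x], so that afterwards [x] can be taken in general position to them. *)
Lemma pl_differential V W (X : set V) (f : V -> W) : pl_on X f ->
  exists (K : finType) (phi : K -> {scalar V}) (b : K -> R),
  forall x, X x -> exists (T : set V) (df : V -> W),
    [/\ conewise_linear T df,
        forall v, T v <-> near0 (fun t => X (x + t *: v)),
        forall v, T v -> near0 (fun t => f (x + t *: v) = f x + t *: df v) &
        forall w, (forall k, phi k x = b k -> phi k w = 0) ->
          forall v, T v -> T (v + w) /\ df (v + w) = df v + df w].
Proof.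
move=> [n [C [hC XE]]].
have cells i : exists k (phi : 'I_k -> {scalar V}) (b : 'I_k -> R)
    (L : {linear V -> W}) (c : W),
  (forall x, C i x <-> forall j, phi j x <= b j) /\ forall x, C i x -> f x = L x + c.
  have [[k [phi [b CE]]] [L [c hL]]] := hC i.
  by exists k, phi, b, L, c; rewrite CE in hL *.
pose k i := projT1 (cid (cells i)).
pose phi i : 'I_(k i) -> {scalar V} := projT1 (cid (projT2 (cid (cells i)))).
pose b i : 'I_(k i) -> R := projT1 (cid (projT2 (cid (projT2 (cid (cells i)))))).
pose L i : {linear V -> W} :=
  projT1 (cid (projT2 (cid (projT2 (cid (projT2 (cid (cells i)))))))).
have [c CL] : exists c : 'I_n -> W, forall i,
    (forall x, C i x <-> forall j, phi i j x <= b i j) /\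
    forall x, C i x -> f x = L i x + c i.
  have h i : exists c, (forall x, C i x <-> forall j, phi i j x <= b i j) /\
    forall x, C i x -> f x = L i x + c.
    exact: projT2 (cid (projT2 (cid (projT2 (cid (projT2 (cid (cells i)))))))).
  by exists (fun i => projT1 (cid (h i))) => i; exact: projT2 (cid (h i)).
exists {i : 'I_n & 'I_(k i)}, (fun t => phi (tag t) (tagged t)),
  (fun t => b (tag t) (tagged t)) => x Xx.
pose I := {i : 'I_n | `[< C i x >]}.
pose psi (i : I) (j : 'I_(k (val i))) : {scalar V} :=
  if phi (val i) j x == b (val i) j then phi (val i) j else \0 : {linear V -> R^o}.
pose inT (i : I) v := forall j, psi i j v <= 0.
have Cx (i : I) : C (val i) x by apply/asboolP; exact: (valP i).
have T_near (i : I) v : inT i v -> near0 (fun t => C (val i) (x + t *: v)).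
  move=> Tv; apply: (@near0W (fun t => forall j, phi (val i) j (x + t *: v) <= b (val i) j)).
    by move=> t _ h; apply/(CL _).1.
  apply: near0_forall => j; have := Tv j; rewrite /psi.
  have := ((CL (val i)).1 x).1 (Cx i) j.
  rewrite le_eqVlt => /orP[act|lt].
    rewrite act => h; apply: near0_true => t t0.
    by rewrite raddfD /= scalar_scale (eqP act) gerDl pmulr_rle0.
  move=> _; apply: near0W (near0_lt (phi (val i) j v) lt) => t _ /ltW.
  by rewrite raddfD /= scalar_scale.
have fE (i : I) v t : C (val i) (x + t *: v) -> f (x + t *: v) = f x + t *: L (val i) v.
  move=> Cv; rewrite ((CL _).2 _ Cv) ((CL _).2 _ (Cx i)) (addrC x) linearP.
  by rewrite -addrA addrC.
have L_eq (i i' : I) v : inT i v -> inT i' v -> L (val i) v = L (val i') v.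
  move=> /T_near h /T_near h'; have [t t0 [c1 c2]] := near0_ex (near0I h h').
  have := fE i v t c1; rewrite (fE i' v t c2) => /addrI /(scalerI (lt0r_neq0 t0)).
  by move=> ->.
pose df v := if [pick i : I | `[< inT i v >]] is Some i then L (val i) v else 0.
have dfE i v : inT i v -> df v = L (val i) v.
  move=> Ti; rewrite /df; case: pickP => [i' /asboolP Ti'|none].
    exact: L_eq.
  by have /asboolP := none i.
exists [set v | exists i, inT i v], df; split.
- by exists I, (fun i => 'I_(k (val i))), psi, (fun i => L (val i)).
- move=> v; split=> [[i /T_near]|].
    by apply: near0W => t _ h; rewrite XE; exists (val i).
  move=> near_X; apply: contrapT => nT.
  (* A cell not having [v] as tangent direction is left at once, either because
     [x] is outside or through an inequality that is an equality at [x]. *)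
  have out i : near0 (fun t => ~ C i (x + t *: v)).
    suff [j] : exists j, near0 (fun t => b i j < phi i j (x + t *: v)).
      by apply: near0W => t _ h /(CL i).1 /(_ j); rewrite leNgt h.
    have [Ci|nCi] := pselect (C i x); last first.
      have [j /negP] : exists j, ~ phi i j x <= b i j.
        by apply/existsNP => h; apply: nCi; apply/(CL i).1.
      rewrite -ltNge => lt; exists j.
      have nlt : - phi i j x < - b i j by rewrite ltrN2.
      apply: near0W (near0_lt (- phi i j v) nlt) => t _.
      by rewrite raddfD /= scalar_scale mulrN -opprD ltrN2.
    have iI : `[< C i x >] by apply/asboolP.
    have [j] : exists j, ~ psi (exist _ i iI) j v <= 0.
      by apply/existsNP => h; apply: nT; exists (exist _ i iI).
    rewrite /psi /=; case: eqP => [act|_]; last by rewrite /= lexx.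
    move=> /negP; rewrite -ltNge => pos; exists j; apply: near0_true => t t0.
    by rewrite raddfD /= scalar_scale act ltrDl mulr_gt0.
  have [t t0 [Xt none]] := near0_ex (near0I near_X (near0_forall out)).
  by move: Xt; rewrite XE => -[i Ci]; apply: (none i).
- move=> v [i Ti]; rewrite (dfE i) //; apply: near0W (T_near i v Ti) => t _.
  exact: fE.
- move=> w hw v [i Ti].
  have psiw j : psi i j w = 0.
    rewrite /psi; case: eqP => // act.
    exact: (hw (Tagged (fun i => 'I_(k i)) j)).
  have Tw : inT i w by move=> j; rewrite psiw.
  have Tvw : inT i (v + w) by move=> j; rewrite raddfD /= psiw addr0.
  by split; [exists i|rewrite !(dfE i) // raddfD].
Qed.

Section GenericPoint.
Variables (d : Order.disp_t) (P : finPOrderType d) (sigma : {set P}).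
Notation V := {ffun P -> R^o}.

Definition simplex_direction (w : V) :=
  (forall p, p \notin sigma -> w p = 0) /\ \sum_p w p = 0.

Definition simplex_interior (x : V) :=
  [/\ forall p, p \in sigma -> 0 < x p, forall p, p \notin sigma -> x p = 0 &
      \sum_p x p = 1].

(** A functional that is not constant on the simplex takes the value [b k] on a
    proper affine subspace.  If the point found so far lies on it, a small move
    along the simplex leaves it without meeting the previous ones again. *)
Lemma generic_point (K : finType) (phi : K -> {scalar V}) (b : K -> R) q :
  q \in sigma ->
  exists2 x, simplex_interior x & forall k, phi k x = b k ->
    forall w, simplex_direction w -> phi k w = 0.
Proof.
move=> qs.
suff H (s : seq K) : exists2 x, simplex_interior x & forall k, k \in s ->
    phi k x = b k -> forall w, simplex_direction w -> phi k w = 0.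
  by have [x xi h] := H (enum K); exists x => // k; apply: h; rewrite mem_enum.
elim: s => [|k s [x xi h]].
  have c0 : (0 : R) < #|sigma|%:R by rewrite ltr0n; apply/card_gt0P; exists q.
  have sE : \sum_(p in sigma) (#|sigma|%:R)^-1 = 1 :> R.
    by rewrite sumr_const -[LHS]mulr_natl mulfV // gt_eqF.
  exists [ffun p => if p \in sigma then (#|sigma|%:R)^-1 else 0] => //; split.
  - by move=> p ps; rewrite ffunE ps invr_gt0.
  - by move=> p /negPf ps; rewrite ffunE ps.
  - under eq_bigr do rewrite ffunE.
    by rewrite -big_mkcond; exact: sE.
have [[w wd wk]|none] := pselect (exists2 w, simplex_direction w & phi k w <> 0); last first.
  exists x => // k'; rewrite inE => /orP[/eqP-> _ w wd|]; last exact: h.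
  by apply: contrapT => wk; apply: none; exists w.
have [xk|xk] := eqVneq (phi k x) (b k); last first.
  by exists x => // k'; rewrite inE => /orP[/eqP-> e|]; [rewrite e eqxx in xk|exact: h].
have [xpos xout xsum] := xi; have [wout wsum] := wd.
have near_pos : near0 (fun t => forall p, p \in sigma -> 0 < x p + t * w p).
  apply: near0_forall => p; have [ps|ps] := boolP (p \in sigma); last exact: near0_true.
  have lt : - (x p : R) < 0 by rewrite oppr_lt0 xpos.
  apply: near0W (near0_lt (- (w p : R)) lt) => t _.
  by rewrite mulrN -opprD oppr_lt0.
have near_off : near0 (fun t => forall k', phi k' x <> b k' -> phi k' (x + t *: w) <> b k').
  apply: near0_forall => k'.
  have [e|/eqP ne] := pselect (phi k' x = b k'); first by apply: near0_true => t _ /(_ e).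
  have [lt|lt|//] := ltgtP (phi k' x) (b k').
  - apply: near0W (near0_lt (phi k' w) lt) => t _ h' _.
    by rewrite raddfD /= scalar_scale => e; rewrite e ltxx in h'.
  - have nlt : - phi k' x < - b k' by rewrite ltrN2.
    apply: near0W (near0_lt (- phi k' w) nlt) => t _ h' _.
    by rewrite raddfD /= scalar_scale => e; rewrite mulrN -opprD e ltxx in h'.
  - by move=> e; rewrite e eqxx in ne.
have [t t0 [tpos toff]] := near0_ex (near0I near_pos near_off).
exists (x + t *: w).
  split=> [p ps|p ps|]; rewrite ?ffunE.
  - exact: tpos.
  - by rewrite xout // wout // scaler0 addr0.
  - under eq_bigr do rewrite !ffunE.
    by rewrite big_split /= xsum -scaler_sumr wsum scaler0 addr0.
move=> k'; rewrite inE => /orP[/eqP->|ks e].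
  rewrite raddfD /= scalar_scale xk => /eqP; rewrite -subr_eq0 addrAC subrr add0r.
  by rewrite mulf_eq0 gt_eqF //= => /eqP.
by apply: h => //; apply: contrapT => /toff.
Qed.
End GenericPoint.
End Differential.

(** * Pseudo-radial projection *)

Section PseudoRadial.
Variables (R : realType) (d : Order.disp_t) (P : finPOrderType d).
Local Open Scope ring_scope.
Local Open Scope classical_set_scope.
Notation V := {ffun P -> R^o}.
Notation total := (mass [set: P]%SET).
Implicit Types x y v : V.

Lemma pl_on_bigmin (U : vectType R) (X : set U) (I : finType) (A : pred I)
    (F : I -> U -> R^o) (a : U -> R^o) :
    pl_on X a -> (forall i, A i -> pl_on X (F i)) ->
  pl_on X (fun u => \big[Num.min/(a u : R)]_(i | A i) (F i u : R) : R^o).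
Proof.
move=> pa pF.
suff H (s : seq I) : pl_on X (fun u => \big[Num.min/(a u : R)]_(i <- s | A i) (F i u : R) : R^o).
  exact: H.
elim: s => [|i s IH].
  by apply: pl_on_eq pa => u _; rewrite big_nil.
case: (boolP (A i)) => Ai.
  by apply: pl_on_eq (pl_on_min (pF i Ai) IH) => u _; rewrite big_cons Ai.
by apply: pl_on_eq IH => u _; rewrite big_cons (negPf Ai).
Qed.

Section Cells.
Variables (B : {set P}) (J : finType) (phi : J -> {scalar V}) (coord_index : P -> J).
Hypothesis coordE : forall p x, phi (coord_index p) x = x p.

Definition sign x : {ffun J -> bool * bool} := [ffun j => (0 < phi j x, phi j x < 0)].

(** The cells are the sets on which all functionals have constant sign; this says
    that [x] is in the closure of the cell of [v]. *)
Definition in_face x v :=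
  forall j, (0 < phi j x -> 0 < phi j v) /\ (phi j x < 0 -> phi j v < 0).

Definition rank x := #|[set j | phi j x != 0]%SET|.

Lemma signP x y : sign x = sign y <->
  forall j, (0 < phi j x) = (0 < phi j y) /\ (phi j x < 0) = (phi j y < 0).
Proof.
split=> [/ffunP h j|h]; first by have := h j; rewrite !ffunE => -[-> ->].
by apply/ffunP => j; rewrite !ffunE; have [-> ->] := h j.
Qed.

Lemma sign_face x y : sign x = sign y -> in_face x y.
Proof. by move=> /signP h j; have [-> ->] := h j. Qed.

Lemma in_face_trans x y v : in_face x y -> in_face y v -> in_face x v.
Proof. by move=> h1 h2 j; have [a b] := h1 j; have [c e] := h2 j; split=> [/a/c|/b/e]. Qed.

Lemma in_face0 x v : in_face x v -> forall j, phi j v = 0 -> phi j x = 0.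
Proof.
move=> h j v0; have [a b] := h j; rewrite v0 ltxx in a b.
by apply/le_anti; rewrite !leNgt; apply/andP; split; [apply/negP => /a|apply/negP => /b].
Qed.

Lemma rank_face x v : in_face x v -> (rank x <= rank v)%N.
Proof.
move=> /in_face0 h; apply: subset_leq_card; apply/fintype.subsetP => j.
by rewrite !inE; apply: contra_neq; apply: h.
Qed.

Lemma rank_face_lt x v : in_face x v -> sign x <> sign v -> (rank x < rank v)%N.
Proof.
move=> h ne; apply: proper_card; apply/properP; split.
  by apply/fintype.subsetP => j; rewrite !inE; apply: contra_neq; apply: in_face0.
apply: contrapT => none; apply: ne; apply/signP => j; have [a b] := h j.
have [x0|x0|x0] := ltgtP (phi j x) 0.
- by have v0 := b x0; split; [apply/esym/lt_gtF|rewrite v0].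
- by have v0 := a x0; split; [rewrite v0|apply/esym/lt_gtF].
- have [v0|v0] := eqVneq (phi j v) 0; first by rewrite v0 ltxx.
  by case: none; exists j; rewrite inE ?x0 ?eqxx.
Qed.

Lemma rank_eq0 x : rank x = 0%N -> x = 0.
Proof.
move=> /cards0_eq h; apply/ffunP => p; rewrite ffunE -coordE.
by apply/eqP; apply: contraTT isT => ne; have := finset.in_set0 (coord_index p); rewrite -h inE ne.
Qed.

Lemma rank0 : rank 0 = 0%N.
Proof. by apply/eqP; rewrite cards_eq0; apply/eqP/setP => j; rewrite !inE raddf0 eqxx. Qed.

Lemma chain_cone_face S x v : in_face x v -> chain_cone S v -> chain_cone S x.
Proof.
move=> h [v0 vS vc].
have vx p : x p != 0 -> v p != 0.
  by apply: contra_neq; rewrite -!coordE; apply: in_face0.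
split=> [p|p /vx/vS//|p q /vx vp /vx vq]; last exact: vc.
rewrite leNgt; apply/negP => xp; have [_] := h (coord_index p).
by rewrite !coordE => /(_ xp); rewrite ltNge v0.
Qed.

Lemma total_chain_cone_ge0 S x : chain_cone S x -> 0 <= total x.
Proof. by move=> [x0 _ _]; apply: mass_ge0. Qed.

(** The largest multiple of [v] that can be subtracted from [x] without leaving
    the closure of the cell of [v].  It is concave and piecewise linear. *)
Definition coef v x : R := \big[Num.min/total x]_(j | phi j v != 0) (phi j x / phi j v).

Lemma coef_le v x j : phi j v != 0 -> coef v x <= phi j x / phi j v.
Proof. by move=> vj; rewrite /coef (bigD1 j) //= ge_min lexx. Qed.

Lemma coef_cases v x : coef v x = total x \/
  exists2 j, phi j v != 0 & coef v x = phi j x / phi j v.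
Proof.
rewrite /coef; elim/big_ind: _ => [|a b [->|[j jv ->]] [->|[i iv ->]]|j jv];
  by [left|rewrite minxx; left|right; exists j|case: leP; [left|right; exists i]|
      case: leP; [right; exists j|left]|case: leP; [right; exists j|right; exists i]].
Qed.

Lemma coef_ge0 S v x : chain_cone S x -> in_face x v -> 0 <= coef v x.
Proof.
move=> xS h; case: (coef_cases v x) => [->|[j jv ->]]; first exact: total_chain_cone_ge0 xS.
have [a b] := h j; have [x0|x0|->] := ltgtP (phi j x) 0; last by rewrite mul0r.
  by apply: ltW; rewrite -mulrNN -invrN mulr_gt0 ?invr_gt0 ?oppr_gt0 // b.
by apply: ltW; rewrite divr_gt0 // a.
Qed.

Lemma coef_gt0 S v x : chain_cone S x -> x != 0 -> sign x = sign v -> 0 < coef v x.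
Proof.
move=> [x0 xS xc] xn /signP h; case: (coef_cases v x) => [->|[j jv ->]].
  rewrite lt_neqAle mass_ge0 // andbT eq_sym; apply: contra_neq xn.
  exact: total_eq0.
have [a b] := h j; have [v0|v0|v0] := ltgtP (phi j v) 0.
- by rewrite -mulrNN -invrN mulr_gt0 ?invr_gt0 ?oppr_gt0 // b.
- by rewrite divr_gt0 // a.
- by rewrite v0 eqxx in jv.
Qed.

Lemma coef_eq0 S v x : chain_cone S x -> in_face x v -> sign x <> sign v ->
  coef v x = 0.
Proof.
move=> xS h ne; apply/le_anti; rewrite (coef_ge0 xS) // andbT.
have [j jv jx] : exists2 j, phi j v != 0 & phi j x = 0.
  apply: contrapT => none; apply: ne; apply/signP => j; have [a b] := h j.
  have [x0|x0|x0] := ltgtP (phi j x) 0.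
  - by have v0 := b x0; split; [apply/esym/lt_gtF|rewrite v0].
  - by have v0 := a x0; split; [rewrite v0|apply/esym/lt_gtF].
  - have [v0|v0] := eqVneq (phi j v) 0; first by rewrite v0 ltxx.
    by case: none; exists j.
by apply: le_trans (coef_le x jv) _; rewrite jx mul0r.
Qed.

Lemma coefD v x a : total v = 1 -> coef v (x + a *: v) = coef v x + a.
Proof.
move=> v1; have tE : total (x + a *: v) = total x + a.
  by rewrite massD totalZ v1 mulr1.
rewrite /coef; elim: (index_enum J) => [|j s IH]; first by rewrite !big_nil.
rewrite !big_cons; case: ifP => // jv; rewrite IH raddfD /= scalar_scale mulrDl mulfK //.
by rewrite addr_minl.
Qed.

Definition residue v x := x - coef v x *: v.

Lemma residue_face S v x : chain_cone S x -> in_face x v -> in_face (residue v x) v.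
Proof.
move=> xS h j.
have rE : phi j (residue v x) = phi j x - coef v x * phi j v.
  by rewrite /residue raddfB /= scalar_scale.
have [a b] := h j; have c0 := coef_ge0 xS h.
have [v0|v0|v0] := ltgtP (phi j v) 0.
- split=> //; rewrite rE subr_gt0 => lt; exfalso.
  have := coef_le x (negbT (lt_eqF v0)); rewrite ler_ndivlMr // => le.
  by have := lt_le_trans lt le; rewrite ltxx.
- split=> //; rewrite rE subr_lt0 => lt; exfalso.
  have := coef_le x (negbT (gt_eqF v0)); rewrite ler_pdivlMr // => le.
  by have := lt_le_trans lt le; rewrite ltxx.
- by rewrite rE v0 mulr0 subr0 (in_face0 h v0) ltxx.
Qed.

(** Otherwise a further multiple of [v] could be subtracted. *)
Lemma residue_sign S v x : chain_cone S v -> v != 0 -> total v = 1 ->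
  in_face x v -> sign (residue v x) <> sign v.
Proof.
move=> vS vn v1 h s; have xS := chain_cone_face h vS.
have yS : chain_cone S (residue v x) by apply: chain_cone_face (sign_face s) vS.
have y0 : residue v x != 0.
  apply: contra_neq vn => y0; apply/ffunP => p; rewrite ffunE -coordE.
  have [a b] := (signP _ _).1 s (coord_index p); rewrite y0 raddf0 ltxx in a b.
  by apply/le_anti; rewrite !leNgt -a -b.
have := coef_gt0 yS y0 s; rewrite /residue -scaleNr coefD //.
by rewrite subrr ltxx.
Qed.

Lemma residueK v x : residue v x + coef v x *: v = x.
Proof. by rewrite /residue subrK. Qed.

(** The vertices of the derived subdivision: a point of mass one in each cell. *)
Definition center (s : {ffun J -> bool * bool}) : V :=
  if pselect (exists x, [/\ chain_cone B x, total x = 1 & sign x = s]) is left h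
  then projT1 (cid h) else 0.

Lemma centerP x : chain_cone B x -> x != 0 ->
  let v := center (sign x) in [/\ chain_cone B v, total v = 1 & sign v = sign x].
Proof.
move=> xB xn; rewrite /center; case: pselect => [h|none].
  exact: projT2 (cid h).
have t0 : 0 < total x.
  rewrite lt_neqAle (total_chain_cone_ge0 xB) andbT eq_sym; apply: contra_neq xn.
  by apply: total_eq0; case: xB.
case: none; exists ((total x)^-1 *: x); split.
- by apply: chain_coneZ xB; rewrite invr_ge0 ltW.
- by rewrite totalZ mulVf // gt_eqF.
- apply/signP => j; rewrite scalar_scale.
  by rewrite pmulr_rgt0 ?invr_gt0 // pmulr_rlt0 ?invr_gt0.
Qed.

Definition is_center v := [/\ chain_cone B v, total v = 1 & center (sign v) = v].

Lemma is_center_neq0 v : is_center v -> v != 0.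
Proof.
move=> [_ v1 _]; apply/eqP => v0; move: v1; rewrite v0 /mass big1 => [/eqP|p _].
  by rewrite eq_sym oner_eq0.
by rewrite ffunE.
Qed.

Lemma center_is_center x : chain_cone B x -> x != 0 -> is_center (center (sign x)).
Proof. by move=> xB xn; have [h1 h2 h3] := centerP xB xn; split=> //; rewrite h3. Qed.

(** This writes [x] as a combination of the centers of a flag of cells, the
    coefficient of each being the largest possible, and multiplies each center
    [v] by [s v].  The rank decreases at each step, so [n = #|J|] steps
    suffice. *)
Fixpoint rescale_rec (s : V -> R) n x : V :=
  if n is n'.+1 then
    if x == 0 then 0 else
    let v := center (sign x) in
    rescale_rec s n' (residue v x) + (coef v x * s v) *: v
  else 0.

Definition rescale s x := rescale_rec s #|J| x.

Lemma rescale_rec0 s n : rescale_rec s n 0 = 0.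
Proof. by case: n => //= n; rewrite eqxx. Qed.

Lemma residue_center x : chain_cone B x -> x != 0 ->
  let y := residue (center (sign x)) x in
  [/\ chain_cone B y, in_face y x, sign y <> sign x & (rank y < rank x)%N].
Proof.
move=> xB xn; have vc := center_is_center xB xn.
have [vB v1 vs] := centerP xB xn.
have xv : in_face x (center (sign x)) by apply/sign_face/esym.
have yv := residue_face xB xv.
have yx : in_face (residue (center (sign x)) x) x.
  exact: in_face_trans yv (sign_face vs).
have ne : sign (residue (center (sign x)) x) <> sign x.
  by rewrite -[in RHS]vs; apply: residue_sign vB (is_center_neq0 vc) v1 xv.
by split=> //; [exact: chain_cone_face yx xB|exact: rank_face_lt].
Qed.

Lemma rescale_rec_stable s n m x : chain_cone B x -> (rank x <= n)%N ->
  (rank x <= m)%N -> rescale_rec s n x = rescale_rec s m x.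
Proof.
elim: n m x => [|n IH] m x xB xn xm.
  by move: xn; rewrite leqn0 => /eqP /rank_eq0 ->; rewrite !rescale_rec0.
case: m xm => [|m] xm.
  by move: xm; rewrite leqn0 => /eqP /rank_eq0 ->; rewrite !rescale_rec0.
rewrite /=; case: eqVneq => // x0.
have [yB _ _ yr] := residue_center xB x0.
by rewrite (IH m) // -ltnS; apply: leq_trans yr _.
Qed.

Lemma rescaleE s x : chain_cone B x -> x != 0 ->
  let v := center (sign x) in
  rescale s x = rescale s (residue v x) + (coef v x * s v) *: v.
Proof.
move=> xB x0 /=; have [yB _ _ yr] := residue_center xB x0.
have le z : (rank z <= #|J|)%N by apply: max_card.
rewrite /rescale (@rescale_rec_stable s _ #|J|.+1 x) //=; last exact: leq_trans (le x) _.
by rewrite (negPf x0).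
Qed.

Lemma rescale0 s : rescale s 0 = 0. Proof. exact: rescale_rec0. Qed.

(** On the boundary of the cell of [v] the coefficient of [v] is zero, so the
    recursive formula of the cell is valid on its closure.  This makes
    [rescale s] piecewise linear, the cells being closed. *)
Lemma rescale_face s v x : is_center v -> in_face x v ->
  rescale s x = rescale s (residue v x) + (coef v x * s v) *: v.
Proof.
move=> vc xv; have [vB v1 vE] := vc; have xB := chain_cone_face xv vB.
have [e|ne] := pselect (sign x = sign v); last first.
  by rewrite /residue (coef_eq0 xB xv ne) scale0r subr0 mul0r scale0r addr0.
have x0 : x != 0.
  apply: contra_neq (is_center_neq0 vc) => x0.
  apply: rank_eq0; apply/eqP; rewrite -leqn0 -rank0 -x0.
  exact/rank_face/sign_face/esym.
by rewrite rescaleE // e vE.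
Qed.

Lemma chain_cone_rec (A : V -> Prop) : A 0 ->
    (forall x, chain_cone B x -> x != 0 -> A (residue (center (sign x)) x) -> A x) ->
  forall x, chain_cone B x -> A x.
Proof.
move=> A0 IH x; have [n] := ubnP (rank x); elim: n x => // n IHn x lt xB.
have [->//|x0] := eqVneq x 0; apply: IH => //.
have [yB _ _ yr] := residue_center xB x0; apply: IHn => //.
by apply: leq_trans yr _; rewrite -ltnS.
Qed.

Lemma polyhedron_face v : polyhedron [set x | in_face x v].
Proof.
have pT := @polyhedronT R {ffun P -> R^o}.
have p0 := pl_on_cst (0 : R^o) pT.
have pphi j : pl_on [set: V] (fun x => phi j x : R^o).
  by apply: pl_on_linear pT _ => a x y; rewrite linearP.
have h := polyhedron_bigI (fun j => polyhedronI
  (polyhedronU (polyhedron_le (pphi j) p0) (polyhedron_const _ (0 < phi j v)))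
  (polyhedronU (polyhedron_le p0 (pphi j)) (polyhedron_const _ (phi j v < 0)))).
apply: pl_on_seteq h => x; split=> h j; have [a b] := h j.
  split=> lt; first by case: a => //= le; have := lt_le_trans lt le; rewrite ltxx.
  by case: b => //= le; have := lt_le_trans lt le; rewrite ltxx.
split=> /=.
  by have [|/a] := leP (phi j x) 0; [left|right].
by have [|/b] := leP 0 (phi j x); [left|right].
Qed.

Lemma pl_on_rescale s : pl_on (chain_cone B) (rescale s).
Proof.
have pT := @polyhedronT R {ffun P -> R^o}.
suff H n : pl_on [set x | chain_cone B x /\ (rank x <= n)%N] (rescale s).
  apply: pl_on_seteq (H #|J|) => x; split=> [[]|xB]//; split=> //; exact: max_card.
elim: n => [|n IH].
  apply: (@pl_on_eq _ _ _ _ (fun=> 0)) => [x [_]|].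
    by rewrite leqn0 => /eqP /rank_eq0 ->; rewrite rescale0.
  apply: pl_on_cst.
  have h := polyhedron_bigI (fun p => polyhedron_eq
    (pl_on_coord p (pl_on_id pT)) (pl_on_cst (0 : R^o) pT)).
  apply: pl_on_seteq h => x; split=> [x0|[_]].
    have -> : x = 0 by apply/ffunP => p; rewrite x0 ffunE.
    by split; [exact: chain_cone0|rewrite rank0].
  by rewrite leqn0 => /eqP /rank_eq0 -> p; rewrite /= ffunE.
pose D (o : option {ffun J -> bool * bool}) : set V :=
  if o is Some t then [set x | in_face x (center t)] `&`
    [set _ | is_center (center t) /\ (rank (center t) <= n.+1)%N]
  else [set x | chain_cone B x /\ (rank x <= n)%N].
apply: (@pl_on_bigU _ _ _ _ D) => [[t|]//|x]; last first.
  split=> [[xB xr]|[[t|] [h1 h2]]].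
  - have [->|x0] := eqVneq x 0.
      by exists None; split; [exact: chain_cone0|rewrite rank0].
    have [vB v1 vs] := centerP xB x0.
    exists (Some (sign x)); split; first exact/sign_face/esym.
    split; first exact: center_is_center.
    by apply: leq_trans xr; apply/rank_face/sign_face.
  - have [vc vr] := h2; split; first by apply: chain_cone_face h1 _; case: vc.
    exact: leq_trans (rank_face h1) vr.
  - by split=> //; apply: leq_trans h2 _.
have pD : polyhedron (D (Some t)).
  by apply: polyhedronI; [exact: polyhedron_face|exact: polyhedron_const].
set v := center t in pD *.
have pid := pl_on_id pD.
have pc : pl_on (D (Some t)) (fun x => coef v x : R^o).
  apply: pl_on_bigmin; first exact: pl_on_mass.
  move=> j _; apply: (@pl_on_eq _ _ _ _ (fun x => (phi j v)^-1 *: (phi j x : R^o))).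
    by move=> x _; rewrite mulrC.
  by apply: pl_on_scale; apply: pl_on_linear pD _ => a x y; rewrite linearP.
have pres : pl_on (D (Some t)) (residue v).
  exact: pl_on_subr pid (pl_on_scalel v pc).
apply: (@pl_on_eq _ _ _ _ (fun x => rescale s (residue v x) + (coef v x * s v) *: v)).
  by move=> x [xv [vc _]]; rewrite -rescale_face.
apply: pl_on_add.
  apply: pl_on_comp pres IH _ => x [xv [vc vr]]; have [vB v1 _] := vc.
  have xB := chain_cone_face xv vB; have yv := residue_face xB xv.
  split; first exact: chain_cone_face yv vB.
  rewrite -ltnS; apply: leq_trans vr; apply: rank_face_lt yv _.
  exact: residue_sign vB (is_center_neq0 vc) v1 xv.
apply: pl_on_scalel; apply: (@pl_on_eq _ _ _ _ (fun x => s v *: (coef v x : R^o))).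
  by move=> x _; rewrite mulrC.
exact: pl_on_scale.
Qed.

Section Positive.
Variable s : V -> R.
Hypothesis s_gt0 : forall v, is_center v -> 0 < s v.

(** Rescaling keeps each cell, because the center of the cell of [x] occurs with a
    positive coefficient. *)
Lemma rescale_sign x : chain_cone B x -> sign (rescale s x) = sign x.
Proof.
move: x; apply: chain_cone_rec => [|x xB x0]; first by rewrite rescale0.
set v := center (sign x) => IH; rewrite rescaleE // -/v.
have vc := center_is_center xB x0; have [vB v1 vs] := centerP xB x0.
have [yB yx _ _] := residue_center xB x0.
have c0 : 0 < coef v x * s v.
  by rewrite mulr_gt0 ?s_gt0 // (coef_gt0 xB x0 (esym vs)).
apply/signP => j; rewrite raddfD /= scalar_scale.
have [/esym a /esym b] := (signP _ _).1 IH j.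
have [e f] := (signP _ _).1 vs j; have [g h] := yx j.
rewrite -/v in e f a b.
have [x1|x1|x1] := ltgtP (phi j x) 0.
- have v0 : phi j v < 0 by rewrite f.
  have y0 : phi j (rescale s (residue v x)) <= 0.
    by rewrite leNgt -a; apply/negP => /g; rewrite ltNge ltW.
  have lt : phi j (rescale s (residue v x)) + coef v x * s v * phi j v < 0.
    by rewrite addrC -[ltRHS]addr0 ltr_leD // pmulr_rlt0.
  by rewrite lt (lt_gtF lt).
- have v0 : 0 < phi j v by rewrite e.
  have y0 : 0 <= phi j (rescale s (residue v x)).
    by rewrite leNgt -b; apply/negP => /h; rewrite ltNge ltW.
  have lt : 0 < phi j (rescale s (residue v x)) + coef v x * s v * phi j v.
    by rewrite addrC ltr_wpDr // pmulr_rgt0.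
  by rewrite lt (lt_gtF lt).
- have v0 : phi j v = 0 by apply: (in_face0 (sign_face vs)).
  have y0 : phi j (rescale s (residue v x)) = 0.
    have := in_face0 yx x1; rewrite -/v => yj.
    by apply/le_anti; rewrite !leNgt -a -b yj ltxx.
  by rewrite v0 y0 mulr0 addr0 ltxx.
Qed.

Lemma rescale_cone S x : chain_cone B x -> chain_cone S x -> chain_cone S (rescale s x).
Proof. by move=> xB; apply/chain_cone_face/sign_face/rescale_sign. Qed.

(** The rescaled point lies in the same cell, and its decomposition is the rescaled
    decomposition: the rest of it is in the boundary of the cell, where the
    coefficient of the center vanishes. *)
Lemma rescaleK s' : (forall v, is_center v -> s v * s' v = 1) ->
  forall x, chain_cone B x -> rescale s' (rescale s x) = x.
Proof.
move=> ss'; apply: chain_cone_rec => [|x xB x0]; first by rewrite !rescale0.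
set v := center (sign x) => IH.
have vc := center_is_center xB x0; have [vB v1 vs] := centerP xB x0.
have [yB yx ne _] := residue_center xB x0; rewrite -/v in yB yx ne vc v1.
have zs := rescale_sign xB; have zB := rescale_cone xB xB.
have z0 : rescale s x != 0.
  apply: contra_neq x0 => z0; apply: rank_eq0; apply/eqP; rewrite -leqn0 -rank0 -z0.
  exact/rank_face/sign_face/esym.
have zE := rescaleE s xB x0; rewrite /= -/v in zE.
rewrite rescaleE // zs -/v.
have ys := rescale_sign yB.
have cz : coef v (rescale s x) = coef v x * s v.
  rewrite zE coefD // (coef_eq0 (rescale_cone yB yB)) ?add0r //.
    apply: in_face_trans (sign_face ys) _.
    by apply: in_face_trans yx _; apply/sign_face/esym.
  by rewrite ys vs.
have rz : residue v (rescale s x) = rescale s (residue v x).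
  by rewrite /residue cz zE addrK.
by rewrite rz IH cz -mulrA ss' // mulr1 residueK.
Qed.

End Positive.

(** As [w] is linear on the closed cells, it may be computed on the centers, where
    rescaling by the inverse of [w] gives [1], the mass of the center. *)
Lemma rescale_total (w : V -> R) :
    (forall v, is_center v -> 0 < w v) -> w 0 = 0 ->
    (forall v, is_center v -> exists l : {scalar V}, forall x, in_face x v -> w x = l x) ->
  forall x, chain_cone B x -> w (rescale (fun v => (w v)^-1) x) = total x.
Proof.
move=> w_gt0 w0 w_lin; set s := fun v => _.
have s_gt0 v : is_center v -> 0 < s v by move=> /w_gt0; rewrite /s invr_gt0.
apply: chain_cone_rec => [|x xB x0].
  by rewrite rescale0 w0 /mass big1 // => p _; rewrite ffunE.
set v := center (sign x) => IH.
have vc := center_is_center xB x0; have [vB v1 vs] := centerP xB x0.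
have [yB yx _ _] := residue_center xB x0.
have [l wl] := w_lin _ vc; rewrite -/v in vc wl IH yB yx v1.
have xv : in_face x v by apply/sign_face/esym.
have yv := in_face_trans yx xv.
rewrite rescaleE // -/v wl; last first.
  rewrite -rescaleE //; apply: in_face_trans xv.
  exact/sign_face/rescale_sign.
rewrite raddfD /= scalar_scale -!wl //; last first.
  by apply: in_face_trans yv; apply/sign_face/rescale_sign.
rewrite IH -mulrA /s mulVf ?gt_eqF ?w_gt0 // mulr1.
by rewrite -[in RHS](residueK v x) massD totalZ v1 mulr1.
Qed.

Lemma rescale_id (s : V -> R) (S : {set P}) :
    (forall v, is_center v -> chain_cone S v -> s v = 1) ->
  forall x, chain_cone B x -> chain_cone S x -> rescale s x = x.
Proof.
move=> s1; apply: chain_cone_rec => [|x xB x0 IH xS]; first by rewrite rescale0.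
have vc := center_is_center xB x0; have [vB v1 vs] := centerP xB x0.
have [yB yx _ _] := residue_center xB x0.
rewrite rescaleE //= IH; last exact: chain_cone_face yx xS.
rewrite s1 //; last exact: chain_cone_face (sign_face vs) xS.
by rewrite mulr1 residueK.
Qed.
End Cells.

(** The substitute for the radial projection between the slices of mass one and
    [w = 1] of the cone, which is not piecewise linear.  With the coordinates
    among the functionals, the cells refine the simplices of the cone, so the
    cone over each subposet is preserved. *)
Lemma pseudo_radial (B L : {set P}) (w : V -> R) (I : finType) (J : I -> finType)
    (phi : forall i, J i -> {scalar V}) (l : I -> {scalar V}) :
    (forall x, chain_cone B x -> exists i, forall j, phi i j x <= 0) ->
    (forall i x, chain_cone B x -> (forall j, phi i j x <= 0) -> w x = l i x) ->
    (forall x, chain_cone B x -> x != 0 -> 0 < w x) ->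
    (forall x, chain_cone L x -> w x = total x) -> L \subset B ->
  exists f g, [/\ pl_inverse (chain_cone B) (chain_cone B) f g,
    forall x, chain_cone B x -> w (f x) = total x &
    forall x, chain_cone L x -> f x = x].
Proof.
move=> cover lin w_gt0 wL LB.
pose psi (k : P + {i : I & J i}) : {scalar V} :=
  match k with inl p => coord_scalar R p | inr t => phi (tag t) (tagged t) end.
have coordE p x : psi (inl p) x = x p by [].
have c_gt0 v : is_center B psi v -> 0 < w v.
  by move=> vc; apply: w_gt0 (is_center_neq0 vc); case: vc.
have w0 : w 0 = 0.
  by rewrite wL ?/mass ?big1 //; [move=> p _; rewrite ffunE|exact: chain_cone0].
have c_lin v : is_center B psi v ->
    exists k : {scalar V}, forall x, in_face psi x v -> w x = k x.
  move=> [vB _ _]; have [i iv] := cover v vB; exists (l i) => x xv.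
  apply: lin; first exact: (chain_cone_face coordE xv vB).
  move=> j; rewrite leNgt; apply/negP => /(xv (inr (Tagged (fun i => J i) j))).1 /=.
  by rewrite ltNge iv.
pose s v := (w v)^-1.
have s_gt0 v : is_center B psi v -> 0 < s v by move=> /c_gt0; rewrite /s invr_gt0.
exists (rescale B psi s), (rescale B psi w); split.
- split.
  + exact: (pl_on_rescale B coordE).
  + by move=> x xB; apply: (rescale_cone coordE s_gt0).
  + exact: (pl_on_rescale B coordE).
  + by move=> x xB; apply: (rescale_cone coordE c_gt0).
  + split; first apply: (rescaleK coordE s_gt0).
      by move=> v vc; rewrite mulVf // gt_eqF ?c_gt0.
    apply: (rescaleK coordE c_gt0).
    by move=> v vc; rewrite mulfV // gt_eqF ?c_gt0.
- exact: (rescale_total coordE c_gt0 w0 c_lin).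
- move=> x xL; apply: (rescale_id coordE (S := L)) => //; last exact: chain_coneS LB xL.
  by move=> v [_ v1 _] vL; rewrite /s wL // v1 invr1.
Qed.
End PseudoRadial.

(** * From a homeomorphism back to collars of links *)

Section LinkCollar.
Variables (R : realType) (d : Order.disp_t) (P : finPOrderType d).
Variables (Q : {set P}) (clQ : closed_subposet Q).
Local Open Scope ring_scope.
Local Open Scope classical_set_scope.
Local Open Scope order_scope.
Notation V := {ffun P -> R^o}.
Notation VR := (V * R^o)%type.
Notation total := (mass [set: P]%SET).
Implicit Types (x u v w : V) (p q r : P).

(** Maximality forces an element comparable with the whole chain to be above
    [q]. *)
Lemma maximal_chain q : exists s : {set P},
  [/\ q \in s, forall p, p \in s -> p <= q,
      forall p r, p \in s -> r \in s -> p >=< r &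
      forall p, p \notin s -> (forall r, r \in s -> p >=< r) -> q < p].
Proof.
pose A (s : {set P}) := [&& q \in s, [forall p in s, p <= q] &
  [forall p in s, forall r in s, p >=< r]].
have A1 : A [set q]%SET.
  apply/and3P; split; first by rewrite finset.in_set1.
    by apply/forall_inP => p; rewrite finset.in_set1 => /eqP ->.
  apply/forall_inP => p; rewrite finset.in_set1 => /eqP ->.
  by apply/forall_inP => r; rewrite finset.in_set1 => /eqP ->; rewrite comparablexx.
have [s /maxsetP[/and3P[qs /forall_inP sq sc] smax] _] := maxset_exists A1.
have scP p r : p \in s -> r \in s -> p >=< r.
  by move=> ps; move/forall_inP: sc => /(_ p ps) /forall_inP; apply.
exists s; split=> // p ps pc; have := pc q qs.
case/orP=> [pq|qp]; last first.
  by rewrite lt_neqAle qp andbT; apply: contraNneq ps => <-.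
suff AP : A (p |: s)%SET.
  by rewrite -(smax _ AP) ?finset.subsetUr // finset.setU11 in ps.
apply/and3P; split; first by rewrite !inE qs orbT.
  by apply/forall_inP => r; rewrite !inE => /orP[/eqP->//|/sq].
apply/forall_inP => r; rewrite !inE => rp; apply/forall_inP => t; rewrite !inE.
move: rp => /orP[/eqP->|rs] /orP[/eqP->|ts]; rewrite ?comparablexx ?pc //.
  by rewrite comparable_sym pc.
exact: scP.
Qed.

Section Link.
Variables (k : V -> VR) (k' : VR -> V) (q : P) (sigma : {set P}).
Hypothesis qQ : q \in Q.
Hypothesis kk' : pl_inverse (realization [set: P]%SET) (cylinder Q) k k'.
Hypothesis kQ : forall x, realization Q x -> k x = (x, 1%R).
Hypothesis qs : q \in sigma.
Hypothesis s_le : forall p, p \in sigma -> p <= q.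
Hypothesis s_chain : forall p r, p \in sigma -> r \in sigma -> p >=< r.
Hypothesis s_max : forall p, p \notin sigma -> (forall r, r \in sigma -> p >=< r) -> q < p.
Variable x0 : V.
Hypothesis x0_int : simplex_interior sigma x0.

Lemma s_Q p : p \in sigma -> p \in Q.
Proof. by move=> /s_le pq; apply: clQ pq qQ. Qed.

Lemma s_below p : q < p -> p \notin sigma.
Proof. by move=> qp; apply/negP => /s_le /(lt_le_trans qp); rewrite ltxx. Qed.

(** The cone of directions of [|S|] at a point interior to the simplex [sigma],
    see [tangentP]: such a direction has mass zero and is the sum of a vector
    supported in [sigma] and one of the cone over the link. *)
Definition tangent (S : {set P}) v :=
  [/\ total v = 0%R, forall p, p \notin sigma -> v p != 0%R -> q < p &
      chain_cone (link q S) (above q v)].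

Lemma near_positive v :
  near0 (fun t : R => forall p, p \in sigma -> (0 < (x0 + t *: v)%R p)%R).
Proof.
have [xpos _ _] := x0_int.
apply: near0_forall => p; have [ps|ps] := boolP (p \in sigma); last exact: near0_true.
have lt : (- (x0 p : R) < 0)%R by rewrite oppr_lt0 xpos.
apply: near0W (near0_lt (- (v p : R)) lt) => t _.
by rewrite !ffunE mulrN -opprD oppr_lt0.
Qed.

Lemma tangentP (S : {set P}) v : (forall p, p \in sigma -> p \in S) ->
  tangent S v <-> near0 (fun t => realization S (x0 + t *: v)%R).
Proof.
move=> sS; have [xpos xout xsum] := x0_int.
have out t p : p \notin sigma -> (x0 + t *: v)%R p = (t * v p)%R.
  by move=> ps; rewrite !ffunE xout // add0r.
have sumE t : (\sum_p (x0 + t *: v)%R p = 1 + t * total v)%R.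
  by rewrite totalE mulr_sumr -xsum -big_split; apply: eq_bigr => p _; rewrite !ffunE.
split=> [[v0 vlt [vpos vS vc]]|near_real].
  have sup t p : (0 < t)%R -> p \notin sigma -> (x0 + t *: v)%R p != 0%R ->
      [/\ q < p, p \in S & above q v p != 0%R].
    move=> t0 ps; rewrite out // mulf_eq0 negb_or => /andP[_ vp].
    have qp := vlt p ps vp; have ap : above q v p != 0%R by rewrite ffunE qp.
    by split=> //; have := vS p ap; rewrite inE => /andP[].
  apply: near0W (near_positive v) => t t0 pos; split.
  - move=> p; have [ps|ps] := boolP (p \in sigma); first exact/ltW/pos.
    rewrite out // pmulr_rge0 //; have [-> //|vp] := eqVneq (v p) 0%R.
    by have := vpos p; rewrite ffunE vlt.
  - by rewrite sumE v0 mulr0 addr0.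
  - move=> p; have [/sS //|ps] := boolP (p \in sigma).
    by move=> /(sup t p t0 ps)[].
  - move=> p r; have [ps|ps] := boolP (p \in sigma); have [rs|rs] := boolP (r \in sigma).
    + by move=> _ _; apply: s_chain.
    + move=> _ /(sup t r t0 rs)[qr _ _].
      by rewrite /Order.comparable (le_trans (s_le ps) (ltW qr)).
    + move=> /(sup t p t0 ps)[qp _ _] _.
      by rewrite /Order.comparable (le_trans (s_le rs) (ltW qp)) orbT.
    + by move=> /(sup t p t0 ps)[_ _ h1] /(sup t r t0 rs)[_ _ h2]; apply: vc.
have [t t0 [[xt0 xt1 xtS xtc] pos]] := near0_ex (near0I near_real (near_positive v)).
have nz p : p \notin sigma -> v p != 0%R -> (x0 + t *: v)%R p != 0%R.
  by move=> ps vp; rewrite out // mulf_neq0 // gt_eqF.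
have vlt p : p \notin sigma -> v p != 0%R -> q < p.
  move=> ps vp; apply: s_max => // r rs; apply: xtc; first exact: nz.
  by rewrite gt_eqF // pos.
split=> //.
  move/eqP: xt1; rewrite sumE -subr_eq0 addrAC subrr add0r mulf_eq0 gt_eqF //=.
  by move/eqP.
have above_nz p : above q v p != 0%R -> q < p /\ (x0 + t *: v)%R p != 0%R.
  rewrite ffunE; case: ifP => [qp vp|_]; last by rewrite eqxx.
  by split=> //; apply: nz => //; apply: s_below.
split.
- move=> p; rewrite ffunE; case: ifP => // qp.
  by have := xt0 p; rewrite out ?s_below // pmulr_rge0.
- by move=> p /above_nz[qp /xtS pS]; rewrite inE pS.
- by move=> p r /above_nz[_ h1] /above_nz[_ h2]; apply: xtc.
Qed.

Lemma tangentS (S T : {set P}) v : S \subset T -> tangent S v -> tangent T v.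
Proof.
move=> ST [h1 h2 h3]; split=> //; apply: chain_coneS h3.
by apply/fintype.subsetP => p; rewrite !inE => /andP[/(fintype.subsetP ST) -> ->].
Qed.

(** At height one only downward directions stay in the cylinder, and near that
    height it lies over [|Q|]. *)
Lemma cylinder_tangentP (v : VR) : (v.2 <= 0)%R /\ tangent Q v.1 <->
  near0 (fun t => cylinder Q ((x0, 1%R) + t *: v)%R).
Proof.
case: v => v s; rewrite tangentP; last exact: s_Q.
have pos : near0 (fun t : R => 0 < 1 + t * s)%R.
  apply: near0W (near0_lt (- s) (_ : -1 < 0)%R) => [t _|]; last by rewrite oppr_lt0 ltr01.
  by rewrite mulrN -opprD oppr_lt0.
split=> /= [[s0 near_v]|near_v].
  apply: near0W (near0I pos near_v) => t t0 [p1 /realizationE[xQ x1]]; split=> /=.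
  - apply/realizationE; split=> //; apply: chain_coneS xQ.
    by apply/fintype.subsetP => p; rewrite inE.
  - exact: ltW.
  - by rewrite gerDl pmulr_rle0.
  - by right.
have [t t0 [_ _ /=]] := near0_ex near_v.
rewrite gerDl pmulr_rle0 // => s0 _; split=> //.
apply: near0W (near0I pos near_v) => r _ [rpos [/realizationE[_ x1] _ _ /= [r0|xQ]]].
  by move: rpos; rewrite [X in (_ < X)%R]r0 ltxx.
exact/realizationE.
Qed.

Definition point_mass : V := [ffun p => if p == q then 1%R else 0%R].

(** A vector of the cone over the link becomes a direction at [x0] when its mass
    is removed at [q], which lies in [sigma]. *)
Definition centered u : V := (u - total u *: point_mass)%R.

Lemma total_point_mass : total point_mass = 1%R.
Proof.
rewrite totalE (bigD1 q) //= ffunE eqxx big1 ?addr0 // => p /negPf pq.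
by rewrite ffunE pq.
Qed.

Lemma total_centered u : total (centered u) = 0%R.
Proof. by rewrite /centered -scaleNr massD totalZ total_point_mass mulr1 subrr. Qed.

Lemma centered_off u p : p != q -> centered u p = u p.
Proof. by move=> /negPf pq; rewrite !ffunE pq scaler0 oppr0 addr0. Qed.

Lemma above_link S u : chain_cone (link q S) u -> above q u = u.
Proof.
move=> [_ uS _]; apply/ffunP => p; rewrite ffunE; case: ifP => // qp.
by apply/esym/eqP; apply: contraFT qp => /uS; rewrite inE => /andP[].
Qed.

Lemma aboveD u v : above q (u + v)%R = (above q u + above q v)%R.
Proof. by apply/ffunP => p; rewrite !ffunE; case: ifP; rewrite ?addr0. Qed.

Lemma above_centered u : above q (centered u) = above q u.
Proof.
apply/ffunP => p; rewrite ffunE [RHS]ffunE; case: ifP => // qp.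
by apply: centered_off; rewrite gt_eqF.
Qed.

Lemma tangent_centered S u : chain_cone (link q S) u -> tangent S (centered u).
Proof.
move=> uL; split; first exact: total_centered.
  move=> p ps; rewrite centered_off; last by apply: contraNneq ps => ->.
  by case: uL => _ uS _ /uS; rewrite inE => /andP[].
by rewrite above_centered (above_link uL).
Qed.

(** A tangent direction is determined by its part above [q] up to a direction
    of the simplex. *)
Lemma tangent_remainder S v : tangent S v ->
  simplex_direction sigma (centered (above q v) - v)%R.
Proof.
move=> [v0 vlt _]; split; last first.
  have := massD [set: P]%SET (centered (above q v)) (- v)%R.
  rewrite -scaleN1r totalZ v0 mulr0 addr0 total_centered totalE => {2}<-.
  by apply: eq_bigr => p _; rewrite scaleN1r.
move=> p ps; have pq : p != q by apply: contraNneq ps => ->.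
rewrite !ffunE (negPf pq) scaler0 oppr0 addr0; case: ifP => qp; first by rewrite subrr.
have [->|/(vlt p ps)] := eqVneq (v p) 0%R; first by rewrite subr0.
by rewrite qp.
Qed.

Lemma direction_tangent w S : simplex_direction sigma w ->
  tangent S w /\ above q w = 0%R.
Proof.
move=> [wout w0]; have aw : above q w = 0%R.
  apply/ffunP => p; rewrite !ffunE; case: ifP => // qp.
  by rewrite wout // s_below.
split=> //; split; first by rewrite totalE.
  by move=> p /wout ->; rewrite eqxx.
by rewrite aw; apply: chain_cone0.
Qed.

(** The differentials of [k] at [x0] and of [k'] at [(x0, 1)].  The two shift
    hypotheses express that [x0] is generic for the cells of both maps. *)
Variables (T : set V) (dk : V -> VR) (T' : set VR) (dk' : VR -> V).
Hypothesis dk_lin : conewise_linear T dk.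
Hypothesis T_near : forall v, T v <-> near0 (fun t => realization [set: P]%SET (x0 + t *: v)%R).
Hypothesis dkE : forall v, T v -> near0 (fun t => k (x0 + t *: v) = k x0 + t *: dk v)%R.
Hypothesis dk_shift : forall w, simplex_direction sigma w ->
  forall v, T v -> dk (v + w)%R = (dk v + dk w)%R.
Hypothesis dk'_lin : conewise_linear T' dk'.
Hypothesis T'_near : forall v : VR, T' v <-> near0 (fun t => cylinder Q ((x0, 1%R) + t *: v)%R).
Hypothesis dk'E : forall v : VR, T' v ->
  near0 (fun t => k' ((x0, 1) + t *: v) = k' (x0, 1) + t *: dk' v)%R.
Hypothesis dk'_shift : forall w, simplex_direction sigma w ->
  forall v : VR, T' v -> dk' (v + (w, 0))%R = (dk' v + dk' (w, 0))%R.

Lemma T_tangent v : T v <-> tangent [set: P]%SET v.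
Proof. by rewrite T_near tangentP // => p; rewrite inE. Qed.

Lemma T'_tangent (v : VR) : T' v <-> (v.2 <= 0)%R /\ tangent Q v.1.
Proof. by rewrite T'_near cylinder_tangentP. Qed.

Lemma near_derivative_unique (U : vectType R) (f : R -> U) y (v w : U) :
  near0 (fun t => f t = y + t *: v)%R -> near0 (fun t => f t = y + t *: w)%R -> v = w.
Proof.
move=> h1 h2; have [t t0 [-> /addrI /(scalerI _)]] := near0_ex (near0I h1 h2).
by apply; rewrite gt_eqF.
Qed.

Lemma x0_Q : realization Q x0.
Proof.
have [xpos xout x1] := x0_int.
have sup p : x0 p != 0%R -> p \in sigma by apply: contraNT => /xout ->.
split=> // [p|p /sup/s_Q//|p r /sup ps /sup rs]; last exact: s_chain.
by have [/xpos/ltW|/xout->] := boolP (p \in sigma).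
Qed.

Lemma realizationT S x : realization S x -> realization (R := R) [set: P]%SET x.
Proof. by move=> [? ? ? ?]; split=> // p _; rewrite inE. Qed.

Lemma kx0 : k x0 = (x0, 1%R). Proof. exact: kQ x0_Q. Qed.

Lemma k'x0 : k' (x0, 1%R) = x0.
Proof. by rewrite -kx0; case: kk' => _ _ _ _ [-> //]; apply: realizationT x0_Q. Qed.

(** On [|Q|] the map [k] only adds the constant height. *)
Lemma dk_Q v : tangent Q v -> dk v = (v, 0%R).
Proof.
move=> vQ; have vT : T v by apply/T_tangent; apply: tangentS vQ; apply/fintype.subsetP => p; rewrite inE.
apply: near_derivative_unique (dkE vT) _.
have := (tangentP v s_Q).1 vQ; apply: near0W => t _ h; rewrite kQ // kx0.
by congr (_, _); rewrite /= scaler0 addr0.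
Qed.

Lemma T'_dk v : T v -> T' (dk v).
Proof.
move=> vT; apply/T'_near; apply: near0W (near0I (dkE vT) ((T_near v).1 vT)) => t _ [kE h].
by rewrite -kx0 -kE; case: kk' => _ kC _ _ _; apply: kC.
Qed.

Lemma T_dk' (v : VR) : T' v -> T (dk' v).
Proof.
move=> vT; apply/T_near; apply: near0W (near0I (dk'E vT) ((T'_near v).1 vT)) => t _ [kE h].
by rewrite k'x0 in kE; rewrite -kE; case: kk' => _ _ _ kC _; apply: kC.
Qed.

Lemma dkK v : T v -> dk' (dk v) = v.
Proof.
move=> vT; apply: near_derivative_unique (dk'E (T'_dk vT)) _.
apply: near0W (near0I (dkE vT) ((T_near v).1 vT)) => t _ [kE h].
by rewrite k'x0 -{1}kx0 -kE; case: kk' => _ _ _ _ [-> //].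
Qed.

Lemma dk'K (v : VR) : T' v -> dk (dk' v) = v.
Proof.
move=> vT; apply: near_derivative_unique (dkE (T_dk' vT)) _.
apply: near0W (near0I (dk'E vT) ((T'_near v).1 vT)) => t _ [kE h].
by rewrite k'x0 in kE; rewrite kx0 -kE; case: kk' => _ _ _ _ [_ ->].
Qed.

Lemma dk_direction w : simplex_direction sigma w -> dk w = (w, 0%R).
Proof. by move=> /(direction_tangent Q)[wQ _]; apply: dk_Q. Qed.

Lemma dk'_direction w : simplex_direction sigma w -> dk' (w, 0%R) = w.
Proof.
move=> ws; have [wT _] := direction_tangent [set: P]%SET ws.
by rewrite -dk_direction // dkK //; apply/T_tangent.
Qed.

Notation B := (link q [set: P]%SET).
Notation L := (link q Q).

(** The map induced by the differential modulo the directions of the simplex; the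
    sign makes the downward direction the half-line of the collar. *)
Definition link_map u : VR := (above q (dk (centered u)).1, - (dk (centered u)).2)%R.
Definition link_inv (y : VR) : V := above q (dk' (centered y.1, - y.2))%R.

Lemma T_centered u : chain_cone B u -> T (centered u).
Proof. by move=> uB; apply/T_tangent; apply: tangent_centered. Qed.

Lemma T'_centered (y : VR) : half_cylinder L y -> T' (centered y.1, - y.2)%R.
Proof.
move=> [yL y0]; apply/T'_tangent; split; first by rewrite oppr_le0.
exact: tangent_centered.
Qed.

Lemma link_map_cone u : chain_cone B u -> half_cylinder L (link_map u).
Proof.
move=> /T_centered /T'_dk /T'_tangent[s0 [_ _ cL]].
by split=> //=; rewrite oppr_ge0.
Qed.

Lemma link_inv_cone (y : VR) : half_cylinder L y -> chain_cone B (link_inv y).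
Proof. by move=> /T'_centered /T_dk' /T_tangent[_ _ cB]. Qed.

(** Replacing the image of the differential by the representative [centered _]
    changes it by a direction of the simplex, which the inverse differential
    carries to itself and which has no part above [q]. *)
Lemma link_mapK u : chain_cone B u -> link_inv (link_map u) = u.
Proof.
move=> uB; have uT := T_centered uB; have dT := T'_dk uT.
have [s0 dQ] := (T'_tangent _).1 dT; have wd := tangent_remainder dQ.
rewrite /link_inv /link_map /= opprK.
set e := dk (centered u) in s0 dQ wd dT *.
have -> : (centered (above q e.1), e.2) = (e + (centered (above q e.1) - e.1, 0))%R.
  rewrite [in RHS](surjective_pairing e); congr (_, _) => /=; last by rewrite addr0.
  by rewrite addrC subrK.
rewrite dk'_shift // dk'_direction // /e dkK // -/e.
have [_ aw] := direction_tangent Q wd.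
by rewrite aboveD aw addr0 above_centered (above_link uB).
Qed.

Lemma link_invK (y : VR) : half_cylinder L y -> link_map (link_inv y) = y.
Proof.
move=> yL; have yT := T'_centered yL; have dT := T_dk' yT.
have dQ := (T_tangent _).1 dT; have wd := tangent_remainder dQ.
rewrite /link_inv /link_map.
set e := dk' (centered y.1, - y.2)%R in dQ wd dT *.
have -> : centered (above q e) = (e + (centered (above q e) - e))%R.
  by rewrite addrC subrK.
rewrite dk_shift // (dk_direction wd) /e dk'K // -/e /=.
rewrite [RHS]surjective_pairing addr0 opprK; congr (_, _).
have [_ aw] := direction_tangent Q wd.
by rewrite aboveD aw addr0 above_centered (above_link yL.1).
Qed.

Lemma link_map_base u : chain_cone L u -> link_map u = (u, 0%R).
Proof.
move=> uL; rewrite /link_map dk_Q /=; last exact: tangent_centered.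
by rewrite oppr0 above_centered (above_link uL).
Qed.

Lemma centered_linear : linear centered.
Proof.
move=> a x y; rewrite /centered; have -> := @mass_linear R _ _ [set: P]%SET a x y.
by rewrite scalerDl -scalerA scalerBr opprD addrACA.
Qed.

Lemma conewise_linear_pl (U W : vectType R) (X : set U) (f : U -> W) :
  conewise_linear X f -> pl_on X f.
Proof.
move=> [I [J [phi [l [XE fE]]]]].
apply: (@pl_on_cells _ _ _ I (fun i => [set v | forall j, (phi i j v <= 0)%R])) => // i.
  exact: (convex_cell_fin (phi := phi i) (b := fun=> 0%R)).
by exists (l i), 0%R => x h; rewrite addr0; apply: fE.
Qed.

Lemma polyhedron_half_cylinder (S : {set P}) : polyhedron (half_cylinder (R := R) S).
Proof.
apply: (@pl_on_seteq _ _ _ _ _ _ _ (polyhedronI (polyhedron_fst R^o (polyhedron_chain_cone R S))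
  (polyhedron_le (pl_on_cst (0%R : R^o) (@polyhedronT _ _)) (pl_on_snd_id (@polyhedronT _ _))))).
by move=> y; split=> -[].
Qed.

Lemma link_map_pl : pl_inverse (chain_cone B) (half_cylinder L) link_map link_inv.
Proof.
have pB := polyhedron_chain_cone R B.
have pL := polyhedron_half_cylinder L.
split.
- have p : pl_on (chain_cone B) (fun u => dk (centered u)).
    apply: pl_on_comp (conewise_linear_pl dk_lin) _; first exact: pl_on_linear pB centered_linear.
    exact: T_centered.
  exact: pl_on_pair (pl_on_above q (pl_on_fst p)) (pl_on_opp (pl_on_snd p)).
- exact: link_map_cone.
- apply: pl_on_above; apply: pl_on_comp (conewise_linear_pl dk'_lin) _; last exact: T'_centered.
  apply: pl_on_pair; last exact: pl_on_opp (pl_on_snd_id pL).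
  exact: pl_on_comp_linear (pl_on_fst_id pL) centered_linear.
- exact: link_inv_cone.
- by split; [exact: link_mapK|exact: link_invK].
Qed.

(** After composition with [pseudo_radial] the induced map preserves the mass, so it
    restricts to the slices of mass one, which are the link and the cone over
    [lk(q,Q)]. *)
Lemma link_collared : exists h : V -> VR,
  pl_homeo (realization B) (cone (realization (R := R) L)) h /\
  forall x, realization L x -> h x = cone_base x.
Proof.
have LB : L \subset B by apply/fintype.subsetP => p; rewrite !inE => /andP[].
have [I [J [phi [l [TE lE]]]]] := dk_lin.
pose w u : R := (total (link_map u).1 + (link_map u).2)%R.
have phic i j : linear (fun u => phi i j (centered u) : R^o).
  by move=> a x y; rewrite centered_linear linearP.
have lc i : linear (fun u => total (above q (l i (centered u)).1) - (l i (centered u)).2 : R^o)%R.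
  move=> a x y; rewrite centered_linear linearP /=.
  have -> : above q (a *: (l i (centered x)).1 + (l i (centered y)).1)%R =
      (a *: above q (l i (centered x)).1 + above q (l i (centered y)).1)%R.
    by apply/ffunP => p; rewrite !ffunE; case: ifP; rewrite ?scaler0 ?addr0.
  have -> := @mass_linear R _ _ [set: P]%SET a.
  by rewrite opprD addrACA scalerBr.
have link_map0 : link_map 0 = 0%R by rewrite link_map_base //; apply: chain_cone0.
have [] := @pseudo_radial R d P B L w I J (fun i j => packed_linear (phic i j))
  (fun i => packed_linear (lc i)).
- by move=> x /T_centered /TE.
- move=> i x xB h; rewrite /w /link_map (lE i) //.
- move=> x xB xn; have [h1 h2] := link_map_cone xB.
  have h3 : (0 <= total (link_map x).1)%R by apply: mass_ge0; case: h1.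
  rewrite lt_neqAle addr_ge0 // andbT eq_sym paddr_eq0 //; apply: contra xn.
  move=> /andP[/eqP y1 /eqP y2]; rewrite -(link_mapK xB) -(link_mapK (chain_cone0 R B)) link_map0.
  rewrite (surjective_pairing (link_map x)) y2 (total_eq0 _ y1) //.
  by case: h1.
- by move=> x xL; rewrite /w link_map_base //= addr0.
- exact: LB.
move=> f [g [fg wf fL]].
have pB : polyhedron (realization (R := R) B) := polyhedron_realization R B.
have pC : polyhedron (cone (realization (R := R) L)).
  have h := polyhedronI (polyhedron_half_cylinder L)
    (polyhedron_eq (pl_on_add (pl_on_mass [set: P]%SET (pl_on_fst_id (@polyhedronT R VR)))
      (pl_on_snd_id (@polyhedronT R VR))) (pl_on_cst (1%R : R^o) (@polyhedronT R VR))).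
  by apply: pl_on_seteq h => y; rewrite cone_realizationE; split=> -[].
have [pf mf pg mg [gf' fg']] := pl_inverse_comp fg link_map_pl.
have [_ fB _ gB [_ fgK]] := fg.
exists (link_map \o f); split; last first.
  move=> x /realizationE[xL _]; rewrite /= fL // link_map_base //.
apply/pl_homeoP; exists (g \o link_inv).
have sub1 x : realization B x -> chain_cone B x by move=> /realizationE[].
have sub2 (y : VR) : cone (realization L) y -> half_cylinder L y by move=> /cone_realizationE[].
split.
- exact: pl_on_sub pf pB sub1.
- move=> x /realizationE[xB x1]; apply/cone_realizationE; split; first exact: mf.
  by rewrite -x1; exact: wf.
- exact: pl_on_sub pg pC sub2.
- move=> y /cone_realizationE[yL y1]; apply/realizationE; split; first exact: mg.
  by rewrite -wf /= ?fgK ?/w ?link_invK //; [exact: link_inv_cone|exact: mg].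
- by split=> [x /sub1|y /sub2]; [exact: gf'|exact: fg'].
Qed.
End Link.

Lemma homeo_collared (h : V -> {ffun pplus clQ -> R^o}) :
    pl_homeo (realization [set: P]%SET) (realization [set: pplus clQ]%SET) h ->
    (forall x, realization Q x ->
       h x = pushforward (fun q : {q | q \in Q} => pplus_cyl clQ q I1) (restriction Q x)) ->
  collared R Q.
Proof.
move=> /pl_homeoP[h' hh'] hQ q qQ.
have kk' := pl_inverse_comp hh' (pl_inverse_cylinder R clQ).
set k := _ \o h in kk'; set k' := h' \o _ in kk'.
have kQ x : realization Q x -> k x = (x, 1%R).
  by move=> xQ; rewrite /k /= hQ //; have [] := top_end clQ xQ.
have [s [qs s_le s_chain s_max]] := maximal_chain q.
have [pk _ pk' _ _] := kk'.
have [K1 [phi1 [b1 D1]]] := pl_differential pk.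
have [K2 [phi2 [b2 D2]]] := pl_differential pk'.
have lin i : linear (fun x : V => phi2 i (x, 0%R) : R^o).
  move=> a x y; rewrite -linearP; congr (phi2 i (_, _)).
  by rewrite /= scaler0 addr0.
pose phi (i : K1 + K2) : {scalar V} :=
  match i with inl i => phi1 i | inr i => packed_linear (lin i) end.
pose b (i : K1 + K2) : R :=
  match i with inl i => b1 i | inr i => (b2 i - phi2 i (0, 1))%R end.
have [x0 xi gen] := generic_point phi b qs.
have xQ := x0_Q qQ s_le s_chain xi.
have kx0 := kQ _ xQ.
have [T [dk [h1 h2 h3 h4]]] := D1 x0 (realizationT xQ).
have cx : cylinder Q (x0, 1%R).
  by rewrite -kx0; have [_ kC _ _ _] := kk'; apply/kC/(realizationT xQ).
have [T' [dk' [h1' h2' h3' h4']]] := D2 _ cx.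
apply: (link_collared qQ kk' kQ qs s_le s_chain s_max xi h1 h2 h3 _ h1' h2' h3' _).
- move=> w wd v vT; apply: (h4 w _ v vT).2 => i e; exact: (gen (inl i) e w wd).
- move=> w wd v vT; apply: (h4' (w, 0%R) _ v vT).2 => i ix.
  apply: (gen (inr i) _ w wd); rewrite /= -ix.
  have -> : phi2 i (x0, 1%R) = (phi2 i (x0, 0) + phi2 i (0, 1))%R.
    by rewrite -raddfD; congr (phi2 i (_, _)); rewrite /= ?addr0 ?add0r.
  by rewrite addrK.
Qed.
End LinkCollar.

Theorem theorem12p3 (R : realType) (d : Order.disp_t) (P : finPOrderType d)
    (Q : {set P}) (clQ : closed_subposet Q) :
  collared R Q <->
  exists h : {ffun P -> R^o} -> {ffun pplus clQ -> R^o},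
    [/\ pl_homeo (realization (R := R) [set: P]%SET)
                 (realization (R := R) [set: pplus clQ]%SET) h,
        (forall x, realization (~: upper_set Q)%SET x ->
                   h x = pushforward (pplus_incl clQ) x) &
        (forall x, realization Q x ->
                   h x = pushforward (fun q => pplus_cyl clQ q I1)
                                     (restriction Q x))].
Proof.
split=> [|[h [hh _ hQ]]]; first exact: collared_homeo.
exact: homeo_collared hh hQ.
Qed.
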